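(* Let $n,m\ge3$ and let $\Gamma$ be an $(n,m)$-eight. Then the $\Bbbk$-vector space $\mathfrak m(\Gamma)/\mathfrak H(\Gamma)$ is zero if $n\not\equiv1\pmod3$ or $m\not\equiv1\pmod 3$, and is one-dimensional if $m\equiv n\equiv1\pmod3$.
   Context: Let $\Bbbk$ be a field. For a finite simple graph $\Gamma$ with vertices $t_1,\dots,t_s$, put $A=\Bbbk[t_1,\dots,t_s]$; for every edge $\{t_i,t_j\}$ take a degree-1 generator $e_{t_it_j}$; the Koszul complex $K(\Gamma)$ is the exterior algebra over $A$ on these generators with $A$-linear graded-derivation differential $d(e_{t_it_j})=t_it_j$, and $H(\Gamma)$ is its homology algebra. $K(\Gamma)$ is multigraded by monomials of $A$: $c\,m\,e_{i_1}\wedge\dots\wedge e_{i_k}$ ($c\in\Bbbk$, $m$ a monomial) has multidegree $m\,x_{i_1}\cdots x_{i_k}$, where $x_{i}$ is the edge monomial $t_at_b$ of $e_i$; $d$ preserves multidegree, so $H(\Gamma)$ is multigraded. The total degree of a multidegree is the sum of its exponents. $\mathfrak m(\Gamma)$ is the ideal of $H(\Gamma)$ spanned by homogeneous classes of positive total degree. For a subgraph $\Gamma'$ the inclusion induces $H(\Gamma')\to H(\Gamma)$. $\mathfrak H(\Gamma)$ is the ideal of $H(\Gamma)$ generated by the images of $\mathfrak m(\Gamma')$ over all proper subgraphs $\Gamma'\ne\Gamma$ (improper classes). Cycle graph of length $n$: vertices $t_1,\dots,t_n$, edges $t_it_{i+1}$ ($1\le i<n$) and $t_nt_1$. An $(n,m)$-eight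 is the connected graph obtained from a cycle of length $n$ and a cycle of length $m$ by identifying one vertex of the first with one vertex of the second. *)

(* Defs.v *)
From HB Require Import structures.
From mathcomp Require Import all_boot all_order all_algebra.
From mathcomp Require Import ring.
From mathcomp Require Import mpoly.
From mathcomp Require Import boolp.

Set Implicit Arguments.
Unset Strict Implicit.
Unset Printing Implicit Defensive.

Import GRing.Theory.
Local Open Scope ring_scope.
Local Open Scope quotient_scope.

(* The exterior algebra over [A] on generators indexed by [E]: the free
   [A]-module on the wedge monomials e_S, S : {set E}, the factors of e_S
   being taken in the order of [enum E]. *)
Definition ext (A : Type) (E : finType) := {ffun {set E} -> A}.

(* The number of transpositions needed to sort the word e_S e_T. *)
Definition inversions (E : finType) (S T : {set E}) : nat :=
  (\sum_(i in S) \sum_(j in T) (enum_rank j < enum_rank i))%N.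

Section ExteriorAlgebra.
Variables (A : comNzRingType) (E : finType).
Implicit Types (x y z : ext A E) (S T U W : {set E}) (i j : E).

HB.instance Definition _ := GRing.Zmodule.copy (ext A E) {ffun {set E} -> A}.

Definition ext_one : ext A E := [ffun U => (U == set0)%:R].

Definition ext_mul x y : ext A E :=
  [ffun U => \sum_(S : {set E}) \sum_(T : {set E} | [disjoint S & T] && (S :|: T == U))
               (-1) ^+ inversions S T * (x S * y T)].

Lemma inversions0l T : inversions set0 T = 0%N.
Proof. by rewrite /inversions big_set0. Qed.

Lemma inversions0r S : inversions S set0 = 0%N.
Proof. by rewrite /inversions big1 // => i _; rewrite big_set0. Qed.

Lemma inversionsUl S1 S2 T : [disjoint S1 & S2] ->
  inversions (S1 :|: S2) T = (inversions S1 T + inversions S2 T)%N.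
Proof.
by move=> dS; rewrite /inversions -bigU //; apply: eq_bigl => i; rewrite !inE.
Qed.

Lemma inversionsUr S T1 T2 : [disjoint T1 & T2] ->
  inversions S (T1 :|: T2) = (inversions S T1 + inversions S T2)%N.
Proof.
move=> dT; rewrite /inversions -big_split /=; apply: eq_bigr => i _.
by rewrite -bigU //; apply: eq_bigl => j; rewrite !inE.
Qed.

Lemma inversions_sym S T : [disjoint S & T] ->
  (inversions S T + inversions T S = #|S| * #|T|)%N.
Proof.
move=> dST; rewrite /inversions [X in (_ + X)%N]exchange_big -big_split /=.
rewrite -[#|S|]sum1_card big_distrl /=; apply: eq_bigr => i iS.
rewrite -big_split /= mul1n -[#|T|]sum1_card; apply: eq_bigr => j jT.
have : enum_rank i != enum_rank j.
  by apply: contraTneq jT => /enum_rank_inj <-; rewrite (disjointFr dST iS).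
by rewrite -val_eqE /=; case: ltngtP.
Qed.

Let c S T U : A :=
  if [disjoint S & T] && (S :|: T == U) then (-1) ^+ inversions S T else 0.

Let cE x y U :
  ext_mul x y U = \sum_(S : {set E}) \sum_(T : {set E}) c S T U * (x S * y T).
Proof.
rewrite ffunE; apply: eq_bigr => S _; rewrite big_mkcond /=.
by apply: eq_bigr => T _; rewrite /c; case: ifP; rewrite ?mul0r.
Qed.

Let c_sum (F : {set E} -> A) S T :
  \sum_(W : {set E}) c S T W * F W =
  if [disjoint S & T] then (-1) ^+ inversions S T * F (S :|: T) else 0.
Proof.
rewrite (bigD1 (S :|: T)) //= big1 ?addr0 => [|W nW].
  by rewrite /c eqxx andbT; case: ifP; rewrite ?mul0r.
by rewrite /c eq_sym (negPf nW) andbF mul0r.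
Qed.

Let cA S T U W :
  \sum_(P : {set E}) c S T P * c P U W = \sum_(P : {set E}) c T U P * c S P W.
Proof.
rewrite !c_sum /c setUA -!setI_eq0 setIUl setIUr !setU_eq0.
case: (_ == W); last by rewrite !andbF !mulr0 !if_same.
rewrite !andbT.
case ST: (S :&: T == set0); case TU: (T :&: U == set0);
  case SU: (S :&: U == set0); rewrite /= ?mulr0 //.
rewrite inversionsUl -?setI_eq0 // inversionsUr -?setI_eq0 //.
by rewrite -!exprD; congr (_ ^+ _); rewrite addnA addnC.
Qed.

Let ext_mulA : associative ext_mul.
Proof.
move=> x y z; apply/ffunP => W; rewrite !cE.
transitivity (\sum_(S : {set E}) \sum_(T : {set E}) \sum_(U : {set E})
   (\sum_(P : {set E}) c T U P * c S P W) * (x S * y T * z U)).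
  apply: eq_bigr => S _.
  transitivity (\sum_(P : {set E}) \sum_(T : {set E}) \sum_(U : {set E})
     c T U P * c S P W * (x S * y T * z U)).
    apply: eq_bigr => P _; rewrite cE !big_distrr /=; apply: eq_bigr => T _.
    by rewrite !big_distrr /=; apply: eq_bigr => U _; ring.
  rewrite exchange_big /=; apply: eq_bigr => T _.
  by rewrite exchange_big /=; apply: eq_bigr => U _; rewrite big_distrl.
under eq_bigr do under eq_bigr do under eq_bigr do rewrite -cA.
under [RHS]eq_bigr => P _ do under eq_bigr => U _ do
  rewrite cE big_distrl big_distrr /=.
transitivity (\sum_(P : {set E}) \sum_(U : {set E}) \sum_(S : {set E})
  \sum_(T : {set E}) c S T P * c P U W * (x S * y T * z U)); last first.
  apply: eq_bigr => P _; apply: eq_bigr => U _; apply: eq_bigr => S _.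
  by rewrite big_distrl big_distrr /=; apply: eq_bigr => T _; ring.
under eq_bigr do under eq_bigr do under eq_bigr do rewrite big_distrl /=.
rewrite [RHS]exchange_big /=.
under [RHS]eq_bigr do rewrite exchange_big /=.
rewrite [RHS]exchange_big /=; apply: eq_bigr => S _.
under [RHS]eq_bigr do rewrite exchange_big /=.
by rewrite [RHS]exchange_big.
Qed.

Let ext_mul1 : left_id ext_one ext_mul.
Proof.
move=> x; apply/ffunP => U; rewrite cE (bigD1 set0) //= [X in _ + X]big1.
  rewrite (bigD1 U) //= big1 => [|T nT]; rewrite /c ffunE eqxx set0U.
    by rewrite -setI_eq0 set0I !eqxx inversions0l !mul1r !addr0.
  by rewrite (negPf nT) andbF mul0r.
by move=> S nS; rewrite big1 // => T _; rewrite ffunE (negPf nS) mul0r mulr0.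
Qed.

Let ext_mulr1 : right_id ext_one ext_mul.
Proof.
move=> x; apply/ffunP => U; rewrite cE (bigD1 U) //= [X in _ + X]big1.
  rewrite (bigD1 set0) //= big1 => [|T nT]; rewrite /c ffunE.
    by rewrite setU0 -setI_eq0 setI0 !eqxx inversions0r mul1r mulr1 !addr0.
  by rewrite (negPf nT) !mulr0.
move=> S nS; rewrite big1 // => T _; rewrite /c ffunE.
have [->|_] := eqVneq T set0; last by rewrite !mulr0.
by rewrite setU0 (negPf nS) andbF mul0r.
Qed.

Let ext_mulDl : left_distributive ext_mul +%R.
Proof.
move=> x y z; apply/ffunP => U; rewrite [RHS]ffunE !cE -big_split /=.
apply: eq_bigr => S _; rewrite -big_split /=; apply: eq_bigr => T _.
by rewrite ffunE; ring.
Qed.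

Let ext_mulDr : right_distributive ext_mul +%R.
Proof.
move=> x y z; apply/ffunP => U; rewrite [RHS]ffunE !cE -big_split /=.
apply: eq_bigr => S _; rewrite -big_split /=; apply: eq_bigr => T _.
by rewrite ffunE; ring.
Qed.

Let ext_1neq0 : ext_one != 0.
Proof. by apply/eqP => /ffunP/(_ set0)/eqP; rewrite !ffunE eqxx oner_eq0. Qed.

HB.instance Definition _ := GRing.Zmodule_isNzRing.Build (ext A E)
  ext_mulA ext_mul1 ext_mulr1 ext_mulDl ext_mulDr ext_1neq0.

Lemma extM x y U : (x * y) U =
  \sum_(S : {set E}) \sum_(T : {set E} | [disjoint S & T] && (S :|: T == U))
    (-1) ^+ inversions S T * (x S * y T).
Proof. by rewrite [LHS]ffunE. Qed.

Lemma ext1 U : (1 : ext A E) U = (U == set0)%:R.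
Proof. by rewrite [LHS]ffunE. Qed.

(* The [A]-linear graded derivation sending the generator e_i to [f i]:
     e_{i_1} ... e_{i_p} |-> \sum_q (-1)^q f_{i_q} e_{i_1} .. ^e_{i_q} .. e_{i_p};
   [inversions [set i] U] is the position of i in the sorted word e_{i |: U}. *)
Definition koszul (f : E -> A) x : ext A E :=
  [ffun U : {set E} =>
     \sum_(i | i \notin U) (-1) ^+ inversions [set i] U * (f i * x (i |: U))].

Definition parity x : ext A E := [ffun S : {set E} => (-1) ^+ #|S| * x S].

Definition ext_gen i : ext A E := [ffun U => (U == [set i])%:R].

Let ext_genM i j U : (ext_gen i * ext_gen j) U = c [set i] [set j] U.
Proof.
rewrite [LHS]cE (bigD1 [set i]) //= [X in _ + X]big1 => [|S nS]; last first.
  by rewrite big1 // => T _; rewrite ffunE (negPf nS) mul0r mulr0.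
rewrite (bigD1 [set j]) //= big1 => [|T nT]; last first.
  by rewrite [ext_gen j T]ffunE (negPf nT) !mulr0.
by rewrite !ffunE !eqxx !mulr1 !addr0.
Qed.

Lemma ext_gen_sqr i : ext_gen i * ext_gen i = 0.
Proof.
by apply/ffunP => U; rewrite ext_genM /c disjoints1 inE eqxx [RHS]ffunE.
Qed.

Lemma ext_gen_anticomm i j : ext_gen i * ext_gen j = - (ext_gen j * ext_gen i).
Proof.
have [->|ij] := eqVneq i j; first by rewrite ext_gen_sqr oppr0.
apply/ffunP => U; rewrite [RHS]ffunE !ext_genM /c !disjoints1 !inE [j == i]eq_sym ij.
rewrite setUC; case: (_ == U); rewrite ?oppr0 //= /inversions !big_set1.
move: ij; rewrite -(inj_eq enum_rank_inj) -val_eqE /=.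
by case: ltngtP; rewrite // ?expr1 ?expr0 ?opprK.
Qed.

Lemma koszul_is_zmod_morphism f : zmod_morphism (koszul f).
Proof.
move=> x y; apply/ffunP => U; rewrite !ffunE -sumrB.
by apply: eq_bigr => i _; rewrite !ffunE; ring.
Qed.

HB.instance Definition _ f :=
  GRing.isZmodMorphism.Build (ext A E) (ext A E) (koszul f)
    (koszul_is_zmod_morphism f).

Lemma koszul_gen f i : koszul f (ext_gen i) = [ffun U => f i * (U == set0)%:R].
Proof.
apply/ffunP => U; rewrite !ffunE; have [->|nU] := eqVneq U set0.
  rewrite (bigD1 i) ?inE //= big1 => [|j /andP[_ ji]]; rewrite ffunE setU0.
    by rewrite inversions0r eqxx mul1r addr0.
  by rewrite (inj_eq set1_inj) (negPf ji) !mulr0.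
rewrite mulr0 big1 // => j jU; rewrite ffunE; case: eqP => [e|]; rewrite ?mulr0 //.
case/set0Pn: nU => l lU; have: l \in j |: U by rewrite !inE lU orbT.
have: j \in j |: U by rewrite !inE eqxx.
by rewrite e !inE => /eqP jE /eqP lE; rewrite jE -lE lU in jU.
Qed.

Let dl i S U : A :=
  if (i \notin U) && (S == i |: U) then (-1) ^+ inversions [set i] U else 0.

Let dlE f x U :
  koszul f x U = \sum_i \sum_(S : {set E}) dl i S U * (f i * x S).
Proof.
rewrite ffunE big_mkcond; apply: eq_bigr => i _.
rewrite (bigD1 (i |: U)) //= big1 => [|S nS]; rewrite /dl ?(negPf nS) ?andbF.
  by rewrite eqxx andbT addr0; case: ifP; rewrite ?mul0r.
by rewrite mul0r.
Qed.

Let dl_suml (F : {set E} -> A) i U : \sum_(S : {set E}) F S * dl i S U =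
  if i \in U then 0 else F (i |: U) * (-1) ^+ inversions [set i] U.
Proof.
rewrite (bigD1 (i |: U)) //= big1 => [|S nS]; rewrite /dl ?(negPf nS) ?andbF.
  by rewrite eqxx andbT addr0; case: (i \in U); rewrite ?mulr0.
by rewrite mulr0.
Qed.

Let dl_sumr (F : {set E} -> A) i S : \sum_(W : {set E}) dl i S W * F W =
  if i \in S then (-1) ^+ inversions [set i] (S :\ i) * F (S :\ i) else 0.
Proof.
case: ifP => [iS|niS]; last first.
  apply: big1 => W _; rewrite /dl; case: eqP niS => [->|]; rewrite ?inE ?eqxx //.
  by rewrite andbF mul0r.
rewrite (bigD1 (S :\ i)) //= big1 => [|W nW]; rewrite /dl ?setD1K ?eqxx ?andbT //.
  by rewrite !inE eqxx /= addr0.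
case: ifP => [/andP[iW /eqP SE]|]; last by rewrite mul0r.
by rewrite SE setU1K ?eqxx in nW.
Qed.

Let setU1P i S : i \in S -> exists2 S' : {set E}, i \notin S' & S = i |: S'.
Proof. by move=> iS; exists (S :\ i); rewrite ?setD1K // !inE eqxx. Qed.

Let disjU1 i S T : [disjoint i |: S & T] = (i \notin T) && [disjoint S & T].
Proof. by rewrite -!setI_eq0 setIUl setU_eq0 setI_eq0 disjoints1. Qed.

Let disjU1r i S T : [disjoint S & i |: T] = (i \notin S) && [disjoint S & T].
Proof. by rewrite disjoint_sym disjU1 disjoint_sym. Qed.

Let eqU1 i (X U : {set E}) : i \notin X -> (i \notin U) && (i |: X == i |: U) = (X == U).
Proof.
move=> iX; apply/andP/eqP => [[iU /eqP e]|<-] //.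
by rewrite -(setU1K iX) e setU1K.
Qed.

Let invU1l i S T : i \notin S ->
  inversions (i |: S) T = (inversions [set i] T + inversions S T)%N.
Proof. by move=> iS; rewrite inversionsUl // disjoints1. Qed.

Let invU1r i S T : i \notin T ->
  inversions S (i |: T) = (inversions S [set i] + inversions S T)%N.
Proof. by move=> iT; rewrite inversionsUr // disjoints1. Qed.

Let c_dl i S T U : \sum_(W : {set E}) c S T W * dl i W U =
  \sum_(W : {set E}) dl i S W * c W T U +
  (-1) ^+ #|S| * \sum_(W : {set E}) dl i T W * c S W U.
Proof.
rewrite dl_suml !dl_sumr.
have sgn (S' : {set E}) : i \notin S' ->
  (-1) ^+ #|S'| = (-1) ^+ inversions [set i] S' * (-1) ^+ inversions S' [set i] :> A.
  by move=> iS'; rewrite -exprD inversions_sym ?disjoints1 // cards1 mul1n.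
have sq n : (-1) ^+ n * (-1) ^+ n = 1 :> A by rewrite -expr2 sqrr_sign.
case iS: (i \in S); case iT: (i \in T); rewrite ?mulr0 ?addr0 ?add0r.
- have [S' iS' ->] := setU1P iS; have [T' iT' ->] := setU1P iT.
  rewrite !setU1K // /c disjU1 !inE eqxx /= mul0r if_same.
  rewrite disjU1 disjU1r iS' iT' /= -setUA [S' :|: _]setUCA.
  case: ifP => _; rewrite ?mulr0 ?addr0 // invU1l // invU1r // cardsU1 iS' /=.
  rewrite !exprD sgn // expr1.
  set a := (-1) ^+ _; set b := (-1) ^+ _; set p := (-1) ^+ _.
  set q := (-1) ^+ _.
  have pp : q * q = 1 by exact: sq.
  by transitivity (a * (b * p) * (1 - q * q)); [rewrite pp subrr mulr0 | ring].
- have [S' iS' ->] := setU1P iS; rewrite !setU1K // /c disjU1 iT /= -setUA.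
  case: ifP => iU.
    case: ifP => [/andP[_ /eqP UE]|]; last by rewrite mulr0.
    by rewrite -UE !inE (negPf iS') iT in iU.
  have iST : i \notin S' :|: T by rewrite !inE (negPf iS') iT.
  rewrite -(eqU1 U iST) iU /=; case: ifP => [/andP[dST /eqP e]|]; last first.
    by rewrite mulr0 mul0r.
  have -> : U = S' :|: T by rewrite -(setU1K iST) e setU1K ?iU.
  rewrite invU1l // inversionsUr // !exprD.
  set p := (-1) ^+ inversions [set i] T; rewrite -[RHS]mulr1 -(sq (inversions [set i] T)).
  by rewrite -/p; ring.
- have [T' iT' ->] := setU1P iT; rewrite !setU1K // /c disjU1r iS /= setUCA.
  case: ifP => iU.
    case: ifP => [/andP[_ /eqP UE]|]; last by rewrite !mulr0.
    by rewrite -UE !inE (negPf iT') iS in iU.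
  have iST : i \notin S :|: T' by rewrite !inE (negPf iT') iS.
  rewrite -(eqU1 U iST) iU /=; case: ifP => [/andP[dST /eqP e]|]; last first.
    by rewrite !mulr0 mul0r.
  have -> : U = S :|: T' by rewrite -(setU1K iST) e setU1K ?iU.
  by rewrite invU1r // inversionsUr // !exprD sgn ?iS //; ring.
- rewrite /c; case: ifP => // iU; case: ifP => [/andP[_ /eqP e]|]; last first.
    by rewrite mul0r.
  have /negP[] : i \notin i |: U by rewrite -e !inE iS iT.
  by rewrite !inE eqxx.
Qed.

Lemma koszulM f x y :
  koszul f (x * y) = koszul f x * y + parity x * koszul f y.
Proof.
apply/ffunP => U; rewrite dlE ffunE.
transitivity (\sum_i \sum_(S : {set E}) \sum_(T : {set E})
   (\sum_(W : {set E}) c S T W * dl i W U) * (f i * x S * y T)).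
  apply: eq_bigr => i _.
  transitivity (\sum_(W : {set E}) \sum_(S : {set E}) \sum_(T : {set E})
    c S T W * dl i W U * (f i * x S * y T)).
    apply: eq_bigr => W _; rewrite [(x * y) W]cE !big_distrr /=.
    apply: eq_bigr => S _; rewrite !big_distrr /=; apply: eq_bigr => T _; ring.
  rewrite exchange_big; apply: eq_bigr => S _.
  by rewrite exchange_big; apply: eq_bigr => T _; rewrite big_distrl.
under eq_bigr do under eq_bigr do under eq_bigr do rewrite c_dl mulrDl.
under eq_bigr do under eq_bigr do rewrite big_split.
under eq_bigr do rewrite big_split.
rewrite big_split /=; congr (_ + _).
  rewrite [RHS]cE; transitivity (\sum_(W : {set E}) \sum_(T : {set E}) \sum_i
    \sum_(S : {set E}) dl i S W * c W T U * (f i * x S * y T)); last first.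
    apply: eq_bigr => W _; apply: eq_bigr => T _; rewrite dlE.
    rewrite big_distrl big_distrr /=; apply: eq_bigr => i _.
    by rewrite big_distrl big_distrr /=; apply: eq_bigr => S _; ring.
  under eq_bigr do under eq_bigr do under eq_bigr do rewrite big_distrl /=.
  under [RHS]eq_bigr do rewrite exchange_big /=.
  rewrite [RHS]exchange_big /=; apply: eq_bigr => i _.
  under [RHS]eq_bigr do rewrite exchange_big /=.
  rewrite [RHS]exchange_big /=; apply: eq_bigr => S _.
  by rewrite [RHS]exchange_big.
rewrite [RHS]cE; transitivity (\sum_(S : {set E}) \sum_(W : {set E}) \sum_i
  \sum_(T : {set E}) (-1) ^+ #|S| * (dl i T W * c S W U) * (f i * x S * y T));
  last first.
  apply: eq_bigr => S _; apply: eq_bigr => W _; rewrite dlE ffunE.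
  rewrite !big_distrr /=; apply: eq_bigr => i _.
  by rewrite !big_distrr /=; apply: eq_bigr => T _; ring.
rewrite exchange_big /=; apply: eq_bigr => S _.
rewrite [RHS]exchange_big /=; apply: eq_bigr => i _.
rewrite [RHS]exchange_big /=; apply: eq_bigr => T _.
by rewrite big_distrr big_distrl.
Qed.

Lemma parityK : involutive parity.
Proof. by move=> x; apply/ffunP => S; rewrite !ffunE signrMK. Qed.

Lemma parity_koszul f x : parity (koszul f x) = - koszul f (parity x).
Proof.
apply/ffunP => U; rewrite !ffunE big_distrr -sumrN /=; apply: eq_bigr => i iU.
by rewrite ffunE cardsU1 iU exprS; ring.
Qed.

Lemma koszul_koszul f x : koszul f (koszul f x) = 0.
Proof.
apply/ffunP => U; rewrite [RHS]ffunE ffunE.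
pose h i j : A := if [&& i \notin U, j \notin U & i != j] then
  (-1) ^+ inversions [set i] U * (-1) ^+ inversions [set j] U *
  (-1) ^+ (enum_rank i < enum_rank j)%N * (f i * f j * x (i |: (j |: U))) else 0.
transitivity (\sum_i \sum_j h i j).
  rewrite big_mkcond; apply: eq_bigr => i _; case: ifP => iU; last first.
    by rewrite big1 // => j _; rewrite /h iU.
  rewrite ffunE !big_distrr /= big_mkcond; apply: eq_bigr => j _.
  rewrite /h iU !inE negb_or andbC eq_sym /=; case: ifP => // /andP[jU ij].
  rewrite invU1r // exprD /inversions !big_set1 setUCA.
  by rewrite -/(inversions _ _); ring.
have hN i j : h i j = - h j i.
  rewrite /h [j == i]eq_sym andbCA; case: ifP => [/and3P[_ _ ij]|]; last by rewrite oppr0.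
  have : enum_rank i != enum_rank j by rewrite (inj_eq enum_rank_inj).
  rewrite -val_eqE setUCA /=.
  by case: ltngtP => // _ _; rewrite ?expr0 ?expr1; ring.
have hd i : h i i = 0 by rewrite /h eqxx !andbF.
pose lt i j := (enum_rank i < enum_rank j)%N.
transitivity (\sum_i \sum_(j | lt i j) h i j + \sum_i \sum_(j | lt j i) h i j).
  rewrite -big_split; apply: eq_bigr => i _ /=; rewrite (bigD1 i) //= hd add0r.
  rewrite (bigID (lt i)) /=; congr (_ + _); apply: eq_bigl => j;
    rewrite -(inj_eq enum_rank_inj) -val_eqE /lt /=; by case: ltngtP.
rewrite [X in _ + X](exchange_big_dep xpredT) //= -big_split big1 // => i _.
by rewrite -big_split big1 // => j _; rewrite /= hN addNr.
Qed.

End ExteriorAlgebra.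
Section ExteriorKAlgebra.
Variables (k : comNzRingType) (A : comAlgType k) (E : finType).
Implicit Types (x y : ext A E) (a : k).

HB.instance Definition _ := GRing.Lmodule.copy (ext A E) {ffun {set E} -> A}.

Lemma extZ a x (U : {set E}) : (a *: x) U = a *: x U.
Proof. by rewrite [LHS]ffunE. Qed.

Let ext_scalerAl a x y : a *: (x * y) = (a *: x) * y.
Proof.
apply/ffunP => U; rewrite extZ !extM scaler_sumr; apply: eq_bigr => S _.
rewrite scaler_sumr; apply: eq_bigr => T _.
by rewrite extZ -scalerAl -scalerAr.
Qed.

HB.instance Definition _ :=
  GRing.Lmodule_isLalgebra.Build k (ext A E) ext_scalerAl.

Let ext_scalerAr a x y : a *: (x * y) = x * (a *: y).
Proof.
apply/ffunP => U; rewrite extZ !extM scaler_sumr; apply: eq_bigr => S _.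
rewrite scaler_sumr; apply: eq_bigr => T _.
by rewrite extZ -!scalerAr.
Qed.

HB.instance Definition _ :=
  GRing.Lalgebra_isAlgebra.Build k (ext A E) ext_scalerAr.

Lemma koszulZ (f : E -> A) a x : koszul f (a *: x) = a *: koszul f x.
Proof.
apply/ffunP => U; rewrite extZ !ffunE scaler_sumr; apply: eq_bigr => i _.
by rewrite extZ -!scalerAr.
Qed.

HB.instance Definition _ (f : E -> A) :=
  GRing.isScalable.Build k (ext A E) (ext A E) *:%R (koszul f) (koszulZ f).

End ExteriorKAlgebra.

Definition linear_span (k : fieldType) (V : lmodType k) (X : V -> Prop) (v : V) :
    Prop :=
  exists (n : nat) (c : 'I_n -> k) (x : 'I_n -> V),
    (forall i, X (x i)) /\ v = \sum_i c i *: x i.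

Definition ideal_span (R : nzRingType) (X : R -> Prop) (a : R) : Prop :=
  exists (n : nat) (l x r : 'I_n -> R),
    (forall i, X (x i)) /\ a = \sum_i l i * x i * r i.

(* N is contained in M, and the classes of some b_0, .., b_(d-1) in M form a
   basis of M / N; the subsets M and N are meant to be linear subspaces. *)
Definition quotient_dim (k : fieldType) (V : lmodType k) (M N : V -> Prop)
    (d : nat) : Prop :=
  (forall v, N v -> M v) /\
  exists b : 'I_d -> V,
    (forall i, M (b i)) /\
    forall v, M v -> exists! c : 'rV[k]_d, N (v - \sum_i c 0 i *: b i).

Record graph (s : nat) := Graph {
  verts : {set 'I_s};
  edges : {set {set 'I_s}};
  edgesP : [forall e in edges, (#|e| == 2) && (e \subset verts)]
}.

Definition subgraph s (G' G : graph s) : bool :=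
  (verts G' \subset verts G) && (edges G' \subset edges G).

Definition is_cycle s (n : nat) (C : graph s) : Prop :=
  exists p : 'I_n -> 'I_s,
    [/\ injective p, verts C = [set p i | i : 'I_n]
      & edges C = [set [set p i; p (ordS i)] | i : 'I_n]].

(* Gluing at one vertex, up to isomorphism: the two cycles meet only in v. *)
Definition is_eight s (n m : nat) (G : graph s) : Prop :=
  exists C1 C2 : graph s,
    [/\ is_cycle n C1, is_cycle m C2,
        exists v, verts C1 :&: verts C2 = [set v],
        verts G = verts C1 :|: verts C2
      & edges G = edges C1 :|: edges C2].

Definition edge_mnm s (e : {set 'I_s}) : 'X_{1..s} :=
  [multinom (i \in e : nat) | i < s].

(* All the complexes K(G), G : graph s, live in this algebra, whose generators
   are indexed by arbitrary sets of variables. *)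
Notation koszul_ambient k s := (ext {mpoly k[s]} {set 'I_s}).

Section KoszulComplex.
Variables (k : fieldType) (s : nat).
Local Notation K := (koszul_ambient k s).
Implicit Types (G : graph s) (x y z : K).

Definition edge_poly (e : {set 'I_s}) : {mpoly k[s]} := 'X_[edge_mnm e].

Definition dK : K -> K := koszul edge_poly.

HB.instance Definition _ := GRing.Linear.on dK.

Definition in_vars (W : {set 'I_s}) (p : {mpoly k[s]}) : bool :=
  all (fun m : 'X_{1..s} => [forall i, (m i != 0%N) ==> (i \in W)]) (msupp p).

(* K(G): exterior polynomials in the edges of G, with coefficients in the
   polynomial ring on the vertices of G. *)
Definition koszul_of G : {pred K} :=
  [pred x : K | [forall F : {set {set 'I_s}},
     in_vars (verts G) (x F) && ((x F != 0) ==> (F \subset edges G))]].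

Lemma in_varsP (W : {set 'I_s}) (p : {mpoly k[s]}) :
  reflect (forall m, m \in msupp p -> forall i, m i != 0%N -> i \in W)
    (in_vars W p).
Proof.
apply: (iffP allP) => h m /h; first by move=> /forallP h' i; apply/implyP.
by move=> h'; apply/forallP => i; apply/implyP/h'.
Qed.

Lemma in_vars0 (W : {set 'I_s}) : in_vars W 0.
Proof. by rewrite /in_vars msupp0. Qed.

Lemma in_vars1 (W : {set 'I_s}) : in_vars W 1.
Proof.
by apply/in_varsP => m; rewrite msupp1 inE => /eqP -> i; rewrite mnm0E.
Qed.

Lemma in_varsD (W : {set 'I_s}) p q : in_vars W p -> in_vars W q -> in_vars W (p + q).
Proof.
move=> /in_varsP hp /in_varsP hq; apply/in_varsP => m /msuppD_le.
by rewrite mem_cat => /orP[/hp|/hq].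
Qed.

Lemma in_varsM (W : {set 'I_s}) p q : in_vars W p -> in_vars W q -> in_vars W (p * q).
Proof.
move=> /in_varsP hp /in_varsP hq; apply/in_varsP => m /msuppM_le /allpairsP.
case=> -[m1 m2] /= [/hp h1 /hq h2 ->] i; rewrite mnmDE addn_eq0 negb_and.
by case/orP=> [/h1|/h2].
Qed.

Lemma in_varsZ (W : {set 'I_s}) a p : in_vars W p -> in_vars W (a *: p).
Proof. by move=> /in_varsP hp; apply/in_varsP => m /msuppZ_le /hp. Qed.

Lemma in_vars_sign (W : {set 'I_s}) n p : in_vars W p -> in_vars W ((-1) ^+ n * p).
Proof.
by rewrite -signr_odd mulr_sign; case: odd; rewrite // -scaleN1r; apply: in_varsZ.
Qed.

Lemma in_vars_sum (W : {set 'I_s}) (I : finType) (P : pred I) (f : I -> {mpoly k[s]}) :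
  (forall i, P i -> in_vars W (f i)) -> in_vars W (\sum_(i | P i) f i).
Proof. by move=> h; elim/big_ind: _ => //; [apply: in_vars0 | apply: in_varsD]. Qed.

Lemma edges_sub G e : e \in edges G -> e \subset verts G.
Proof. by have /forall_inP h := edgesP G; move=> /h /andP[]. Qed.

Lemma edges_card G e : e \in edges G -> #|e| = 2.
Proof. by have /forall_inP h := edgesP G; move=> /h /andP[/eqP]. Qed.

Lemma in_vars_edge G e : e \in edges G -> in_vars (verts G) (edge_poly e).
Proof.
move=> /edges_sub /subsetP eG; apply/in_varsP => m.
rewrite msuppX inE => /eqP -> i; rewrite mnmE.
by case ie: (i \in e) => // _; apply: eG.
Qed.

Lemma koszul_ofP G x : reflect
  (forall F, in_vars (verts G) (x F) /\ (x F != 0 -> F \subset edges G))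
  (x \in koszul_of G).
Proof.
apply: (iffP forallP) => h F; have := h F.
  by case/andP=> -> /implyP.
by case=> -> h'; apply/implyP.
Qed.

Lemma koszul_of_subalg_closed G : subalg_closed (koszul_of G).
Proof.
split=> [|a x y /koszul_ofP hx /koszul_ofP hy|x y /koszul_ofP hx /koszul_ofP hy];
  apply/koszul_ofP => F.
- rewrite ext1; case: eqP => [->|_]; last by rewrite in_vars0 eqxx.
  by rewrite in_vars1 sub0set.
- rewrite ffunE extZ; have [hx1 hx2] := hx F; have [hy1 hy2] := hy F; split.
    by apply: in_varsD => //; apply: in_varsZ.
  have [x0|/hx2 //] := eqVneq (x F) 0; have [y0|/hy2 //] := eqVneq (y F) 0.
  by rewrite x0 y0 scaler0 addr0 eqxx.
rewrite extM; split.
  apply: in_vars_sum => S _; apply: in_vars_sum => T _.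
  apply: in_vars_sign; apply: in_varsM; first by have [] := hx S.
  by have [] := hy T.
apply: contraR => FG; rewrite big1 // => S _; rewrite big1 // => T.
case/andP=> _ /eqP FE; have [->|xS] := eqVneq (x S) 0; first by rewrite mul0r mulr0.
have [->|yT] := eqVneq (y T) 0; first by rewrite !mulr0.
by rewrite -FE subUset (hx S).2 ?(hy T).2 in FG.
Qed.

HB.instance Definition _ G :=
  GRing.isSubalgClosed.Build k K (koszul_of G) (GRing.subalg_closed_semi (koszul_of_subalg_closed G)).

Lemma koszul_of_dK G x : x \in koszul_of G -> dK x \in koszul_of G.
Proof.
move=> /koszul_ofP hx; apply/koszul_ofP => F; rewrite ffunE.
have nz i : x (i |: F) != 0 -> i \in edges G /\ F \subset edges G.
  by move=> /(hx _).2; rewrite subUset sub1set => /andP.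
split.
  apply: in_vars_sum => i _; apply: in_vars_sign.
  have [->|/nz[iG _]] := eqVneq (x (i |: F)) 0; first by rewrite mulr0 in_vars0.
  by apply: in_varsM; [apply: in_vars_edge | have [] := hx (i |: F)].
apply: contraR => FG; rewrite big1 // => i _.
by have [->|/nz[_ /idPn[]]] := eqVneq (x (i |: F)) 0; rewrite ?mulr0.
Qed.

Lemma koszul_of_parity G x : x \in koszul_of G -> parity x \in koszul_of G.
Proof.
move=> /koszul_ofP hx; apply/koszul_ofP => F; rewrite ffunE; split.
  by apply: in_vars_sign; have [] := hx F.
by rewrite -signr_odd mulr_sign; case: odd; rewrite ?oppr_eq0; have [] := hx F.
Qed.

Lemma koszul_of_sub G' G :
  subgraph G' G -> {subset koszul_of G' <= koszul_of G}.
Proof.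
case/andP=> /subsetP sV sE x /koszul_ofP hx; apply/koszul_ofP => F; split.
  by apply/in_varsP => m mx i mi; apply/sV/(in_varsP _ _ (hx F).1 m mx).
by move=> /(hx F).2 FG; apply: subset_trans sE.
Qed.

Definition cycles G : {pred K} := [pred x : K | (x \in koszul_of G) && (dK x == 0)].

Lemma cycles_subalg_closed G : subalg_closed (cycles G).
Proof.
split=> [|a x y /andP[xK /eqP dx] /andP[yK /eqP dy]|
          x y /andP[xK /eqP dx] /andP[yK /eqP dy]]; rewrite inE.
- rewrite rpred1 /=; apply/eqP/ffunP => U; rewrite !ffunE big1 // => e _.
  rewrite ext1; case: eqP => [e0|]; rewrite ?mulr0 //.
  by have := setU11 e U; rewrite e0 inE.
- by rewrite rpredD ?rpredZ //= linearP /= dx dy scaler0 addr0.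
by rewrite rpredM //= /dK koszulM [koszul _ x]dx [koszul _ y]dy mul0r mulr0 addr0.
Qed.

HB.instance Definition _ G :=
  GRing.isSubalgClosed.Build k K (cycles G) (GRing.subalg_closed_semi (cycles_subalg_closed G)).

Record cycle G := Cycle { cycle_val : K; _ : cycle_val \in cycles G }.

HB.instance Definition _ G := [isSub for @cycle_val G].
HB.instance Definition _ G := [Choice of cycle G by <:].
HB.instance Definition _ G := [SubChoice_isSubLalgebra of cycle G by <:].
HB.instance Definition _ G := [SubLalgebra_isSubAlgebra of cycle G by <:].

Definition boundaries G : {pred cycle G} :=
  [pred z : cycle G | `[< exists2 y, y \in koszul_of G & \val z = dK y >]].

Arguments boundaries : clear implicits.

Lemma boundariesP G (z : cycle G) :
  reflect (exists2 y, y \in koszul_of G & \val z = dK y) (z \in boundaries G).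
Proof. exact: asboolP. Qed.

Lemma boundaries_submod_closed G : submod_closed (boundaries G).
Proof.
split; first by apply/boundariesP; exists 0; rewrite ?rpred0 // !linear0.
move=> a x y /boundariesP[x' x'G xE] /boundariesP[y' y'G yE]; apply/boundariesP.
by exists (a *: x' + y'); rewrite ?rpredD ?rpredZ // !linearP /= xE yE.
Qed.

HB.instance Definition _ G :=
  GRing.isSubmodClosed.Build k (cycle G) (boundaries G)
    (GRing.submod_closed_semi (boundaries_submod_closed G)).

Lemma cycle_dK G (z : cycle G) : dK (\val z) = 0.
Proof. by have /andP[_ /eqP] := valP z. Qed.

Lemma cycle_in_koszul G (z : cycle G) : \val z \in koszul_of G.
Proof. by have /andP[] := valP z. Qed.

Lemma boundariesMl G (z b : cycle G) : b \in boundaries G -> z * b \in boundaries G.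
Proof.
move=> /boundariesP[y yG bE]; apply/boundariesP.
exists (parity (\val z) * y).
  by rewrite rpredM // koszul_of_parity // cycle_in_koszul.
have dpz : dK (parity (\val z)) = 0.
  apply/eqP; rewrite -oppr_eq0 -parity_koszul [koszul _ _]cycle_dK.
  by apply/eqP/ffunP => U; rewrite !ffunE mulr0.
by rewrite rmorphM /= bE [in RHS]/dK koszulM [koszul _ (parity _)]dpz parityK mul0r add0r.
Qed.

Lemma boundariesMr G (z b : cycle G) : b \in boundaries G -> b * z \in boundaries G.
Proof.
move=> /boundariesP[y yG bE]; apply/boundariesP.
exists (y * \val z); first by rewrite rpredM // cycle_in_koszul.
by rewrite rmorphM /= bE [in RHS]/dK koszulM [koszul _ (\val z)]cycle_dK mulr0 addr0.
Qed.

Lemma boundaries1 G : 1 \notin boundaries G.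
Proof.
apply/boundariesP => -[y /koszul_ofP yG].
rewrite rmorph1 => /ffunP/(_ set0)/(congr1 (mcoeff 0%MM)).
rewrite ext1 eqxx mcoeff1 eqxx ffunE (big_morph _ (mcoeffD _) (mcoeff0 _ _)).
rewrite big1 => [/eqP|e _]; first by rewrite oner_eq0.
rewrite inversions0r mul1r rmorphM /= mcoeffX setU0.
have [->|/(yG _).2] := eqVneq (y [set e]) 0; first by rewrite mcoeff0 mulr0.
rewrite sub1set => eG; case: eqP => [/mnmP e0|_]; last by rewrite mul0r.
have : e != set0 by rewrite -card_gt0 (edges_card eG).
case/set0Pn => v ve; have := e0 v.
by rewrite mnmE mnm0E ve.
Qed.

Section Homology.
Variable G : graph s.

Definition homology := Quotient.quot (boundaries G).

HB.instance Definition _ := GRing.Zmodule.on homology.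

Definition hclass (z : cycle G) : homology := \pi_(Quotient.quot (boundaries G)) z.

Definition hmul (a b : homology) : homology := hclass (repr a * repr b).

Definition hscale (c : k) (a : homology) : homology := hclass (c *: repr a).

Lemma hclass_is_zmod_morphism : zmod_morphism hclass.
Proof. exact: pi_is_zmod_morphism. Qed.

HB.instance Definition _ :=
  GRing.isZmodMorphism.Build (cycle G) homology hclass hclass_is_zmod_morphism.

Lemma hclassP (z w : cycle G) :
  reflect (hclass z = hclass w) (z - w \in boundaries G).
Proof. by rewrite Quotient.idealrBE; apply: eqP. Qed.

Lemma hclass_repr (a : homology) : hclass (repr a) = a.
Proof. exact: reprK. Qed.

Lemma repr_hclass (z : cycle G) : repr (hclass z) - z \in boundaries G.
Proof. by apply/hclassP; rewrite hclass_repr. Qed.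

Let homologyW (P : homology -> Prop) :
  (forall z : cycle G, P (hclass z)) -> forall a, P a.
Proof. by move=> h a; rewrite -[a]hclass_repr. Qed.

Let hmulE (z w : cycle G) : hmul (hclass z) (hclass w) = hclass (z * w).
Proof.
apply/hclassP.
have -> : repr (hclass z) * repr (hclass w) - z * w =
    (repr (hclass z) - z) * repr (hclass w) + z * (repr (hclass w) - w).
  by rewrite mulrBl mulrBr addrA subrK.
apply: rpredD; [apply: boundariesMr | apply: boundariesMl]; exact: repr_hclass.
Qed.

Let hscaleE c (z : cycle G) : hscale c (hclass z) = hclass (c *: z).
Proof. by apply/hclassP; rewrite -scalerBr; apply/rpredZ/repr_hclass. Qed.

Let hmulA : associative hmul.
Proof.
by elim/homologyW=> x; elim/homologyW=> y; elim/homologyW=> z; rewrite !hmulE mulrA.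
Qed.

Let hmul1 : left_id (hclass 1) hmul.
Proof. by elim/homologyW=> x; rewrite hmulE mul1r. Qed.

Let hmulr1 : right_id (hclass 1) hmul.
Proof. by elim/homologyW=> x; rewrite hmulE mulr1. Qed.

Let hmulDl : left_distributive hmul +%R.
Proof.
elim/homologyW=> x; elim/homologyW=> y; elim/homologyW=> z.
by rewrite -raddfD !hmulE mulrDl raddfD.
Qed.

Let hmulDr : right_distributive hmul +%R.
Proof.
elim/homologyW=> x; elim/homologyW=> y; elim/homologyW=> z.
by rewrite -raddfD !hmulE mulrDr raddfD.
Qed.

Let h1_neq0 : hclass 1 != 0.
Proof.
apply/eqP; rewrite -(raddf0 hclass) => /hclassP; rewrite subr0.
exact/negP/boundaries1.
Qed.

HB.instance Definition _ := GRing.Zmodule_isNzRing.Build homology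
  hmulA hmul1 hmulr1 hmulDl hmulDr h1_neq0.

Let hscalerA a b v : hscale a (hscale b v) = hscale (a * b) v.
Proof. by elim/homologyW: v => x; rewrite !hscaleE scalerA. Qed.

Let hscale1r : left_id 1 hscale.
Proof. by elim/homologyW=> x; rewrite hscaleE scale1r. Qed.

Let hscalerDr : right_distributive hscale +%R.
Proof.
move=> a; elim/homologyW=> x; elim/homologyW=> y.
by rewrite -raddfD !hscaleE scalerDr raddfD.
Qed.

Let hscalerDl v : {morph hscale^~ v : a b / a + b}.
Proof. by elim/homologyW: v => x a b; rewrite !hscaleE scalerDl raddfD. Qed.

HB.instance Definition _ := GRing.Zmodule_isLmodule.Build k homology
  hscalerA hscale1r hscalerDr hscalerDl.

Let hscalerAl a (u v : homology) : a *: (u * v) = (a *: u) * v.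
Proof.
elim/homologyW: u => x; elim/homologyW: v => y.
by rewrite -[RHS]/(hmul (hscale _ _) _) -[LHS]/(hscale _ (hmul _ _))
           hscaleE !hmulE hscaleE scalerAl.
Qed.

HB.instance Definition _ := GRing.Lmodule_isLalgebra.Build k homology hscalerAl.

Let hscalerAr a (u v : homology) : a *: (u * v) = u * (a *: v).
Proof.
elim/homologyW: u => x; elim/homologyW: v => y.
by rewrite -[RHS]/(hmul _ (hscale _ _)) -[LHS]/(hscale _ (hmul _ _))
           hscaleE !hmulE hscaleE scalerAr.
Qed.

HB.instance Definition _ := GRing.Lalgebra_isAlgebra.Build k homology hscalerAr.

Lemma hclass_is_monoid_morphism : monoid_morphism hclass.
Proof. by split=> // x y; rewrite -hmulE. Qed.

HB.instance Definition _ := GRing.isMonoidMorphism.Build (cycle G) homology hclass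
  hclass_is_monoid_morphism.

Lemma hclass_is_scalable : scalable hclass.
Proof. by move=> a x; rewrite -hscaleE. Qed.

HB.instance Definition _ :=
  GRing.isScalable.Build k (cycle G) homology *:%R hclass hclass_is_scalable.

End Homology.

Section Functoriality.
Variables (G' G : graph s) (sG : subgraph G' G).

Lemma cycles_sub : {subset cycles G' <= cycles G}.
Proof. by move=> x /andP[xK dx]; rewrite inE (koszul_of_sub sG). Qed.

Definition cycle_incl (z : cycle G') : cycle G := Cycle (cycles_sub (valP z)).

(* The map H(G') -> H(G) induced by the inclusion K(G') -> K(G). *)
Definition homology_map (a : homology G') : homology G := hclass (cycle_incl (repr a)).

Lemma homology_mapE (z : cycle G') : homology_map (hclass z) = hclass (cycle_incl z).
Proof.
apply/hclassP; have /boundariesP[y yG' yE] := repr_hclass z.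
apply/boundariesP; exists y; first exact: koszul_of_sub yG'.
by rewrite -yE !raddfB.
Qed.

End Functoriality.

(* The multidegree of m e_F is m times the edge monomials of the edges in F. *)
Definition multihomogeneous (mu : 'X_{1..s}) (x : K) : bool :=
  [forall F : {set {set 'I_s}},
    all (fun m => (m + \sum_(e in F) edge_mnm e)%MM == mu) (msupp (x F))].

Definition homogeneous_class G (mu : 'X_{1..s}) (a : homology G) : Prop :=
  exists2 z : cycle G, multihomogeneous mu (\val z) & a = hclass z.

(* The ideal m(G); [mdeg mu] is the total degree of [mu]. *)
Definition positive_part G : homology G -> Prop :=
  linear_span (fun a => exists2 mu : 'X_{1..s},
    (0 < mdeg mu)%N & homogeneous_class mu a).

Definition improper_generator G (a : homology G) : Prop :=
  exists (G' : graph s) (sG : subgraph G' G) (b : homology G'),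
    [/\ G' <> G, positive_part b & a = homology_map sG b].

(* The ideal frakH(G). *)
Definition improper_classes G : homology G -> Prop :=
  ideal_span (@improper_generator G).

End KoszulComplex.

Arguments koszul_of k {s} G.
Arguments cycles k {s} G.
Arguments cycle k {s} G.
Arguments boundaries {k s} G.
Arguments homology k {s} G.
Arguments positive_part k {s} G.
Arguments improper_classes k {s} G.

(* Main.v *)
(* Setting all variables to 1 turns the multidegree-mu part of K(G) into the
   augmented chain complex of the simplicial complex of edge sets F with
   deg_F(v) <= mu(v) for every vertex v, so everything reduces to
   combinatorial homology.  Let e = {v,u}, g = {u,u'} be the only edges at u,
   with mu(u) = 1, and suppose that mu does not restrict the edges at v.  Then
   every cycle is homologous to (e - g) y for a cycle y of multidegree
   mu - v - u - u', and y is a boundary if (e - g) y is one.  Iterating this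
   removes the vertices of a path three at a time, and a path with 1 mod 3
   edges is acyclic.

   A class is improper if mu vanishes at a vertex, or if mu does not restrict
   the edges at some vertex.  This leaves the multidegrees with exponent 1
   outside the centre c and exponent 1, 2 or 3 at c.  For an edge e, the
   coefficient of e in a cycle z is a cycle of the link of e, which the path
   reduction computes; if it is the coefficient of a product of classes, then z
   minus that product is homologous to a cycle that avoids e, so z is improper.
   The only survivor is the multidegree c^2 (prod of the other vertices) for
   n = m = 1 mod 3, where the homology is spanned by one class.  This class is
   proper, because in that multidegree deleting any edge kills every cycle, and
   a product of two classes of positive degree is homologous to a cycle that
   avoids some edge. *)
From HB Require Import structures.
From mathcomp Require Import all_boot all_order all_algebra.
From mathcomp Require Import zify ring mpoly boolp.
Require Import Defs.

Set Implicit Arguments.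
Unset Strict Implicit.
Unset Printing Implicit Defensive.

Import GRing.Theory.
Local Open Scope ring_scope.

(** * Derivations of an exterior algebra *)

(** The period 3 comes from the cycle [e - g], which uses up the three vertices v, u, u'; a path
    with 1 mod 3 edges thus shrinks to a single edge with unrestricted ends, which is a cone point.
    A factor of the coefficient of [e] is useful only if it bounds once [e] is deleted, for only
    then does it lift to a cycle. The obstacle is the competition for the exponent at the centre: a
    lift along the first cycle needs one unit there, and whether the remaining factor can give it up
    depends on the length of the second cycle. In the surviving multidegree one unit is spent on [e]
    and the other on a path ending at the centre, so nothing is left to share. As the ideal admits
    inhomogeneous multipliers, properness is tested on representatives: an improper cycle is a
    boundary plus multihomogeneous products, and is projected to the surviving multidegree. *)

Section Exterior.
Variables (A : comNzRingType) (E : finType).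
Implicit Types (x y : ext A E) (f g : E -> A) (i : E) (U S T : {set E}).

Lemma ext_eqP x y : x = y <-> forall U, x U = y U.
Proof. by split=> [->|h] //; apply/ffunP. Qed.

Lemma extD x y U : (x + y) U = x U + y U.
Proof. by rewrite [LHS]ffunE. Qed.

Lemma extN x U : (- x) U = - x U.
Proof. by rewrite [LHS]ffunE. Qed.

Lemma ext0 U : (0 : ext A E) U = 0.
Proof. by rewrite [LHS]ffunE. Qed.

Lemma extM_neq0 x y U : (x * y) U != 0 ->
  exists S T, [/\ x S != 0, y T != 0, [disjoint S & T] & U = S :|: T].
Proof.
rewrite extM => h; apply: contrapT => hn; case/eqP: h.
apply: big1 => S _; apply: big1 => T /andP[dST /eqP UE].
have [xS|xS] := eqVneq (x S) 0; first by rewrite xS mul0r mulr0.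
have [yT|yT] := eqVneq (y T) 0; first by rewrite yT !mulr0.
by case: hn; exists S, T.
Qed.

Lemma ext_gen_neq0 i U : ext_gen A i U != 0 -> U = [set i].
Proof. by rewrite ffunE; case: (U =P _) => // _; rewrite mulr0n eqxx. Qed.

Lemma koszul_neq0 f x U : koszul f x U != 0 ->
  exists i, [/\ i \notin U, f i != 0 & x (i |: U) != 0].
Proof.
rewrite ffunE => h; apply: contrapT => hn; case/eqP: h; apply: big1 => i iU.
have [fi|fi] := eqVneq (f i) 0; first by rewrite fi mul0r mulr0.
have [xi|xi] := eqVneq (x (i |: U)) 0; first by rewrite xi !mulr0.
by case: hn; exists i.
Qed.

Lemma koszulDf f g x : koszul (fun i => f i + g i) x = koszul f x + koszul g x.
Proof.
apply/ffunP => U; rewrite extD !ffunE -big_split; apply: eq_bigr => i _ /=; ring.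
Qed.

(** Polarization: the derivations of [f], [g] and [f + g] all square to zero, so the mixed terms
    cancel. *)
Lemma koszul_anticomm f g x : koszul f (koszul g x) = - koszul g (koszul f x).
Proof.
apply/eqP; rewrite -addr_eq0; apply/eqP.
have := koszul_koszul (fun i => f i + g i) x.
by rewrite koszulDf !koszulDf !raddfD /= !koszul_koszul add0r addr0.
Qed.

Lemma koszul_ext1 f : koszul f (1 : ext A E) = 0.
Proof.
apply/ffunP => U; rewrite ext0 ffunE big1 // => i _; rewrite ext1.
case: eqP => [h|_]; last by rewrite !mulr0.
by have := setU11 i U; rewrite h inE.
Qed.

Lemma parity_gen i : parity (ext_gen A i) = - ext_gen A i.
Proof.
apply/ffunP => U; rewrite extN !ffunE; case: eqP => [->|_].
  by rewrite cards1 expr1 mulN1r.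
by rewrite mulr0 oppr0.
Qed.

Lemma koszul_genM f i x :
  koszul f (ext_gen A i * x) = koszul f (ext_gen A i) * x - ext_gen A i * koszul f x.
Proof. by rewrite koszulM parity_gen mulNr. Qed.

Definition bd : ext A E -> ext A E := koszul (fun=> 1).
HB.instance Definition _ := GRing.Additive.on bd.

(* [contr e x] is the coefficient of the generator e in x: as the derivation
   sending e to 1 and the other generators to 0, it anticommutes with [bd]. *)
Definition contr e : ext A E -> ext A E := koszul (fun i => (i == e)%:R).
HB.instance Definition _ e := GRing.Additive.on (contr e).

Lemma bd_gen i : bd (ext_gen A i) = 1.
Proof. by rewrite [LHS]koszul_gen; apply/ffunP => U; rewrite ext1 ffunE mul1r. Qed.

Lemma contr_gen e i : contr e (ext_gen A i) = (i == e)%:R.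
Proof.
rewrite [LHS]koszul_gen; apply/ffunP => U; rewrite ffunE.
by case: (i == e); rewrite ?mul1r ?ext1 // mul0r ext0.
Qed.

Lemma bd_genM i x : bd (ext_gen A i * x) = x - ext_gen A i * bd x.
Proof. by rewrite [LHS]koszul_genM [koszul _ (ext_gen A i)]bd_gen mul1r. Qed.

Lemma contr_genM e i x :
  contr e (ext_gen A i * x) = (i == e)%:R * x - ext_gen A i * contr e x.
Proof. by rewrite [LHS]koszul_genM [koszul _ (ext_gen A i)]contr_gen. Qed.

Lemma bdK x : bd (bd x) = 0. Proof. exact: koszul_koszul. Qed.
Lemma contrK e x : contr e (contr e x) = 0. Proof. exact: koszul_koszul. Qed.
Lemma contr_bd e x : contr e (bd x) = - bd (contr e x).
Proof. exact: koszul_anticomm. Qed.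

Lemma contr_neq0 e x U : contr e x U != 0 -> e \notin U /\ x (e |: U) != 0.
Proof.
by case/koszul_neq0=> i []; case: (i =P e) => [->|_] iU; rewrite ?mulr0n ?eqxx.
Qed.

Lemma contrE e x U : e \notin U ->
  contr e x U = (-1) ^+ inversions [set e] U * x (e |: U).
Proof.
move=> eU; rewrite ffunE (bigD1 e) //= eqxx mul1r big1 ?addr0 // => i /andP[_ ie].
by rewrite (negPf ie) mul0r mulr0.
Qed.

Lemma contr_eq0 e x : (forall U, e \in U -> x U = 0) -> contr e x = 0.
Proof.
move=> h; apply/ext_eqP => U; rewrite ext0; apply/eqP; apply: contraT.
by case/contr_neq0=> _ /eqP[]; apply/h/setU11.
Qed.

Lemma contr_eq0_notin e x U : contr e x = 0 -> x U != 0 -> e \notin U.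
Proof.
move=> h; apply: contraNN => eU; have := contrE x (negbT (setD11 e U)).
rewrite h ext0 setD1K // => /esym/eqP.
by rewrite -signr_odd mulr_sign; case: odd; rewrite ?oppr_eq0.
Qed.

Lemma bdM0 x y : bd x = 0 -> bd y = 0 -> bd (x * y) = 0.
Proof.
by move=> dx dy; rewrite [LHS]koszulM [koszul _ x]dx [koszul _ y]dy mul0r mulr0 addr0.
Qed.

Lemma bd_parity x : bd x = 0 -> bd (parity x) = 0.
Proof.
move=> dx; apply/eqP; rewrite -oppr_eq0 -parity_koszul [koszul _ x]dx.
by apply/eqP/ext_eqP => U; rewrite !ffunE mulr0.
Qed.

Lemma parity_neq0 x U : parity x U != 0 -> x U != 0.
Proof. by rewrite ffunE -signr_odd mulr_sign; case: odd; rewrite ?oppr_eq0. Qed.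

End Exterior.

(** * Chains of bounded degree *)

Lemma leq_sub_of_addl (a b c : nat) : (a + b <= c)%N -> (b <= c - a)%N.
Proof. lia. Qed.

Section Chains.
Variables (k : fieldType) (s : nat).
Local Notation C := (ext k {set 'I_s}).
Local Notation gen := (@ext_gen k {set 'I_s}).
Implicit Types (D F : {set {set 'I_s}}) (mu nu : 'X_{1..s}) (x y z c : C)
  (e f g : {set 'I_s}) (u v : 'I_s).

(* Chains have coefficients in k: they are elements of K(G) with all variables
   set to 1, and [chain D mu c] says that c comes from an element of
   multidegree mu on the edges D.  As [edge_mnm] is the indicator of an
   arbitrary vertex set, it also serves to write multidegrees. *)
Definition deg F : 'X_{1..s} := (\sum_(e in F) edge_mnm e)%MM.

Definition face D mu F := (F \subset D) && (deg F <= mu)%MM.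

Definition chain D mu c := forall F, c F != 0 -> face D mu F.
Definition cyc D mu c := chain D mu c /\ bd c = 0.
Definition bnd D mu c := exists2 y, chain D mu y & c = bd y.

Lemma edge_mnmE e v : edge_mnm e v = (v \in e) :> nat.
Proof. exact: mnmE. Qed.

Lemma degE F v : deg F v = #|[set f in F | v \in f]|.
Proof.
rewrite /deg mnm_sumE -sum1_card big_mkcond [RHS]big_mkcond /=.
by apply: eq_bigr => f _; rewrite inE edge_mnmE; case: (f \in F); case: (v \in f).
Qed.

Lemma deg0 : deg set0 = 0%MM.
Proof. by rewrite /deg big_set0. Qed.

Lemma degU F1 F2 : [disjoint F1 & F2] -> deg (F1 :|: F2) = (deg F1 + deg F2)%MM.
Proof. by move=> d; rewrite /deg -bigU //; apply: eq_bigl => f; rewrite !inE. Qed.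

Lemma degU1 e F : e \notin F -> deg (e |: F) = (edge_mnm e + deg F)%MM.
Proof. by move=> eF; rewrite degU ?disjoints1 // /deg big_set1. Qed.

Lemma deg_mem e F v : e \in F -> (edge_mnm e v <= deg F v)%N.
Proof. by move=> eF; rewrite -(setD1K eF) degU1 ?setD11 // mnmDE leq_addr. Qed.

Lemma faceP D mu F :
  reflect (F \subset D /\ forall v, (deg F v <= mu v)%N) (face D mu F).
Proof. by apply: (iffP andP) => -[FD /mnm_lepP]. Qed.

Lemma chain0 D mu : chain D mu 0.
Proof. by move=> F; rewrite ext0 eqxx. Qed.

Lemma chainD D mu x y : chain D mu x -> chain D mu y -> chain D mu (x + y).
Proof.
move=> hx hy F; rewrite extD; have [x0|/hx //] := eqVneq (x F) 0.
by rewrite x0 add0r; apply: hy.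
Qed.

Lemma chainN D mu x : chain D mu x -> chain D mu (- x).
Proof. by move=> hx F; rewrite extN oppr_eq0; apply: hx. Qed.

Lemma chainB D mu x y : chain D mu x -> chain D mu y -> chain D mu (x - y).
Proof. by move=> hx hy; apply/chainD/chainN. Qed.

Lemma chainW D D' mu mu' x : D \subset D' -> (forall v, mu v <= mu' v)%N ->
  chain D mu x -> chain D' mu' x.
Proof.
move=> sD smu hx F /hx/faceP[FD h]; apply/faceP; split=> [|v].
  exact: subset_trans sD.
exact: leq_trans (smu v).
Qed.

Lemma chain1 D mu : chain D mu 1.
Proof.
move=> F; rewrite ext1; case: (F =P set0) => [-> _|_]; last by rewrite mulr0n eqxx.
by apply/faceP; split=> [|v]; rewrite ?sub0set // deg0 mnm0E.
Qed.

Lemma chainM D mu nu x y :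
  chain D mu x -> chain D nu y -> chain D (mu + nu)%MM (x * y).
Proof.
move=> hx hy F /extM_neq0[S [T [/hx/faceP[SD hS] /hy/faceP[TD hT] dST ->]]].
apply/faceP; split=> [|v]; first by rewrite subUset SD.
by rewrite degU // !mnmDE leq_add.
Qed.

Lemma chain_gen D e : e \in D -> chain D (edge_mnm e) (gen e).
Proof.
move=> eD F /ext_gen_neq0 ->; apply/faceP; split=> [|v]; first by rewrite sub1set.
by rewrite /deg big_set1.
Qed.

Lemma chain_bd D mu x : chain D mu x -> chain D mu (bd x).
Proof.
move=> hx F /koszul_neq0[i [iF _ /hx/faceP[]]]; rewrite subUset => /andP[_ FD] h.
by apply/faceP; split=> // v; apply: leq_trans (h v); rewrite degU1 // mnmDE leq_addl.
Qed.

Lemma chain_contr D mu e x :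
  chain D mu x -> chain (D :\ e) (mu - edge_mnm e)%MM (contr e x).
Proof.
move=> hx F /contr_neq0[eF /hx/faceP[]]; rewrite subUset => /andP[_ FD] h.
apply/faceP; split=> [|v]; first by rewrite subsetD1 FD.
by rewrite mnmBE; apply: leq_sub_of_addl; rewrite -mnmDE -degU1.
Qed.

Lemma chain_contr_edge D mu e x : contr e x != 0 -> chain D mu x ->
  e \in D /\ (forall v, edge_mnm e v <= mu v)%N.
Proof.
move=> nx hx; case: (pselect (exists F, contr e x F != 0)) => [[F]|hn].
  case/contr_neq0=> eF /hx/faceP[]; rewrite subUset sub1set => /andP[eD _] h.
  by split=> // v; apply: leq_trans (h v); rewrite degU1 // mnmDE leq_addr.
case/eqP: nx; apply/ext_eqP => F; rewrite ext0; apply/eqP; apply: contraT => h.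
by case: hn; exists F.
Qed.

Lemma chain_notin D mu e x : chain (D :\ e) mu x -> contr e x = 0.
Proof.
move=> hx; apply: contr_eq0 => U eU; apply/eqP; apply: contraT => /hx/faceP[].
by rewrite subsetD1 eU andbF.
Qed.

Lemma chain_contr0 D mu e x : chain D mu x -> contr e x = 0 -> chain (D :\ e) mu x.
Proof.
move=> hx e0 F xF; have /faceP[FD h] := hx _ xF; apply/faceP; split=> //.
by rewrite subsetD1 FD; apply: contr_eq0_notin xF.
Qed.

Lemma chain_parity D mu x : chain D mu x -> chain D mu (parity x).
Proof. by move=> hx F /parity_neq0/hx. Qed.

Lemma contr_rest e x : contr e (x - gen e * contr e x) = 0.
Proof. by rewrite raddfB /= contr_genM eqxx mul1r contrK mulr0 subr0 subrr. Qed.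

Lemma chain_rest D mu e x : chain D mu x ->
  chain (D :\ e) mu (x - gen e * contr e x).
Proof.
move=> hx; apply: chain_contr0 (contr_rest e x).
have [e0|ne0] := eqVneq (contr e x) 0; first by rewrite e0 mulr0 subr0.
have [eD le] := chain_contr_edge ne0 hx.
apply: chainB => //.
have h := chainW (subD1set _ _) (fun=> leqnn _) (chain_contr (e := e) hx).
apply: chainW (chainM (chain_gen eD) h) => // v.
by rewrite mnmDE mnmBE subnKC.
Qed.

(* The edges at v that can occur in a chain of multidegree mu; if [slack]
   holds, then mu does not restrict the use of the edges at v. *)
Definition eff D mu v := [set f in D | (v \in f) && (edge_mnm f <= mu)%MM].
Definition slack D mu v := (#|eff D mu v| <= mu v)%N.

Lemma effP D mu v f :
  reflect [/\ f \in D, v \in f & forall u, u \in f -> (0 < mu u)%N] (f \in eff D mu v).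
Proof.
rewrite inE; apply: (iffP and3P) => -[fD vf h]; split=> //.
  by move=> u uf; have := mnm_lepP h u; rewrite edge_mnmE uf.
by apply/mnm_lepP => u; rewrite edge_mnmE; case: (boolP (u \in f)) => // /h.
Qed.

Lemma face_eff D mu F v : face D mu F -> [set f in F | v \in f] \subset eff D mu v.
Proof.
case/faceP=> /subsetP FD h; apply/subsetP => f; rewrite inE => /andP[fF vf].
apply/effP; split; [exact: FD | by [] | move=> u uf].
apply: leq_trans (h u); apply: leq_trans (deg_mem u fF).
by rewrite edge_mnmE uf.
Qed.

(** Only the degrees at [v] and [u] grow, and there slackness bounds the number of all effective
    edges, the new one included. *)
Lemma chain_cone D mu c v u : [set v; u] \in D -> (edge_mnm [set v; u] <= mu)%MM ->
  slack D mu v -> slack D mu u -> chain D mu c -> chain D mu (gen [set v; u] * c).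
Proof.
set e := [set v; u] => eD emu fv fu hc F /extM_neq0[S [T [/ext_gen_neq0 -> cT]]].
rewrite disjoints1 => eT ->; have hT := hc _ cT; have /faceP[TD lT] := hT.
apply/faceP; split=> [|w]; first by rewrite subUset sub1set eD.
suff: slack D mu w -> w \in e -> (deg (e |: T) w <= mu w)%N.
  move=> h; case we: (w \in e).
    by apply: h => //; move: we; rewrite /e !inE => /orP[]/eqP->.
  by rewrite degU1 // mnmDE edge_mnmE we lT.
move=> fw we; apply: leq_trans fw; rewrite degE; apply: subset_leq_card.
apply/subsetP => f; rewrite !inE => /andP[/orP[/eqP->|fT] wf].
  by rewrite eD we.
by have /subsetP/(_ f) := face_eff w hT; rewrite !inE fT wf; apply.
Qed.

(** Multiplication by the edge is a contracting homotopy. *)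
Lemma cyc_cone D mu v u : [set v; u] \in D -> (edge_mnm [set v; u] <= mu)%MM ->
  slack D mu v -> slack D mu u -> forall c, cyc D mu c -> bnd D mu c.
Proof.
move=> eD emu fv fu c [hc dc]; exists (gen [set v; u] * c).
  exact: chain_cone.
by rewrite bd_genM dc mulr0 subr0.
Qed.

Lemma slackD1 D mu v e : slack D mu v -> slack (D :\ e) mu v.
Proof.
apply: leq_trans; apply: subset_leq_card; apply/subsetP => f.
by rewrite !inE -!andbA => /and4P[_ -> -> ->].
Qed.

Lemma slack1 D mu v e : (0 < mu v)%N -> (forall f, f \in eff D mu v -> f = e) ->
  slack D mu v.
Proof.
move=> mv h; apply: leq_trans mv; rewrite -(cards1 e); apply: subset_leq_card.
by apply/subsetP => f /h ->; rewrite inE.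
Qed.

Lemma slack2 D mu v e1 e2 : (1 < mu v)%N ->
  (forall f, f \in eff D mu v -> f = e1 \/ f = e2) -> slack D mu v.
Proof.
move=> mv h; apply: leq_trans mv; apply: leq_trans (_ : #|[set e1; e2]| <= _)%N.
  by apply/subset_leq_card/subsetP => f /h[] ->; rewrite !inE eqxx ?orbT.
by rewrite cards2; case: eqP.
Qed.

(** * Removing the end of a path *)

Section Leaf.
Variables (D : {set {set 'I_s}}) (mu : 'X_{1..s}) (v u u' : 'I_s).
Let e := [set v; u].
Let g := [set u; u'].
Hypotheses (eD : e \in D) (vu : v != u) (vu' : v != u').
Hypotheses (mv : (0 < mu v)%N) (mu1 : mu u = 1%N) (fv : slack D mu v).
Hypothesis effu : forall f, f \in eff D mu u -> f = e \/ f = g.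

(** The subtraction is truncated: the exponent at [u'] may be 0, and then [g] occurs in no chain. *)
Definition leaf_mnm : 'X_{1..s} := (mu - edge_mnm [set v; u; u'])%MM.

Let emu : (edge_mnm e <= mu)%MM.
Proof.
apply/mnm_lepP => w; rewrite edge_mnmE !inE.
by case: eqP => [->|_] //=; case: eqP => [->|_] //=; rewrite mu1.
Qed.

Let eg : (e == g) = false.
Proof.
apply/eqP => /setP/(_ v); rewrite !inE eqxx (negPf vu) (negPf vu').
by [].
Qed.

(** The exponent drops at [v] although [v] is not on [g]: since [mu u = 1], a face containing [g]
    cannot contain [e], so it misses one of the at most [mu v] effective edges at [v]. *)
Lemma chain_leaf c : chain D mu c -> chain D leaf_mnm (contr g c).
Proof.
move=> hc F hF; have [gF cgF] := contr_neq0 hF.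
have hgF := hc _ cgF; have /faceP[] := hgF; rewrite subUset => /andP[_ FD] lF.
apply/faceP; split=> // w; have := lF w; rewrite degU1 // mnmDE mnmBE !edge_mnmE.
have [->|wv] := eqVneq w v.
  2: by rewrite !inE (negPf wv) /=; apply: leq_sub_of_addl.
rewrite !inE (negPf vu) (negPf vu') eqxx /= add0n => _.
rewrite -ltnS subn1 prednK //.
apply: leq_trans fv; rewrite degE; apply: proper_card; apply/properP; split.
  apply: subset_trans (face_eff v hgF); apply/subsetP => f.
  by rewrite !inE => /andP[-> ->]; rewrite orbT.
exists e.
  apply/effP; split=> //; first by rewrite !inE eqxx.
  by move=> w'; rewrite !inE => /orP[]/eqP-> //; rewrite mu1.
rewrite !inE eqxx andbT; apply/negP => eF.
have := lF u; rewrite degU1 // mnmDE mu1 edge_mnmE !inE eqxx.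
have := deg_mem u eF; rewrite edge_mnmE !inE eqxx orbT.
by case: (deg F u).
Qed.

(** The cycle [y] is minus the coefficient of [g]; once the terms with [g] are removed, [e] is the
    only edge left at [u]. *)
Lemma leaf c : cyc D mu c ->
  exists2 y, cyc D leaf_mnm y & bnd D mu (c - (gen e - gen g) * y).
Proof.
move=> [hc dc]; exists (- contr g c).
  split; first exact/chainN/chain_leaf.
  by rewrite raddfN /= -contr_bd dc raddf0.
(* Multiplication by e contracts the chains that do not involve g. *)
exists (gen e * (c - gen g * contr g c)).
  apply: (@chainW (D :\ g) _ mu) => //; first exact: subD1set.
  apply: chain_cone; rewrite ?in_setD1 -/e ?eg //; first exact: slackD1.
    apply: (@slack1 _ _ _ e); rewrite ?mu1 // => f /effP[].
    rewrite in_setD1 => /andP[fg fD] uf h.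
    by case: (effu (introT (effP _ _ _ _) (And3 fD uf h))) fg => ->; rewrite ?eqxx.
  exact: chain_rest.
have dg : bd (contr g c) = 0 by apply: oppr_inj; rewrite -contr_bd dc raddf0 oppr0.
rewrite bd_genM raddfB /= bd_genM dc dg mulr0 subr0 sub0r.
by rewrite !mulrN !opprK mulrBl addrA addrAC.
Qed.

(** Comparison of the coefficients of [g]: [y] cannot involve [g], because [leaf_mnm] vanishes at
    [u], so [y] is the boundary of the coefficient of [g] in the bounding chain. *)
Lemma leaf_inj y : chain D leaf_mnm y ->
  bnd D mu ((gen e - gen g) * y) -> bnd D leaf_mnm y.
Proof.
move=> hy [x hx exy]; exists (contr g x); first exact: chain_leaf.
have gy : contr g y = 0.
  apply: contr_eq0 => F gF; apply/eqP; apply: contraT => /hy/faceP[_ /(_ u)].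
  rewrite mnmBE mu1 edge_mnmE !inE eqxx orbT /= subnn => h.
  have := deg_mem u gF; rewrite edge_mnmE !inE eqxx.
  by move: h; case: (deg F u).
have := congr1 (contr g) exy; rewrite contr_bd mulrBl raddfB /= !contr_genM gy eg eqxx.
by rewrite mul0r !mulr0 !subr0 mul1r sub0r => /oppr_inj.
Qed.

End Leaf.
End Chains.

(** * Removing paths *)

Section Paths.
Variables (k : fieldType) (s : nat).
Local Notation C := (ext k {set 'I_s}).
Local Notation gen := (@ext_gen k {set 'I_s}).
Implicit Types (D F : {set {set 'I_s}}) (mu nu rho : 'X_{1..s}) (x y z c Q : C)
  (e f g : {set 'I_s}) (u v : 'I_s) (w : nat -> 'I_s) (r : nat).

Lemma cycW D D' mu mu' x : D \subset D' -> (forall v, mu v <= mu' v)%N ->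
  cyc D mu x -> cyc D' mu' x.
Proof. by move=> sD smu [hx dx]; split=> //; apply: chainW hx. Qed.

Lemma bndW D D' mu mu' x : D \subset D' -> (forall v, mu v <= mu' v)%N ->
  bnd D mu x -> bnd D' mu' x.
Proof. by move=> sD smu [y hy ->]; exists y => //; apply: chainW hy. Qed.

Lemma bnd_cyc D mu x : bnd D mu x -> cyc D mu x.
Proof. by case=> y hy ->; split; [exact: chain_bd | exact: bdK]. Qed.

Lemma cyc1 D mu : cyc D mu (1 : C).
Proof. by split; [exact: chain1 | exact: koszul_ext1]. Qed.

Lemma cycB D mu x y : cyc D mu x -> cyc D mu y -> cyc D mu (x - y).
Proof. by move=> [hx dx] [hy dy]; split; [exact: chainB | rewrite raddfB /= dx dy subr0]. Qed.

Lemma bnd0 D mu : bnd D mu (0 : C).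
Proof. by exists 0; [exact: chain0 | rewrite raddf0]. Qed.

Lemma bndD D mu x y : bnd D mu x -> bnd D mu y -> bnd D mu (x + y).
Proof.
move=> [a ha ->] [b hb ->]; exists (a + b); [exact: chainD | by rewrite raddfD].
Qed.

Lemma bnd_trans D mu x y z : bnd D mu (x - y) -> bnd D mu (y - z) -> bnd D mu (x - z).
Proof. by move=> h1 h2; rewrite -(subrK y x) -addrA; apply: bndD. Qed.

Lemma bnd_eq D mu x y : bnd D mu (x - y) -> bnd D mu y -> bnd D mu x.
Proof. by move=> h1 h2; rewrite -(subrK y x); apply: bndD. Qed.

Lemma cycM D mu nu rho x y : (forall v, mu v + nu v <= rho v)%N ->
  cyc D mu x -> cyc D nu y -> cyc D rho (x * y).
Proof.
move=> le [hx dx] [hy dy]; split; last exact: bdM0.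
by apply: chainW (chainM hx hy) => // v; rewrite mnmDE.
Qed.

Lemma bndMr D mu nu rho x y : (forall v, mu v + nu v <= rho v)%N ->
  bnd D mu x -> cyc D nu y -> bnd D rho (x * y).
Proof.
move=> le [a ha ->] [hy dy]; exists (a * y).
  by apply: chainW (chainM ha hy) => // v; rewrite mnmDE.
by rewrite [RHS]koszulM [koszul _ y]dy mulr0 addr0.
Qed.

Lemma bndMl D mu nu rho x y : (forall v, mu v + nu v <= rho v)%N ->
  cyc D mu x -> bnd D nu y -> bnd D rho (x * y).
Proof.
move=> le [hx dx] [a ha ->]; exists (parity x * a).
  by apply: chainW (chainM (chain_parity hx) ha) => // v; rewrite mnmDE.
by rewrite [RHS]koszulM parityK [koszul _ (parity x)](bd_parity dx) mul0r add0r.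
Qed.

Lemma cyc_contr D mu e z : cyc D mu z ->
  cyc (D :\ e) (mu - edge_mnm e)%MM (contr e z).
Proof.
move=> [hz dz]; split; first exact: chain_contr.
by apply: oppr_inj; rewrite -contr_bd dz raddf0 oppr0.
Qed.

(** If the coefficient of [e] is [bd y], then the boundary of [e y] is [y - e (bd y)]; adding it to
    [z] trades all terms with [e] for [y]. *)
Lemma del D mu e z : cyc D mu z ->
  bnd (D :\ e) (mu - edge_mnm e)%MM (contr e z) ->
  exists2 z', cyc (D :\ e) mu z' & bnd D mu (z - z').
Proof.
move=> cz; have [hz dz] := cz; case=> y hy ey.
(* A zero coefficient is treated apart, since [e] may then lie outside [D]. *)
have [z0|nz] := eqVneq (contr e z) 0.
  by exists z; [split=> //; exact: chain_contr0 | rewrite subrr; exact: bnd0].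
have [eD le] := chain_contr_edge nz hz.
have hy' : chain (D :\ e) mu y by apply: chainW hy => // v; rewrite mnmBE leq_subr.
have cy : chain D mu (gen e * y).
  apply: chainW (chainM (chain_gen eD) (chainW (subD1set _ _) _ hy)) => // v.
  by rewrite mnmDE mnmBE subnKC.
have bz : bnd D mu (z - (z - gen e * contr e z + y)).
  exists (- (gen e * y)); first exact: chainN.
  by rewrite raddfN /= bd_genM ey !opprB !opprD !addrA subrr add0r opprK.
exists (z - gen e * contr e z + y) => //; split.
  by apply: chainD => //; exact: chain_rest.
have [x _ ex] := bz; have := congr1 (@bd k _) ex.
by rewrite bdK raddfB /= dz sub0r => /eqP; rewrite oppr_eq0 => /eqP.
Qed.

(** The cone [e Q] has boundary [Q]; closing it off with a chain that bounds [Q] away from [e] gives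
    a cycle whose coefficient of [e] is [Q]. *)
Lemma ext_lift D mu e Q : e \in D -> (forall v, edge_mnm e v <= mu v)%N ->
  cyc (D :\ e) (mu - edge_mnm e)%MM Q -> bnd (D :\ e) mu Q ->
  exists2 xi, cyc D mu xi & contr e xi = Q.
Proof.
move=> eD le [hQ dQ] [x hx ex]; exists (gen e * Q - x).
  split; last by rewrite raddfB /= bd_genM dQ mulr0 subr0 -ex subrr.
  apply: chainB; last by apply: chainW hx; rewrite ?subD1set.
  apply: chainW (chainM (chain_gen eD) (chainW (subD1set _ _) _ hQ)) => // v.
  by rewrite mnmDE mnmBE subnKC.
by rewrite raddfB /= contr_genM (chain_notin hx) (chain_notin hQ) eqxx mul1r mulr0 !subr0.
Qed.

Lemma contrMl D mu e x y : chain (D :\ e) mu y -> contr e (x * y) = contr e x * y.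
Proof. by move=> hy; rewrite [LHS]koszulM [koszul _ y](chain_notin hy) mulr0 addr0. Qed.

(** The exponent at [u] becomes 0, so [[set v; u]] is no longer effective; at [x = v] this
    compensates the drop of the exponent. *)
Lemma slack_leaf D mu v u u' (x : 'I_s) : [set v; u] \in D -> v != u -> v != u' ->
  (0 < mu v)%N -> mu u = 1%N -> slack D mu x -> x != u -> x != u' ->
  slack D (leaf_mnm mu v u u') x.
Proof.
move=> eD vu vu' mv mu1 fx xu xu'.
have sub : eff D (leaf_mnm mu v u u') x \subset eff D mu x :\ [set v; u].
  apply/subsetP => f /effP[fD xf h]; rewrite in_setD1; apply/andP; split.
    apply/eqP => fe; have := h u; rewrite fe !inE eqxx orbT => /(_ isT).
    by rewrite mnmBE mu1 edge_mnmE !inE eqxx orbT.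
  by apply/effP; split=> // t /h; rewrite mnmBE => /leq_trans; apply; rewrite leq_subr.
apply: leq_trans (subset_leq_card sub) _.
rewrite mnmBE edge_mnmE !inE (negPf xu) (negPf xu') !orbF.
have [xv|xv] := eqVneq x v.
  have e1 : [set v; u] \in eff D mu x.
    rewrite xv; apply/effP; split; rewrite ?inE ?eqxx //.
    by move=> t; rewrite !inE => /orP[]/eqP->; rewrite ?mu1.
  by move: fx; rewrite /slack (cardsD1 [set v; u]) e1 add1n subn1; case: (mu x).
rewrite subn0; apply: leq_trans fx; apply: subset_leq_card; exact: subD1set.
Qed.

Definition ed w i : {set 'I_s} := [set w i; w i.+1].
Definition img w n : {set 'I_s} := [set w i | i : 'I_n].
Definition shift3 w i := w i.+3.

(** The cycle split off by [r] leaf removals, one factor per triple of consecutive vertices; the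
    edges joining two triples do not occur. *)
Fixpoint tailp w r : C :=
  if r is r'.+1 then (gen (ed w 0) - gen (ed w 1)) * tailp (shift3 w) r' else 1.

Lemma imgP w n v : reflect (exists2 i, (i < n)%N & v = w i) (v \in img w n).
Proof.
apply: (iffP imsetP) => [[i _ ->]|[i lt ->]]; first by exists i.
by exists (Ordinal lt).
Qed.

Definition inj_below w n := forall i j, (i < n)%N -> (j < n)%N -> w i = w j -> i = j.

Lemma edge_img_shift w r v : inj_below w (3 * r.+1) ->
  edge_mnm (img w (3 * r.+1)) v =
  (edge_mnm [set w 0%N; w 1%N; w 2%N] v + edge_mnm (img (shift3 w) (3 * r)) v)%N.
Proof.
move=> inj; rewrite !edge_mnmE.
have -> : (v \in img w (3 * r.+1)) =
  (v \in [set w 0%N; w 1%N; w 2%N]) || (v \in img (shift3 w) (3 * r)).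
  apply/imgP/orP => [[[|[|[|i]]] lt ->]|[]].
  - by left; rewrite !inE eqxx.
  - by left; rewrite !inE eqxx ?orbT.
  - by left; rewrite !inE eqxx ?orbT.
  - by right; apply/imgP; exists i => //; lia.
  - by rewrite !inE -orbA => /or3P[]/eqP->; [exists 0%N | exists 1%N | exists 2%N] => //; lia.
  - by case/imgP=> i lt ->; exists i.+3 => //; lia.
case: (boolP (v \in img _ _)) => [/imgP[i lt ->]|_]; last by rewrite orbF addn0.
rewrite orbT !inE -!orbA; case: or3P => // -[] /eqP /inj h; have := h; lia.
Qed.

Lemma cyc_gen_sub D v u u' : [set v; u] \in D -> [set u; u'] \in D ->
  cyc D (edge_mnm [set v; u; u']) (gen [set v; u] - gen [set u; u']).
Proof.
move=> eD gD; split; last by rewrite raddfB /= !bd_gen subrr.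
by apply: chainB; (apply: chainW (chain_gen _); [exact: subxx | | by []]) => w;
  rewrite !edge_mnmE !inE; case: (w == _); case: (w == _); case: (w == _).
Qed.

Lemma tailp_cyc D w r : inj_below w (3 * r) ->
  (forall i, (i.+1 < 3 * r)%N -> ed w i \in D) ->
  cyc D (edge_mnm (img w (3 * r))) (tailp w r).
Proof.
elim: r w => [|r IH] w inj hD /=; first exact: cyc1.
have {}IH : cyc D (edge_mnm (img (shift3 w) (3 * r))) (tailp (shift3 w) r).
  apply: IH => [i j li lj /inj h|i li]; last by apply: (hD i.+3); lia.
  by have := h; lia.
apply: (cycM (mu := edge_mnm [set w 0%N; w 1%N; w 2%N])) IH.
  by move=> v; rewrite edge_img_shift.
by apply: cyc_gen_sub; apply: hD; lia.
Qed.

(* A path w 0, w 1, ... that enters the rest of the graph only after its first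
   3 r - 1 vertices; its last vertex w (3 r - 1) is unconstrained. *)
Record tailable D mu w r := Tailable {
  tl_inj : inj_below w (3 * r);
  tl_one : forall i, (0 < i)%N -> (i.+1 < 3 * r)%N -> mu (w i) = 1%N;
  tl_pos : forall i, (i < 3 * r)%N -> (0 < mu (w i))%N;
  tl_edge : forall i, (i.+1 < 3 * r)%N -> ed w i \in D;
  tl_eff : forall i f, (0 < i)%N -> (i.+1 < 3 * r)%N -> f \in eff D mu (w i) ->
    f = ed w i.-1 \/ f = ed w i;
  tl_free : (0 < r)%N -> slack D mu (w 0%N) }.

Lemma eff_leaf D mu v u u' (x : 'I_s) f : f \in eff D (leaf_mnm mu v u u') x ->
  f \in eff D mu x.
Proof.
case/effP=> fD xf h; apply/effP; split=> // t /h; rewrite mnmBE => /leq_trans.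
by apply; rewrite leq_subr.
Qed.

Lemma leaf_mnm_out mu v u u' (x : 'I_s) : x != v -> x != u -> x != u' ->
  leaf_mnm mu v u u' x = mu x.
Proof.
by move=> /negPf xv /negPf xu /negPf xu'; rewrite mnmBE edge_mnmE !inE xv xu xu' subn0.
Qed.

Lemma inj_neq w n i j : inj_below w n -> (i < n)%N -> (j < n)%N -> i != j -> w i != w j.
Proof. by move=> inj li lj; apply: contraNneq => /inj ->. Qed.

Lemma tailable_shift D mu w r : tailable D mu w r.+1 ->
  tailable D (leaf_mnm mu (w 0%N) (w 1%N) (w 2%N)) (shift3 w) r.
Proof.
case=> inj one pos hD heff fr.
have mE i : (i < 3 * r)%N -> leaf_mnm mu (w 0%N) (w 1%N) (w 2%N) (w i.+3) = mu (w i.+3).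
  by move=> li; apply: leaf_mnm_out; apply: (inj_neq inj); lia.
split.
- by move=> i j li lj /inj h; have := h; lia.
- by move=> i i0 li; rewrite mE ?one //; lia.
- by move=> i li; rewrite mE ?pos //; lia.
- by move=> i li; apply: (hD i.+3); lia.
- by move=> i f i0 li /eff_leaf /heff []; (try lia); case: i i0 li => // i _ li; auto.
(* The exponent at [w 2] is now 0, which kills [ed w 2] and leaves [ed w 3] as the only edge at the
   new starting vertex. *)
move=> r0; apply: (@slack1 _ _ _ _ (ed w 3)); first by rewrite mE ?pos; lia.
move=> f hf; case: (heff 3 f) => //; [lia | exact: eff_leaf hf | move=> fE].
case/effP: hf => _ _ /(_ (w 2%N)); rewrite fE /ed !inE eqxx => /(_ isT).
by rewrite mnmBE one ?edge_mnmE ?inE ?eqxx ?orbT //; lia.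
Qed.

Lemma leaf_img mu w r v : inj_below w (3 * r.+1) ->
  (leaf_mnm mu (w 0%N) (w 1%N) (w 2%N) - edge_mnm (img (shift3 w) (3 * r)))%MM v =
  (mu - edge_mnm (img w (3 * r.+1)))%MM v.
Proof. by move=> inj; rewrite !mnmBE edge_img_shift // subnDA. Qed.

Lemma tail D mu w r c : tailable D mu w r -> cyc D mu c ->
  exists2 y, cyc D (mu - edge_mnm (img w (3 * r)))%MM y & bnd D mu (c - tailp w r * y).
Proof.
elim: r w mu c => [|r IH] w mu c tl hc /=.
  exists c; last by rewrite mul1r subrr; exact: bnd0.
  apply: cycW hc => // v; rewrite mnmBE edge_mnmE.
  by case: imgP => [[]//|_]; rewrite subn0.
have [inj one pos hD heff fr] := tl.
have [] := @leaf k s D mu (w 0%N) (w 1%N) (w 2%N) _ _ _ _ _ _ _ c hc.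
- by apply: hD; lia.
- by apply: (inj_neq inj); lia.
- by apply: (inj_neq inj); lia.
- by apply: pos; lia.
- by apply: one; lia.
- exact: fr.
- by move=> f hf; apply: (heff 1) => //; lia.
move=> y hy bc; have [y' hy' by'] := IH _ _ _ (tailable_shift tl) hy.
exists y'; first by apply: cycW hy' => // v; rewrite leaf_img.
apply: (bnd_trans bc); rewrite -mulrA -mulrBr.
apply: (bndMl (mu := edge_mnm [set w 0%N; w 1%N; w 2%N])) by'.
  move=> v; rewrite mnmBE subnKC // edge_mnmE; case: (boolP (v \in _)) => //.
  by rewrite !inE -orbA => /or3P[]/eqP->; apply: pos; lia.
by apply: cyc_gen_sub; apply: hD; lia.
Qed.

Lemma tail_inj D mu w r y : tailable D mu w r ->
  chain D (mu - edge_mnm (img w (3 * r)))%MM y -> bnd D mu (tailp w r * y) ->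
  bnd D (mu - edge_mnm (img w (3 * r)))%MM y.
Proof.
elim: r w mu => [|r IH] w mu tl hy /=.
  rewrite mul1r; apply: bndW => // v; rewrite mnmBE edge_mnmE.
  by case: imgP => [[]//|_]; rewrite subn0.
have [inj one pos hD heff fr] := tl; rewrite -mulrA.
have tl' := tailable_shift tl; have pr := @tl_pos _ _ _ _ tl'.
have hy' : chain D (leaf_mnm mu (w 0%N) (w 1%N) (w 2%N) - edge_mnm (img (shift3 w) (3 * r)))%MM y.
  by apply: chainW hy => // v; rewrite leaf_img.
have tp : cyc D (edge_mnm (img (shift3 w) (3 * r))) (tailp (shift3 w) r).
  by apply: tailp_cyc => [|i li]; [exact: tl_inj tl' | exact: tl_edge tl' _ li].
move/(@leaf_inj k s D mu (w 0%N) (w 1%N) (w 2%N)) => h.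
have {}h : bnd D (leaf_mnm mu (w 0%N) (w 1%N) (w 2%N)) (tailp (shift3 w) r * y).
  apply: h.
  - by apply: hD; lia.
  - by apply: (inj_neq inj); lia.
  - by apply: (inj_neq inj); lia.
  - by apply: pos; lia.
  - by apply: one; lia.
  - exact: fr.
  - apply: chainW (chainM tp.1 hy') => // v; rewrite mnmDE mnmBE subnKC //.
    by rewrite edge_mnmE; case: imgP => // -[i li ->]; apply: pr.
by have := IH _ _ tl' hy' h; apply: bndW => // v; rewrite leaf_img.
Qed.

(* A path with 3 r + 1 edges, w 0 .. w (3 r + 1); its two ends may coincide. *)
Record strip D mu w r := Strip {
  st_inj : inj_below w (3 * r).+1;
  st_one : forall i, (0 < i <= 3 * r)%N -> mu (w i) = 1%N;
  st_edge : forall i, (i <= 3 * r)%N -> ed w i \in D;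
  st_eff : forall i f, (0 < i <= 3 * r)%N -> f \in eff D mu (w i) ->
    f = ed w i.-1 \/ f = ed w i;
  st_pos : (0 < mu (w 0%N))%N;
  st_free : slack D mu (w 0%N);
  st_last : forall i, (0 < i <= 3 * r)%N -> w (3 * r).+1 != w i;
  st_pos_last : ((w (3 * r).+1 == w 0%N) < mu (w (3 * r).+1))%N;
  st_free_last : slack D mu (w (3 * r).+1) }.

(** If the two ends coincide, the removal also lowers the exponent at the last vertex, which is why
    [st_pos_last] asks for 2 there; afterwards the ends are distinct. *)
Lemma strip_shift D mu w r : strip D mu w r.+1 ->
  strip D (leaf_mnm mu (w 0%N) (w 1%N) (w 2%N)) (shift3 w) r.
Proof.
move=> st.
have mE i : (i <= 3 * r)%N -> leaf_mnm mu (w 0%N) (w 1%N) (w 2%N) (w i.+3) = mu (w i.+3).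
  by move=> li; apply: leaf_mnm_out; apply: (inj_neq (st_inj st)); lia.
have E : shift3 w (3 * r).+1 = w (3 * r.+1).+1 by rewrite /shift3 mulnS.
have last i : (0 < i <= 3 * r.+1)%N -> w (3 * r.+1).+1 != w i by exact: (st_last st).
split; rewrite ?E.
- by move=> i j li lj /(st_inj st) h; have := h; lia.
- by move=> i li; rewrite mE ?(st_one st) //; lia.
- by move=> i li; apply: (st_edge st (i := i.+3)); lia.
- move=> i f li /eff_leaf hf.
  have [|->|->] := st_eff st _ hf; [lia | left | by right].
  by case: i li {hf} => // i; rewrite andbF.
- by rewrite mE // (st_one st) //; lia.
- apply: (@slack1 _ _ _ _ (ed w 3)); first by rewrite mE ?(st_one st); lia.
  move=> f hf; case: (st_eff st (i := 3) _ (eff_leaf hf)) => // [|fE]; first by lia.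
  case/effP: hf => _ _ /(_ (w 2%N)); rewrite fE /ed !inE eqxx => /(_ isT).
  by rewrite mnmBE (st_one st) ?edge_mnmE ?inE ?eqxx ?orbT //; lia.
- by move=> i li; apply: last; lia.
- rewrite [w _ == _](negPf (last 3 _)); last by lia.
  rewrite mnmBE edge_mnmE !inE (negPf (last 1 _)) ?(negPf (last 2 _)) ?orbF; try lia.
  by have := st_pos_last st; case: (_ == _); case: (mu _) => // -[].
have w01 : w 0%N != w 1%N by apply: (inj_neq (st_inj st)); lia.
have w02 : w 0%N != w 2%N by apply: (inj_neq (st_inj st)); lia.
apply: slack_leaf => //; first by apply: (st_edge st (i := 0)).
- exact: st_pos st.
- by rewrite (st_one st) //; lia.
- exact: st_free_last st.
- by apply: last; lia.
- by apply: last; lia.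
Qed.

Lemma acyclic D mu w r c : strip D mu w r -> cyc D mu c -> bnd D mu c.
Proof.
elim: r w mu c => [|r IH] w mu c st hc.
  (* A single edge is left, and both its ends are slack. *)
  apply: (@cyc_cone k s D mu (w 0%N) (w 1%N)) hc.
  - exact: (st_edge st (i := 0)).
  - apply/mnm_lepP => v; rewrite edge_mnmE; case: (boolP (v \in _)) => //.
    rewrite !inE => /orP[]/eqP->; first exact: st_pos st.
    exact: leq_ltn_trans (leq0n _) (st_pos_last st).
  - exact: st_free st.
  - exact: st_free_last st.
have e0 : ed w 0 \in D by apply: (st_edge st (i := 0)).
have [] := @leaf k s D mu (w 0%N) (w 1%N) (w 2%N) e0 _ _ _ _ _ _ c hc.
- by apply: (inj_neq (st_inj st)); lia.
- by apply: (inj_neq (st_inj st)); lia.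
- exact: st_pos st.
- by apply: (st_one st); lia.
- exact: st_free st.
- by move=> f hf; apply: (st_eff st (i := 1)) => //; lia.
move=> y hy bc; apply: (bnd_eq bc).
apply: (bndMl (mu := edge_mnm [set w 0%N; w 1%N; w 2%N])
  (nu := leaf_mnm mu (w 0%N) (w 1%N) (w 2%N))).
- move=> v; rewrite mnmBE subnKC // edge_mnmE; case: (boolP (v \in _)) => //.
  rewrite !inE -orbA => /or3P[]/eqP->; first exact: st_pos st.
    by rewrite (st_one st) //; lia.
  by rewrite (st_one st) //; lia.
- by apply: cyc_gen_sub => //; apply: (st_edge st); lia.
exact: IH (strip_shift st) hy.
Qed.

End Paths.

(** * Closed paths in an edge set *)

Section Arcs.
Variables (k : fieldType) (s : nat).
Local Notation C := (ext k {set 'I_s}).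
Implicit Types (D F : {set {set 'I_s}}) (mu nu rho : 'X_{1..s}) (x y z c Q : C)
  (e f g : {set 'I_s}) (u v : 'I_s) (r : nat).

(** The multidegree of a segment, with multiplicity; on a closed path, a range containing the index
    [n] counts the centre. *)
Definition rg (P : nat -> 'I_s) a b (v : 'I_s) : nat := (\sum_(a <= i < b) (v == P i))%N.

Lemma rg_cat P a b d v : (a <= b)%N -> (b <= d)%N ->
  rg P a d v = (rg P a b v + rg P b d v)%N.
Proof. by move=> ab bc; rewrite /rg (big_cat_nat (n := b)). Qed.

Lemma rgS P a v : rg P a a.+1 v = (v == P a).
Proof. by rewrite /rg big_nat1. Qed.

Lemma rg_nil P a b v : (b <= a)%N -> rg P a b v = 0%N.
Proof. by move=> ba; rewrite /rg big_geq. Qed.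

Lemma rg_out P a b v : (forall i, (a <= i < b)%N -> v != P i) -> rg P a b v = 0%N.
Proof. by move=> h; rewrite /rg big_nat big1 // => i /h /negPf ->. Qed.

Lemma rg_in P a b i : (a <= i < b)%N ->
  (forall j, (a <= j < b)%N -> P i = P j -> j = i) -> rg P a b (P i) = 1%N.
Proof.
move=> ib h; rewrite (@rg_cat _ _ i); try lia.
rewrite (@rg_cat _ i i.+1 b); try lia.
rewrite rgS eqxx !rg_out // => j lj; apply/eqP => /h; lia.
Qed.

Lemma rg_img P a n v : inj_below (fun i => P (a + i)%N) n ->
  edge_mnm (img (fun i => P (a + i)%N) n) v = rg P a (a + n) v.
Proof.
move=> inj; rewrite edge_mnmE; case: imgP => [[i li ->]|h].
  rewrite rg_in //; first by lia.
  move=> j lj e; suff: (j - a)%N = i by lia.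
  by apply: (inj _ _ _ _ _) => //; rewrite ?subnKC //; lia.
rewrite rg_out // => i li; apply/eqP => vi; case: h; exists (i - a)%N; first by lia.
by rewrite subnKC //; lia.
Qed.

(** A cycle that meets the rest of [E] only at [P 0]. Since [P n = P 0], a segment can end at the
    centre without reduction of indices modulo [n]. *)
Record arc (E : {set {set 'I_s}}) (P : nat -> 'I_s) n := Arc {
  arc_gt2 : (2 < n)%N;
  arc_close : P n = P 0%N;
  arc_inj : inj_below P n;
  arc_edge : forall i, (i < n)%N -> ed P i \in E;
  arc_inc : forall i f, (0 < i < n)%N -> f \in E -> P i \in f ->
    f = ed P i.-1 \/ f = ed P i }.

Section Arc.
Variables (E : {set {set 'I_s}}) (P : nat -> 'I_s) (n : nat).
Hypothesis arcP : arc E P n.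

Let Pinj := arc_inj arcP.
Let Pn := arc_close arcP.

Lemma arc_neq i j : (i <= n)%N -> (0 < j < n)%N -> i != j -> P i != P j.
Proof.
move=> li lj ij; have [->|ni] := eqVneq i n.
  by rewrite Pn; apply: (inj_neq Pinj); lia.
by apply: (inj_neq Pinj); lia.
Qed.

Lemma rgP a b i : (0 < i < n)%N -> (b <= n.+1)%N -> rg P a b (P i) = (a <= i < b)%N.
Proof.
move=> li lb; case: (boolP (a <= i < b)%N) => [ib|ib].
  rewrite rg_in // => j lj e; apply/eqP; apply: contraT => ji.
  have lj' : (j <= n)%N by lia.
  by have := arc_neq lj' li ji; rewrite e eqxx.
rewrite rg_out // => j lj; rewrite eq_sym; apply: arc_neq => //; first by lia.
by apply: contraNneq ib => <-.
Qed.

Lemma rgP0 a b : (0 < a)%N -> (b <= n)%N -> rg P a b (P 0%N) = 0%N.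
Proof. by move=> a0 lb; rewrite rg_out // => j lj; apply: arc_neq; lia. Qed.

Lemma edge_rg i v : (i < n)%N -> edge_mnm (ed P i) v = rg P i i.+2 v.
Proof.
move=> li; rewrite (@rg_cat _ _ i.+1) // !rgS edge_mnmE /ed !inE.
have n2 := arc_gt2 arcP.
have : P i != P i.+1.
  have [->|i0] := posnP i; first by apply: arc_neq; lia.
  by rewrite eq_sym; apply: arc_neq; lia.
by have [->|//] := eqVneq v (P i) => /negPf ->.
Qed.

(** Equal edges at [i < j] force [j = i + 1] and then [P (i + 2) = P i], impossible in a cycle of
    length greater than 2. *)
Lemma ed_inj i j : (i < n)%N -> (j < n)%N -> ed P i = ed P j -> i = j.
Proof.
have n2 := arc_gt2 arcP.
move=> li lj e; apply/eqP; apply: contraT => ij.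
wlog lij : i j li lj e ij / (i < j)%N.
  by move=> H; case: (ltnP i j) => h; [apply: (H i j) | apply: (H j i)] => //; lia.
have : P j \in ed P i by rewrite e !inE eqxx.
rewrite !inE => /orP[]; first by rewrite eq_sym (negPf (arc_neq _ _ _)) //; lia.
move=> /eqP ji; have {}ji : j = i.+1.
  apply/eqP; apply: contraT => h; have lj' : (0 < j < n)%N by lia.
  by have := arc_neq li lj'; rewrite eq_sym h -ji eqxx => /(_ isT).
have : P i \in ed P j by rewrite -e !inE eqxx.
rewrite !inE => /orP[]; first by rewrite (negPf (arc_neq _ _ _)) //; lia.
rewrite ji; have [n3|n3] := eqVneq i.+2 n.
  rewrite n3 Pn eq_sym (negPf (arc_neq _ _ _)) //; lia.
by rewrite (negPf (arc_neq _ _ _)) //; lia.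
Qed.

(** The indices 0 and [n] name the same vertex, so a segment may contain one of them but not
    both. *)
Lemma arc_inj_from a l : (a + l <= n.+1)%N -> (0 < a)%N || (a + l <= n)%N ->
  inj_below (fun i => P (a + i)%N) l.
Proof.
move=> le h i j li lj e; apply/eqP; apply: contraT => ij.
wlog lij : i j li lj e ij / (i < j)%N.
  by move=> H; case: (ltnP i j) => h'; [apply: (H i j) | apply: (H j i)] => //; lia.
have [ai|ai] := posnP (a + i).
  by move/eqP: e; rewrite ai (negPf (arc_neq _ _ _)) //; lia.
by move/esym/eqP: e; rewrite (negPf (arc_neq _ _ _)) //; lia.
Qed.

Variables (D : {set {set 'I_s}}) (mu : 'X_{1..s}).
Hypothesis sD : D \subset E.

(** The left edge is cut, by deletion or by a zero exponent at its other end, so at most one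
    effective edge remains. *)
Lemma slackl a : (0 < a < n)%N -> (0 < mu (P a))%N ->
  mu (P a.-1) = 0%N \/ ed P a.-1 \notin D -> slack D mu (P a).
Proof.
move=> la ma h; apply: (slack1 (e := ed P a)) => // f /effP[fD af hf].
case: (arc_inc arcP la (subsetP sD _ fD) af) => // fE; case: h; last by rewrite -fE fD.
by have := hf (P a.-1); rewrite fE !inE eqxx => /(_ isT); case: (mu _).
Qed.

Lemma slackr a : (0 < a < n)%N -> (0 < mu (P a))%N ->
  mu (P a.+1) = 0%N \/ ed P a \notin D -> slack D mu (P a).
Proof.
move=> la ma h; apply: (slack1 (e := ed P a.-1)) => // f /effP[fD af hf].
case: (arc_inc arcP la (subsetP sD _ fD) af) => // fE; case: h; last by rewrite -fE fD.
by have := hf (P a.+1); rewrite fE !inE eqxx orbT => /(_ isT); case: (mu _).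
Qed.

Lemma arc_tailable a r : (a + 3 * r <= n.+1)%N -> (0 < a)%N || (a + 3 * r <= n)%N ->
  (forall i, (a < i)%N -> (i.+1 < a + 3 * r)%N -> mu (P i) = 1%N) ->
  (forall i, (a <= i < a + 3 * r)%N -> (0 < mu (P i))%N) ->
  (forall i, (a <= i)%N -> (i.+1 < a + 3 * r)%N -> ed P i \in D) ->
  ((0 < r)%N -> slack D mu (P a)) ->
  tailable D mu (fun i => P (a + i)%N) r.
Proof.
move=> le h one pos hD sl; split.
- exact: arc_inj_from.
- by move=> i i0 li; apply: one; lia.
- by move=> i li; apply: pos; lia.
- by move=> i li; rewrite /ed addnS; apply: hD; lia.
- move=> i f i0 li /effP[fD fi _].
  case: (@arc_inc _ _ _ arcP (a + i) f _ (subsetP sD _ fD) fi) => [|->|->]; first by lia.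
    by left; rewrite /ed; congr [set P _; P _]; lia.
  by right; rewrite /ed; congr [set P _; P _]; lia.
- by move/sl; rewrite addn0.
Qed.

Lemma arc_tail nu a r c : (a + 3 * r <= n.+1)%N -> (0 < a)%N || (a + 3 * r <= n)%N ->
  (forall i, (a < i)%N -> (i.+1 < a + 3 * r)%N -> mu (P i) = 1%N) ->
  (forall i, (a <= i < a + 3 * r)%N -> (0 < mu (P i))%N) ->
  (forall i, (a <= i)%N -> (i.+1 < a + 3 * r)%N -> ed P i \in D) ->
  ((0 < r)%N -> slack D mu (P a)) ->
  (forall v, mu v <= nu v + rg P a (a + 3 * r) v)%N ->
  cyc D mu c ->
  exists2 y, cyc D nu y & bnd D mu (c - tailp k (fun i => P (a + i)%N) r * y).
Proof.
move=> le h one pos hD sl hnu hc.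
have tl := arc_tailable le h one pos hD sl.
have [y hy by_] := tail tl hc; exists y => //.
apply: cycW hy => // v; rewrite mnmBE rg_img; last exact: tl_inj tl.
by have := hnu v; lia.
Qed.

Lemma arc_tailp a r : (a + 3 * r <= n.+1)%N -> (0 < a)%N || (a + 3 * r <= n)%N ->
  (forall i, (a <= i)%N -> (i.+1 < a + 3 * r)%N -> ed P i \in D) ->
  (forall v, rg P a (a + 3 * r) v <= mu v)%N ->
  cyc D mu (tailp k (fun i => P (a + i)%N) r).
Proof.
move=> le h hD hm.
have inj : inj_below (fun i => P (a + i)%N) (3 * r).
  exact: arc_inj_from.
apply: cycW (tailp_cyc _ inj _) => // [v|i li]; first by rewrite rg_img.
by rewrite /ed addnS; apply: hD; lia.
Qed.

(** With [a = 0] and [b = n] the path goes around the whole cycle; its ends then share the centre,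
    whose exponent must exceed 1. *)
Lemma arc_acyclic a b c : (a < b <= n)%N -> ((b - a) %% 3 = 1)%N ->
  (forall i, (a < i < b)%N -> mu (P i) = 1%N) ->
  (forall i, (a <= i < b)%N -> ed P i \in D) ->
  (0 < mu (P a))%N -> slack D mu (P a) ->
  ((P b == P a) < mu (P b))%N -> slack D mu (P b) ->
  cyc D mu c -> bnd D mu c.
Proof.
move=> lab m3 one hD pa sa pb sb.
pose r := ((b - a) %/ 3)%N; have bE : b = (a + (3 * r).+1)%N.
  by have := divn_eq (b - a) 3; rewrite m3 -/r; lia.
apply: (acyclic (w := fun i => P (a + i)%N) (r := r)); split; rewrite ?addn0 -?bE //.
- by apply: arc_inj_from; lia.
- by move=> i li; apply: one; lia.
- by move=> i li; rewrite /ed addnS; apply: hD; lia.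
- move=> i f li /effP[fD fi _].
  case: (@arc_inc _ _ _ arcP (a + i) f _ (subsetP sD _ fD) fi) => [|->|->]; first by lia.
    by left; rewrite /ed; congr [set P _; P _]; lia.
  by right; rewrite /ed; congr [set P _; P _]; lia.
- by move=> i li; apply: arc_neq; lia.
Qed.

Lemma segment_acyclic a b c : (0 < a)%N -> (a < b < n)%N -> ((b - a) %% 3 = 1)%N ->
  (forall i, (a <= i <= b)%N -> mu (P i) = 1%N) ->
  (forall i, (a <= i < b)%N -> ed P i \in D) ->
  mu (P a.-1) = 0%N \/ ed P a.-1 \notin D ->
  mu (P b.+1) = 0%N \/ ed P b \notin D ->
  cyc D mu c -> bnd D mu c.
Proof.
move=> a0 lab m3 one hD ha hb.
apply: (@arc_acyclic a b) => //; try lia.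
- by move=> i li; apply: one; lia.
- by rewrite one //; lia.
- by apply: slackl => //; rewrite ?one //; lia.
- by rewrite (negPf (arc_neq _ _ _)) ?one //; lia.
- by apply: slackr => //; rewrite ?one //; lia.
Qed.

End Arc.
End Arcs.

(** * Multidegrees of an eight *)

Section Eight.
Variables (k : fieldType) (s : nat).
Local Notation C := (ext k {set 'I_s}).
Implicit Types (D F : {set {set 'I_s}}) (mu nu rho : 'X_{1..s}) (x y z c : C) (P Q : nat -> 'I_s) (n m : nat)
  (e f g : {set 'I_s}) (u v : 'I_s) (r : nat).

(* The chains whose classes are improper: the clauses are boundaries, sums,
   classes from a deleted edge, and products with a class from a deleted
   vertex v. *)
Inductive imp (E : {set {set 'I_s}}) (V : {set 'I_s}) mu : C -> Prop :=
| imp_bnd z : bnd E mu z -> imp E V mu z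
| imp_add x y : imp E V mu x -> imp E V mu y -> imp E V mu (x + y)
| imp_del e z : e \in E -> cyc (E :\ e) mu z -> imp E V mu z
| imp_mul nu rho u v x y : v \in V -> nu v = 0%N -> (0 < nu u)%N ->
    cyc E nu x -> cyc E rho y -> (forall v, nu v + rho v <= mu v)%N ->
    imp E V mu (x * y).

Record eight (E : {set {set 'I_s}}) (V : {set 'I_s}) (P : nat -> 'I_s) n
    (Q : nat -> 'I_s) m := Eight {
  eight_l : arc E P n;
  eight_r : arc E Q m;
  eight_c : P 0%N = Q 0%N;
  eight_disj : forall i j, (0 < i < n)%N -> (0 < j < m)%N -> P i != Q j;
  eight_edge : forall f, f \in E ->
    (exists2 i, (i < n)%N & f = ed P i) \/ (exists2 j, (j < m)%N & f = ed Q j);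
  eight_vert : forall v, v \in V <->
    (exists2 i, (i < n)%N & v = P i) \/ (exists2 j, (j < m)%N & v = Q j) }.

Lemma eight_sym E V P n Q m : eight E V P n Q m -> eight E V Q m P n.
Proof.
case=> aP aQ cPQ dPQ eE vV; split=> //.
- by move=> i j li lj; rewrite eq_sym; apply: dPQ.
- by move=> f /eE[]; [right | left].
- by move=> v; rewrite vV; split=> -[]; [right | left | right | left].
Qed.

(* The exponent is j at the centre P 0 and 1 on P a .. P (b-1) and
   Q a' .. Q (b'-1). *)
Definition M P Q j a b a' b' : 'X_{1..s} :=
  [multinom (j * (v == P 0%N) + rg P a b v + rg Q a' b' v)%N | v < s].

Lemma ME P Q j a b a' b' v :
  M P Q j a b a' b' v = (j * (v == P 0%N) + rg P a b v + rg Q a' b' v)%N.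
Proof. exact: mnmE. Qed.

Lemma cyc_dead D mu e v y : v \in e -> mu v = 0%N -> cyc D mu y -> cyc (D :\ e) mu y.
Proof.
move=> ve m0 [hy dy]; split=> //; apply: (chain_contr0 hy).
apply: contr_eq0 => F eF; apply/eqP; apply: contraT => /hy/faceP[_ /(_ v)].
by rewrite m0 => /(leq_trans (deg_mem v eF)); rewrite edge_mnmE ve.
Qed.

Section Config.
Variables (E : {set {set 'I_s}}) (V : {set 'I_s}) (P : nat -> 'I_s) (n : nat)
  (Q : nat -> 'I_s) (m : nat).
Hypothesis cfg : eight E V P n Q m.
Let aP := eight_l cfg.
Let aQ := eight_r cfg.
Let PQ := eight_c cfg.
Let n2 : (2 < n)%N := arc_gt2 aP.
Let m2 : (2 < m)%N := arc_gt2 aQ.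
Local Notation M := (M P Q).

Lemma P_neq_c i : (0 < i < n)%N -> (P i == P 0%N) = false.
Proof. by move=> li; rewrite eq_sym (negPf (arc_neq aP _ _ _)) //; lia. Qed.

Lemma Q_neq_c i : (0 < i < m)%N -> (Q i == P 0%N) = false.
Proof. by move=> li; rewrite PQ eq_sym (negPf (arc_neq aQ _ _ _)) //; lia. Qed.

Lemma M_P j a b a' b' i : (0 < i < n)%N -> (b <= n.+1)%N -> (b' <= m.+1)%N ->
  M j a b a' b' (P i) = (a <= i < b)%N.
Proof.
move=> li lb lb'; rewrite ME (rgP aP) // P_neq_c //.
rewrite rg_out ?muln0 ?addn0 // => l ll.
have [->|l0] := posnP l; first by rewrite -PQ P_neq_c.
have [->|lm] := eqVneq l m; first by rewrite (arc_close aQ) -PQ P_neq_c.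
by apply: (eight_disj cfg) => //; lia.
Qed.

Lemma M_Q j a b a' b' i : (0 < i < m)%N -> (b <= n.+1)%N -> (b' <= m.+1)%N ->
  M j a b a' b' (Q i) = (a' <= i < b')%N.
Proof.
move=> li lb lb'; rewrite ME (rgP aQ) // Q_neq_c //.
rewrite rg_out ?muln0 // => l ll.
have [->|l0] := posnP l; first by rewrite Q_neq_c.
have [->|lm] := eqVneq l n; first by rewrite (arc_close aP) Q_neq_c.
by rewrite eq_sym; apply: (eight_disj cfg) => //; lia.
Qed.

Lemma M_c j a b a' b' : (0 < a)%N -> (b <= n)%N -> (0 < a')%N -> (b' <= m)%N ->
  M j a b a' b' (P 0%N) = j.
Proof.
move=> a0 lb a0' lb'; rewrite ME (rgP0 aP) // eqxx muln1 addn0.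
by rewrite PQ (rgP0 aQ) ?addn0.
Qed.

Lemma edP_neq i j : (i < n)%N -> (j < n)%N -> i != j -> ed P i != ed P j.
Proof. by move=> li lj; apply: contraNneq => /(ed_inj aP) ->. Qed.

Lemma edQ_neq i j : (i < m)%N -> (j < m)%N -> i != j -> ed Q i != ed Q j.
Proof. by move=> li lj; apply: contraNneq => /(ed_inj aQ) ->. Qed.

Lemma edPQ i j : (i < n)%N -> (j < m)%N -> ed P i != ed Q j.
Proof.
move=> li lj; apply/eqP => /setP e.
suff [l ll pl] : exists2 l, (0 < l < n)%N & P l \in ed P i.
  move: pl; rewrite e !inE.
  have h i' : (i' <= m)%N -> P l == Q i' = false.
    move=> li'; have [->|i0] := posnP i'; first by rewrite -PQ P_neq_c.
    have [->|im] := eqVneq i' m; first by rewrite (arc_close aQ) -PQ P_neq_c.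
    by rewrite (negPf (eight_disj cfg _ _)) //; lia.
  by rewrite !h //; lia.
have [i0|i0] := posnP i; [exists 1%N | exists i]; rewrite ?i0 ?inE ?eqxx ?orbT //; lia.
Qed.

Lemma P_edge i : (i < n)%N -> ed P i \in E. Proof. exact: arc_edge aP _. Qed.
Lemma Q_edge i : (i < m)%N -> ed Q i \in E. Proof. exact: arc_edge aQ _. Qed.

Lemma center_edge f : f \in E -> P 0%N \in f ->
  f = ed P 0 \/ f = ed P n.-1 \/ f = ed Q 0 \/ f = ed Q m.-1.
Proof.
move=> /(eight_edge cfg)[] [i li ->]; rewrite !inE.
  have [->|i0] := posnP i; first by left.
  rewrite (negPf (arc_neq aP _ _ _)) //=; try lia.
  have [->|ni] := eqVneq i n.-1; first by right; left.
  by rewrite (negPf (arc_neq aP _ _ _)) //=; lia.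
rewrite PQ; have [->|i0] := posnP i; first by right; right; left.
rewrite (negPf (arc_neq aQ _ _ _)) //=; try lia.
have [->|ni] := eqVneq i m.-1; first by right; right; right.
by rewrite (negPf (arc_neq aQ _ _ _)) //=; lia.
Qed.

Lemma center_eff D mu f : D \subset E -> mu (Q 1%N) = 0%N -> mu (Q m.-1) = 0%N ->
  f \in eff D mu (P 0%N) -> f = ed P 0 \/ f = ed P n.-1.
Proof.
move=> sD h1 h2 /effP[fD cf hf].
have [->|[->|[fE|fE]]] := center_edge (subsetP sD _ fD) cf; auto.
  by have := hf (Q 1%N); rewrite fE h1 !inE eqxx orbT => /(_ isT).
by have := hf (Q m.-1); rewrite fE h2 !inE eqxx => /(_ isT).
Qed.

Lemma edge_noncenter f : f \in E -> exists2 v, v \in f & v != P 0%N.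
Proof.
move=> /(eight_edge cfg)[] [i li ->].
  have [i0|i0] := posnP i.
    by exists (P 1%N); rewrite ?i0 ?inE ?eqxx ?orbT // P_neq_c //; lia.
  by exists (P i); rewrite ?inE ?eqxx // P_neq_c //; lia.
have [i0|i0] := posnP i.
  by exists (Q 1%N); rewrite ?i0 ?inE ?eqxx ?orbT // Q_neq_c //; lia.
by exists (Q i); rewrite ?inE ?eqxx // Q_neq_c //; lia.
Qed.

(** Every edge has an end other than the centre, where the exponent is 0; only the empty face
    remains, whatever the exponent at the centre. *)
Lemma cyc_center D j y : D \subset E -> cyc D (M j 1 1 1 1) y -> cyc D (M 0 1 1 1 1) y.
Proof.
move=> sD [hy dy]; split=> // F /hy/faceP[FD h]; apply/faceP; split=> // v.
have -> : F = set0.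
  apply/eqP; apply: contraT => /set0Pn[f fF].
  have [w wf wc] := edge_noncenter (subsetP sD _ (subsetP FD _ fF)).
  have := leq_trans (deg_mem w fF) (h w).
  by rewrite edge_mnmE wf ME (negPf wc) muln0 !rg_nil.
by rewrite deg0 mnm0E.
Qed.

(* [x] is lifted to a cycle [xi] of multidegree nu whose coefficient of e is x;
   then [z - xi * y] is homologous to a cycle that avoids e. *)
Lemma imp_peel mu nu rho e u v x y z : v \in V -> nu v = 0%N -> (0 < nu u)%N ->
  e \in E -> (forall v, edge_mnm e v <= nu v)%N ->
  (forall v, nu v + rho v <= mu v)%N ->
  cyc (E :\ e) (nu - edge_mnm e)%MM x -> bnd (E :\ e) nu x ->
  cyc (E :\ e) rho y -> cyc E mu z ->
  bnd (E :\ e) (mu - edge_mnm e)%MM (contr e z - x * y) -> imp E V mu z.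
Proof.
move=> vV nv nu_ eE en nr cx bx cy cz bz.
have [xi cxi xie] := ext_lift eE en cx bx.
have cy' : cyc E rho y by apply: cycW cy => //; exact: subD1set.
have cxy : cyc E mu (xi * y) by exact: cycM cxi cy'.
have [] := @del k s E mu e (z - xi * y); first exact: cycB.
  by rewrite raddfB /= (contrMl _ cy.1) xie.
move=> z' cz' bz'; rewrite -(subrK (xi * y) z) addrC.
apply: imp_add; first exact: imp_mul vV nv nu_ cxi cy' nr.
rewrite -(subrK z' (z - _)); apply: imp_add; first exact: imp_bnd.
exact: imp_del eE cz'.
Qed.

Lemma imp_link mu e z : e \in E -> cyc E mu z ->
  (forall c, cyc (E :\ e) (mu - edge_mnm e)%MM c -> bnd (E :\ e) (mu - edge_mnm e)%MM c) ->
  imp E V mu z.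
Proof.
move=> eE cz h; have [z' cz' bz'] := del cz (h _ (cyc_contr e cz)).
rewrite -(subrK z' z); apply: imp_add; first exact: imp_bnd.
exact: imp_del eE cz'.
Qed.

Lemma M_edgeP0 j b a' b' : (2 <= b)%N ->
  (M j.+1 1 b a' b' - edge_mnm (ed P 0))%MM = M j 2 b a' b'.
Proof.
move=> lb; apply/mnmP => v; rewrite mnmBE !ME (edge_rg aP); last lia.
rewrite (@rg_cat _ _ 0 1 2) // (@rg_cat _ P 1 2 b) // !rgS mulSn.
lia.
Qed.

Lemma M_edgeQ0 j a b b' : (2 <= b')%N ->
  (M j.+1 a b 1 b' - edge_mnm (ed Q 0))%MM = M j a b 2 b'.
Proof.
move=> lb; apply/mnmP => v; rewrite mnmBE !ME (edge_rg aQ); last lia.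
rewrite (@rg_cat _ _ 0 1 2) // (@rg_cat _ Q 1 2 b') // !rgS PQ mulSn.
lia.
Qed.

Lemma M_edgeP1 j b a' b' : (3 <= b)%N ->
  (M j 1 b a' b' - edge_mnm (ed P 1))%MM = M j 3 b a' b'.
Proof.
move=> lb; apply/mnmP => v; rewrite mnmBE !ME (edge_rg aP); last lia.
rewrite (@rg_cat _ P 1 3 b) //; lia.
Qed.

End Config.
End Eight.

(** * One cycle length is not 1 mod 3 *)

Section Eight.
Variables (k : fieldType) (s : nat).
Local Notation C := (ext k {set 'I_s}).
Implicit Types (D F : {set {set 'I_s}}) (mu nu rho : 'X_{1..s}) (x y z c : C)
  (P Q : nat -> 'I_s) (n m : nat)
  (e f g : {set 'I_s}) (u v : 'I_s) (r : nat).

Section Config.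
Variables (E : {set {set 'I_s}}) (V : {set 'I_s}) (P : nat -> 'I_s) (n : nat)
  (Q : nat -> 'I_s) (m : nat).
Hypothesis cfg : eight E V P n Q m.
Let aP := eight_l cfg.
Let aQ := eight_r cfg.
Let PQ := eight_c cfg.
Let n2 : (2 < n)%N := arc_gt2 aP.
Let m2 : (2 < m)%N := arc_gt2 aQ.
Local Notation M := (M P Q).

Lemma P_vert i : (i < n)%N -> P i \in V.
Proof. by move=> li; apply/(eight_vert cfg); left; exists i. Qed.

Lemma Q_vert i : (i < m)%N -> Q i \in V.
Proof. by move=> li; apply/(eight_vert cfg); right; exists i. Qed.

Lemma edP0_mnm v : edge_mnm (ed P 0) v = ((v == P 0%N) + (v == P 1%N))%N :> nat.
Proof. by rewrite (edge_rg aP) ?(@rg_cat _ P 0 1 2) ?rgS //; lia. Qed.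

Lemma rgP1 v : rg P 1 n v = ((v == P 1%N) + rg P 2 n v)%N.
Proof. by rewrite (@rg_cat _ P 1 2 n) ?rgS //; lia. Qed.

(** In the link of [ed P 0] the [n - 2] vertices [P 2 .. P (n-1)] form whole triples and split off
    as a tail. This tail bounds once [ed P 0] is deleted, because the path [P 1 .. P n] has [n - 1]
    edges, 1 mod 3; so it lifts to a cycle that misses [Q 1]. *)
Lemma imp_mod2 j z : (n %% 3 = 2)%N -> (0 < j)%N -> cyc E (M j 1 n 1 m) z ->
  imp E V (M j 1 n 1 m) z.
Proof.
move=> n3; case: j => // j _ cz; pose r := (n %/ 3)%N.
have nE : n = (2 + 3 * r)%N by have := divn_eq n 3; rewrite n3 -/r; lia.
pose e := ed P 0; have sD : E :\ e \subset E by exact: subD1set.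
have eD i : (0 < i < n)%N -> ed P i \in E :\ e.
  by move=> li; rewrite in_setD1 (P_edge cfg) ?(edP_neq cfg); lia.
have ce := cyc_contr e cz; rewrite (M_edgeP0 cfg) in ce; last by lia.
have [|||||||y cy by_] := @arc_tail k s E P n aP (E :\ e) (M j 2 n 1 m) sD
  (M j 1 1 1 m) 2 r (contr e z) _ _ _ _ _ _ _ ce; try lia.
- by move=> i i1 i2; rewrite (M_P cfg); lia.
- by move=> i i1; rewrite (M_P cfg); lia.
- by move=> i i1 i2; apply: eD; lia.
- by move=> r0; apply: (slackl aP sD); [lia | rewrite (M_P cfg); lia | left; rewrite (M_P cfg); lia].
- by move=> v; rewrite !ME (@rg_nil _ P 1 1) // -nE; lia.
apply: (imp_peel (nu := M 1 1 n 1 1) (rho := M j 1 1 1 m) (e := e) (u := P 1%N) (v := Q 1%N)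
   _ _ _ _ _ _ _ _ cy cz (x := tailp k (fun i => P (2 + i)%N) r)).
- by apply: Q_vert; lia.
- by rewrite (M_Q cfg); lia.
- by rewrite (M_P cfg); lia.
- by apply: (P_edge cfg); lia.
- by move=> v; rewrite ME edP0_mnm rgP1; lia.
- by move=> v; rewrite !ME (@rg_nil _ P 1 1) // (@rg_nil _ Q 1 1) //; lia.
- rewrite (M_edgeP0 cfg); last by lia.
  apply: (arc_tailp k aP sD) => //; try lia; first by move=> i i1 i2; apply: eD; lia.
  by move=> v; rewrite ME -nE; lia.
- apply: (arc_acyclic (b := n) (a := 1) aP sD).
  + lia.
  + lia.
  + by move=> i li; rewrite (M_P cfg); lia.
  + by move=> i li; apply: eD; lia.
  + by rewrite (M_P cfg); lia.
  + by apply: (slackl aP sD); [lia | rewrite (M_P cfg); lia | right; rewrite setD11].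
  + by rewrite (arc_close aP) eq_sym (P_neq_c cfg) ?(M_c cfg); lia.
  + rewrite (arc_close aP); apply: (slack1 (e := ed P n.-1)); first by rewrite (M_c cfg); lia.
    move=> f fe; case: (center_eff cfg sD _ _ fe) => //; rewrite ?(M_Q cfg); try lia.
    by move=> fE; move: fe; rewrite fE => /effP[]; rewrite setD11.
  + apply: (arc_tailp k aP sD) => //; try lia; first by move=> i i1 i2; apply: eD; lia.
    by move=> v; rewrite ME -nE (@rg_cat _ P 1 2 n); lia.
- by rewrite (M_edgeP0 cfg) //; lia.
Qed.

Lemma rgQm v : rg Q 2 m.+1 v = (rg Q 2 m v + (v == P 0%N))%N.
Proof. by rewrite (@rg_cat _ Q 2 m m.+1) ?rgS ?(arc_close aQ) ?PQ //; lia. Qed.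

Lemma rgPm v : rg P 2 n.+1 v = (rg P 2 n v + (v == P 0%N))%N.
Proof. by rewrite (@rg_cat _ P 2 n n.+1) ?rgS ?(arc_close aP) //; lia. Qed.

Lemma rgQ0 v : rg Q 0 m v = ((v == P 0%N) + rg Q 1 m v)%N.
Proof. by rewrite (@rg_cat _ Q 0 1 m) ?rgS ?PQ //; lia. Qed.

(** The edge [ed Q 0] uses the only unit at the centre; its link cuts off the path [P 1 .. P (n-1)],
    whose [n - 2] edges are 1 mod 3 in number. *)
Lemma imp_mod0_1 z : (n %% 3 = 0)%N -> cyc E (M 1 1 n 1 m) z -> imp E V (M 1 1 n 1 m) z.
Proof.
move=> n3 cz; have sD := subD1set E (ed Q 0).
apply: (@imp_link _ _ _ _ _ (ed Q 0)) (cz) _; first by apply: (Q_edge cfg); lia.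
rewrite (M_edgeQ0 cfg); last by lia.
move=> c; apply: (segment_acyclic (a := 1) (b := n.-1) aP sD); try lia.
- by move=> i li; rewrite (M_P cfg); lia.
- by move=> i li; rewrite in_setD1 (P_edge cfg) ?(edPQ cfg); lia.
- by left; rewrite (M_c cfg) //; lia.
- by left; rewrite prednK ?(arc_close aP) ?(M_c cfg); lia.
Qed.

(** The last vertex of a tail is unconstrained, so the tail [Q 2 .. Q m] may end at the centre,
    where it takes one unit of the exponent. *)
Lemma tail_through_center D j a b c : D \subset E -> (0 < a)%N -> (b <= n)%N ->
  (m %% 3 = 1)%N -> (forall i, (1 < i < m)%N -> ed Q i \in D) ->
  cyc D (M j.+1 a b 2 m) c ->
  exists2 y, cyc D (M j a b 1 1) y &
    bnd D (M j.+1 a b 2 m) (c - tailp k (fun i => Q (2 + i)%N) (m %/ 3) * y).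
Proof.
move=> sD a0 bn m3 hD cc.
have mE : (2 + 3 * (m %/ 3))%N = m.+1 by have := divn_eq m 3; rewrite m3; lia.
have [|||||||y cy by_] := @arc_tail k s E Q m aQ D (M j.+1 a b 2 m) sD
  (M j a b 1 1) 2 (m %/ 3) c _ _ _ _ _ _ _ cc; try lia.
- by move=> i i1 i2; rewrite (M_Q cfg); lia.
- move=> i i1; have [->|im] := eqVneq i m; last by rewrite (M_Q cfg); lia.
  by rewrite (arc_close aQ) -PQ (M_c cfg).
- by move=> i i1 i2; apply: hD; lia.
- by move=> r0; apply: (slackl aQ sD); [lia | rewrite (M_Q cfg); lia | left; rewrite (M_Q cfg); lia].
- by move=> v; rewrite !ME mE rgQm (@rg_nil _ Q 1 1) //; lia.
by exists y.
Qed.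

Lemma acyclic_through_center D j a b c : D \subset E -> (0 < a)%N -> (b <= n)%N ->
  (m %% 3 = 1)%N -> (forall i, (1 < i < m)%N -> ed Q i \in D) ->
  (forall y, cyc D (M j a b 1 1) y -> bnd D (M j a b 1 1) y) ->
  cyc D (M j.+1 a b 2 m) c -> bnd D (M j.+1 a b 2 m) c.
Proof.
move=> sD a0 bn m3 hD h cc; have [y cy by_] := tail_through_center sD a0 bn m3 hD cc.
have mE : (2 + 3 * (m %/ 3))%N = m.+1 by have := divn_eq m 3; rewrite m3; lia.
apply: (bnd_eq by_); apply: (bndMl (mu := M 1 1 1 2 m)) (h _ cy).
  by move=> v; rewrite !ME (@rg_nil _ P 1 1) // (@rg_nil _ Q 1 1) //; lia.
apply: (arc_tailp k aQ sD); try lia; first by move=> i i1 i2; apply: hD; lia.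
by move=> v; rewrite ME mE rgQm; lia.
Qed.

(** One unit at the centre goes to [ed Q 0] and the other to the tail [Q 2 .. Q m]; this cuts off
    the acyclic path [P 1 .. P (n-1)]. *)
Lemma imp_mod0_1_2 z : (n %% 3 = 0)%N -> (m %% 3 = 1)%N ->
  cyc E (M 2 1 n 1 m) z -> imp E V (M 2 1 n 1 m) z.
Proof.
move=> n3 m3 cz; have sD := subD1set E (ed Q 0).
apply: (@imp_link _ _ _ _ _ (ed Q 0)) (cz) _; first by apply: (Q_edge cfg); lia.
rewrite (M_edgeQ0 cfg); last by lia.
move=> c; apply: acyclic_through_center => // [i li|y].
  by rewrite in_setD1 (Q_edge cfg) ?(edQ_neq cfg); lia.
apply: (segment_acyclic (a := 1) (b := n.-1) aP sD); try lia.
- by move=> i li; rewrite (M_P cfg); lia.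
- by move=> i li; rewrite in_setD1 (P_edge cfg) ?(edPQ cfg); lia.
- by left; rewrite (M_c cfg) //; lia.
- by left; rewrite prednK ?(arc_close aP) ?(M_c cfg); lia.
Qed.

Lemma slack_center D j b' : D \subset E -> (1 < j)%N -> (b' <= m)%N ->
  slack D (M j 1 1 1 b') (P 0%N).
Proof.
move=> sD j1 lb; apply: (slack2 (e1 := ed Q 0) (e2 := ed Q m.-1)).
  by rewrite (M_c cfg) //; lia.
rewrite PQ => f; apply: (center_eff (eight_sym cfg) sD); rewrite (M_P cfg) //; lia.
Qed.

(** Only two edges are effective at the centre, so exponent 3 allows no more faces than exponent
    2. *)
Lemma cyc_center3 D y : D \subset E -> cyc D (M 3 1 1 1 m) y -> cyc D (M 2 1 1 1 m) y.
Proof.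
move=> sD [hy dy]; split=> // F /hy hF; have /faceP[FD h] := hF.
apply/faceP; split=> // v; have [->|vc] := eqVneq v (P 0%N); last first.
  by have := h v; rewrite !ME (negPf vc) !muln0.
rewrite (M_c cfg) //; try lia.
have sl : slack D (M 2 1 1 1 m) (P 0%N) by apply: slack_center; lia.
have : (deg F (P 0%N) <= #|eff D (M 2 1 1 1 m) (P 0%N)|)%N.
  rewrite degE; apply: subset_leq_card; apply/subsetP => f.
  move/(subsetP (face_eff _ hF)) => /effP[fD cf hf]; apply/effP; split=> // u /hf.
  by rewrite !ME; case: (u == P 0%N); rewrite ?muln0.
by move/leq_trans; apply; move: sl; rewrite /slack (M_c cfg) //; lia.
Qed.

(** The edge [ed P 1] is chosen because the [n - 3] vertices [P 3 .. P (n-1)] form whole triples. As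
    this edge avoids the centre, the unit that the lift needs there must be taken from the other
    factor, which is first rewritten with exponent [j - 1]. *)
Lemma imp_mod0 j z : (n %% 3 = 0)%N -> (j = 3 \/ j = 2 /\ m %% 3 = 0)%N ->
  cyc E (M j 1 n 1 m) z -> imp E V (M j 1 n 1 m) z.
Proof.
move=> n3 hj cz; pose e := ed P 1; pose r := (n %/ 3).-1.
have nE : n = (3 + 3 * r)%N by have := divn_eq n 3; rewrite n3 /r; lia.
have sD : E :\ e \subset E by exact: subD1set.
have eD i : (1 < i < n)%N -> ed P i \in E :\ e.
  by move=> li; rewrite in_setD1 (P_edge cfg) ?(edP_neq cfg); lia.
have qD i : (i < m)%N -> ed Q i \in E :\ e.
  by move=> li; rewrite in_setD1 (Q_edge cfg) // eq_sym (edPQ cfg) //; lia.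
have ce := cyc_contr e cz; rewrite (M_edgeP1 cfg) in ce; last by lia.
have [|||||||y cy by_] := @arc_tail k s E P n aP (E :\ e) (M j 3 n 1 m) sD
  (M j 1 1 1 m) 3 r (contr e z) _ _ _ _ _ _ _ ce; try lia.
- by move=> i i1 i2; rewrite (M_P cfg); lia.
- by move=> i i1; rewrite (M_P cfg); lia.
- by move=> i i1 i2; apply: eD; lia.
- by move=> r0; apply: (slackl aP sD); [lia | rewrite (M_P cfg); lia | left; rewrite (M_P cfg); lia].
- by move=> v; rewrite !ME (@rg_nil _ P 1 1) // -nE; lia.
have [y' cy' by'] : exists2 y', cyc (E :\ e) (M j.-1 1 1 1 m) y' &
    bnd (E :\ e) (M j 1 1 1 m) (y - y').
  case: hj cy => [->|[-> m3]] cy.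
    by exists y; [exact: cyc_center3 | rewrite subrr; exact: bnd0].
  (* The tail starts at the centre [Q 0] and takes all vertices of the second cycle; what remains is
     a scalar. *)
  have mE : m = (0 + 3 * (m %/ 3))%N by have := divn_eq m 3; rewrite m3; lia.
  have [|||||||y2 cy2 by2] := @arc_tail k s E Q m aQ (E :\ e) (M 2 1 1 1 m) sD
    (M 1 1 1 1 1) 0 (m %/ 3) y _ _ _ _ _ _ _ cy; try lia.
  - by move=> i i1 i2; rewrite (M_Q cfg); lia.
  - move=> i i1; have [->|i0] := posnP i; last by rewrite (M_Q cfg); lia.
    by rewrite -PQ (M_c cfg) //; lia.
  - by move=> i i1 i2; apply: qD; lia.
  - by move=> r0; rewrite -PQ; apply: slack_center.
  - by move=> v; rewrite !ME -mE rgQ0 (@rg_nil _ Q 1 1) //; lia.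
  eexists; last exact: by2; have cy3 := cyc_center cfg sD cy2.
  apply: (cycM (mu := M 1 1 1 1 m)) cy3.
    by move=> v; rewrite !ME (@rg_nil _ P 1 1) // (@rg_nil _ Q 1 1) //; lia.
  apply: (arc_tailp k aQ sD); try lia; first by move=> i i1 i2; apply: qD; lia.
  by move=> v; rewrite ME -mE rgQ0; lia.
have ctp : cyc (E :\ e) (M 1 3 n 1 1) (tailp k (fun i => P (3 + i)%N) r).
  apply: (arc_tailp k aP sD); try lia; first by move=> i i1 i2; apply: eD; lia.
  by move=> v; rewrite ME -nE; lia.
apply: (imp_peel (nu := M 1 1 n 1 1) (rho := M j.-1 1 1 1 m) (e := e) (u := P 1%N) (v := Q 1%N)
   _ _ _ _ _ _ _ _ cy' cz (x := tailp k (fun i => P (3 + i)%N) r)).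
- by apply: Q_vert; lia.
- by rewrite (M_Q cfg); lia.
- by rewrite (M_P cfg); lia.
- by apply: (P_edge cfg); lia.
- by move=> v; rewrite ME (edge_rg aP) ?(@rg_cat _ P 1 3 n); lia.
- move=> v; rewrite !ME (@rg_nil _ P 1 1) // (@rg_nil _ Q 1 1) //.
  by case: hj => [->|[-> _]]; lia.
- by rewrite (M_edgeP1 cfg) //; lia.
(* Deleting [ed P 0] too isolates [P 1]; the path [P 2 .. P n] with its [n - 2] edges, 1 mod 3, then
   shows that the tail bounds. *)
- have sD' : E :\ e :\ ed P 0 \subset E :\ e by exact: subD1set.
  apply: (bndW sD' (fun=> leqnn _)).
  have {}sD' := subset_trans sD' sD.
  have eD' i : (1 < i < n)%N -> ed P i \in E :\ e :\ ed P 0.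
    by move=> li; rewrite in_setD1 eD ?(edP_neq cfg); lia.
  apply: (arc_acyclic (b := n) (a := 2) aP sD').
  + lia.
  + lia.
  + by move=> i li; rewrite (M_P cfg); lia.
  + by move=> i li; apply: eD'; lia.
  + by rewrite (M_P cfg); lia.
  + by apply: (slackl aP sD'); [lia | rewrite (M_P cfg); lia | right; rewrite !inE eqxx /= andbF].
  + by rewrite (arc_close aP) eq_sym (P_neq_c cfg) ?(M_c cfg); lia.
  + rewrite (arc_close aP); apply: (slack1 (e := ed P n.-1)); first by rewrite (M_c cfg); lia.
    move=> f fe; case: (center_eff cfg sD' _ _ fe) => //; rewrite ?(M_Q cfg); try lia.
    by move=> fE; move: fe; rewrite fE => /effP[]; rewrite setD11.
  + apply: (arc_tailp k aP sD'); try lia; first by move=> i i1 i2; apply: eD'; lia.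
    by move=> v; rewrite ME -nE (@rg_cat _ P 1 3 n); lia.
- rewrite (M_edgeP1 cfg); last by lia.
  apply: (bnd_trans by_); rewrite -mulrBr.
  apply: (bndMl (mu := M 0 3 n 1 1)) by'.
    by move=> v; rewrite !ME (@rg_nil _ P 1 1) // (@rg_nil _ Q 1 1) //; lia.
  apply: (arc_tailp k aP sD); try lia; first by move=> i i1 i2; apply: eD; lia.
  by move=> v; rewrite ME -nE; lia.
Qed.

End Config.
End Eight.

(** * Both cycle lengths are 1 mod 3 *)

Section Eight.
Variables (k : fieldType) (s : nat).
Local Notation C := (ext k {set 'I_s}).
Implicit Types (D F : {set {set 'I_s}}) (mu nu rho : 'X_{1..s}) (x y z c : C)
  (P Q : nat -> 'I_s) (n m : nat)
  (e f g : {set 'I_s}) (u v : 'I_s) (r : nat).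

Section Config.
Variables (E : {set {set 'I_s}}) (V : {set 'I_s}) (P : nat -> 'I_s) (n : nat)
  (Q : nat -> 'I_s) (m : nat).
Hypothesis cfg : eight E V P n Q m.
Let aP := eight_l cfg.
Let aQ := eight_r cfg.
Let PQ := eight_c cfg.
Let n2 : (2 < n)%N := arc_gt2 aP.
Let m2 : (2 < m)%N := arc_gt2 aQ.
Local Notation M := (M P Q).


Section OneOne.
Hypotheses (n3 : (n %% 3 = 1)%N) (m3 : (m %% 3 = 1)%N).

Local Notation e := (ed P 0).
Let sD : E :\ e \subset E := subD1set E e.
Let rn := (n %/ 3)%N.
Let rm := (m %/ 3)%N.
Let nE : n = (1 + 3 * rn)%N.
Proof. by have := divn_eq n 3; rewrite n3 -/rn; lia. Qed.
Let mE : m = (1 + 3 * rm)%N.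
Proof. by have := divn_eq m 3; rewrite m3 -/rm; lia. Qed.

(** This tail is [P 2 .. P n] and ends at the centre, while [tail_r] is [Q 1 .. Q (m-1)]; together
    with [ed P 0] they make up the full multidegree with 2 at the centre. *)
Definition tail_l := tailp k (fun i => P (2 + i)%N) rn.
Definition tail_r := tailp k (fun i => Q (1 + i)%N) rm.

Let eD i : (0 < i < n)%N -> ed P i \in E :\ e.
Proof. by move=> li; rewrite in_setD1 (P_edge cfg) ?(edP_neq cfg); lia. Qed.

Let qD i : (i < m)%N -> ed Q i \in E :\ e.
Proof. by move=> li; rewrite in_setD1 (Q_edge cfg) // eq_sym (edPQ cfg) //; lia. Qed.

(** The inner vertices of the first cycle split off as a tail from the free end [P 1]. The second
    cycle remains, a closed path of 1 mod 3 edges with both units at the centre still available. *)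
Lemma acyclic_delP0 z : cyc (E :\ e) (M 2 1 n 1 m) z -> bnd (E :\ e) (M 2 1 n 1 m) z.
Proof.
move=> cz.
have [|||||||y cy by_] := @arc_tail k s E P n aP (E :\ e) (M 2 1 n 1 m) sD
  (M 2 1 1 1 m) 1 rn z _ _ _ _ _ _ _ cz; try lia.
- by move=> i i1 i2; rewrite (M_P cfg); lia.
- by move=> i i1; rewrite (M_P cfg); lia.
- by move=> i i1 i2; apply: eD; lia.
- by move=> r0; apply: (slackl aP sD); [lia | rewrite (M_P cfg); lia | right; rewrite setD11].
- by move=> v; rewrite !ME (@rg_nil _ P 1 1) // -nE; lia.
apply: (bnd_eq by_); apply: (bndMl (mu := M 0 1 n 1 1) (nu := M 2 1 1 1 m)).
- by move=> v; rewrite !ME (@rg_nil _ P 1 1) // (@rg_nil _ Q 1 1) //; lia.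
- apply: (arc_tailp k aP sD); try lia; first by move=> i i1 i2; apply: eD; lia.
  by move=> v; rewrite ME -nE; lia.
have sl : slack (E :\ e) (M 2 1 1 1 m) (Q 0%N) by rewrite -PQ; apply: (slack_center cfg).
have mc : M 2 1 1 1 m (Q 0%N) = 2 by rewrite -PQ (M_c cfg) //; lia.
apply: (arc_acyclic (a := 0) (b := m) aQ sD) cy; rewrite ?(arc_close aQ) ?mc ?eqxx //; try lia.
by move=> i li; rewrite (M_Q cfg); lia.
Qed.

Let ctr D : D \subset E -> (forall i, (0 < i < m.-1)%N -> ed Q i \in D) ->
  cyc D (M 0 1 1 1 m) tail_r.
Proof.
move=> sD' hD; apply: (arc_tailp k aQ sD'); try lia; first by move=> i i1 i2; apply: hD; lia.
by move=> v; rewrite ME -mE; lia.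
Qed.

Let ctl : cyc (E :\ e) (M 1 2 n 1 1) tail_l.
Proof.
apply: (arc_tailp k aP sD); try lia; first by move=> i i1 i2; apply: eD; lia.
have -> : (2 + 3 * rn)%N = n.+1 by lia.
by move=> v; rewrite ME (rgPm cfg); lia.
Qed.

Let tlr D j : D \subset E -> (forall i, (0 < i < m.-1)%N -> ed Q i \in D) ->
  j = 0%N \/ ed Q 0 \notin D -> tailable D (M j 1 1 1 m) (fun i => Q (1 + i)%N) rm.
Proof.
move=> sD' hD hj; apply: (arc_tailable aQ sD'); try lia.
- by move=> i i1 i2; rewrite (M_Q cfg); lia.
- by move=> i i1; rewrite (M_Q cfg); lia.
- by move=> i i1 i2; apply: hD; lia.
- move=> r0; apply: (slackl aQ sD'); [lia | rewrite (M_Q cfg); lia |].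
  by case: hj => [->|]; [left; rewrite -PQ (M_c cfg) //; lia | right].
Qed.

Let tll : tailable (E :\ e) (M 1 2 n 1 m) (fun i => P (2 + i)%N) rn.
Proof.
apply: (arc_tailable aP sD); try lia.
- by move=> i i1 i2; rewrite (M_P cfg); lia.
- move=> i i1; have [->|im] := eqVneq i n; last by rewrite (M_P cfg); lia.
  by rewrite (arc_close aP) (M_c cfg) //; lia.
- by move=> i i1 i2; apply: eD; lia.
- by move=> r0; apply: (slackl aP sD); [lia | rewrite (M_P cfg); lia | left; rewrite (M_P cfg); lia].
Qed.

Let tailr D j y : D \subset E -> (forall i, (0 < i < m.-1)%N -> ed Q i \in D) ->
  j = 0%N \/ ed Q 0 \notin D -> cyc D (M j 1 1 1 m) y ->
  exists2 y', cyc D (M 0 1 1 1 1) y' & bnd D (M j 1 1 1 m) (y - tail_r * y').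
Proof.
move=> sD' hD hj cy; have tl := tlr sD' hD hj.
have [y' cy' by'] := tail tl cy; exists y' => //.
apply: (cyc_center cfg sD' (j := j)); apply: cycW cy' => // v.
rewrite mnmBE rg_img; last exact: tl_inj tl.
by rewrite -mE !ME (@rg_nil _ Q 1 1) //; lia.
Qed.

(** With exponent 1 at the centre [Q 1] is not slack, so [ed Q 0] is removed by [del]: its link is
    the isolated path [Q 2 .. Q (m-1)] with [m - 3] edges, 1 mod 3. *)
Let tailr1 y : cyc (E :\ e) (M 1 1 1 1 m) y ->
  exists2 y', cyc (E :\ e) (M 0 1 1 1 1) y' & bnd (E :\ e) (M 1 1 1 1 m) (y - tail_r * y').
Proof.
move=> cy; have sD1 : E :\ e :\ ed Q 0 \subset E :\ e by exact: subD1set.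
have sD' := subset_trans sD1 sD.
have hD i : (0 < i < m)%N -> ed Q i \in E :\ e :\ ed Q 0.
  by move=> li; rewrite in_setD1 qD ?(edQ_neq cfg); lia.
have := cyc_contr (ed Q 0) cy; rewrite (M_edgeQ0 cfg) => [cc|]; last by lia.
have [] := del cy (e := ed Q 0).
  rewrite (M_edgeQ0 cfg); last by lia.
  apply: (segment_acyclic (a := 2) (b := m.-1) aQ sD') cc; try lia.
  - by move=> i li; rewrite (M_Q cfg); lia.
  - by move=> i li; apply: hD; lia.
  - by left; rewrite (M_Q cfg); lia.
  - by left; rewrite prednK ?(arc_close aQ) -?PQ ?(M_c cfg) //; lia.
move=> y1 cy1 by1; have [||y2 cy2 by2] := tailr sD' _ _ cy1.
- by move=> i li; apply: hD; lia.
- by right; rewrite setD11.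
exists y2; first by apply: cycW cy2.
by apply: (bnd_trans by1); apply: bndW by2.
Qed.

(** For [j = 1] the left tail exhausts the centre, which makes [Q 1] slack; for [j = 2] one unit
    remains and [tailr1] is needed. *)
Lemma link_one_one j z : (0 < j < 3)%N -> cyc E (M j.+1 1 n 1 m) z ->
  exists2 y, cyc (E :\ e) (M 0 1 1 1 1) y &
    bnd (E :\ e) (M j 2 n 1 m) (contr e z - tail_l * tail_r * y).
Proof.
move=> lj cz; have ce := cyc_contr e cz; rewrite (M_edgeP0 cfg) in ce; last by lia.
have [|||||||y cy by_] := @arc_tail k s E P n aP (E :\ e) (M j 2 n 1 m) sD
  (M j.-1 1 1 1 m) 2 rn (contr e z) _ _ _ _ _ _ _ ce; try lia.
- by move=> i i1 i2; rewrite (M_P cfg); lia.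
- move=> i i1; have [->|im] := eqVneq i n; last by rewrite (M_P cfg); lia.
  by rewrite (arc_close aP) (M_c cfg) //; lia.
- by move=> i i1 i2; apply: eD; lia.
- by move=> r0; apply: (slackl aP sD); [lia | rewrite (M_P cfg); lia | left; rewrite (M_P cfg); lia].
- have -> : (2 + 3 * rn)%N = n.+1 by lia.
  by move=> v; rewrite !ME (@rg_nil _ P 1 1) // (rgPm cfg); case: j lj {cz ce} => //; lia.
have [y' cy' by'] : exists2 y', cyc (E :\ e) (M 0 1 1 1 1) y' &
    bnd (E :\ e) (M j.-1 1 1 1 m) (y - tail_r * y').
  have [j1|j2] : j = 1%N \/ j = 2%N by lia.
    rewrite j1 /= in cy *; apply: tailr => //; last by left.
    by move=> i li; apply: qD; lia.
  by rewrite j2 /= in cy *; apply: tailr1.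
exists y' => //; apply: (bnd_trans by_); rewrite -mulrA -mulrBr.
apply: (bndMl (mu := M 1 2 n 1 1)) by' => //.
by move=> v; rewrite !ME (@rg_nil _ P 1 1) // (@rg_nil _ Q 1 1) //; case: j lj {cz ce by_ cy} => //; lia.
Qed.

Lemma cyc_tail_lr : cyc (E :\ e) (M 1 2 n 1 m) (tail_l * tail_r).
Proof.
apply: (cycM (mu := M 1 2 n 1 1) (nu := M 0 1 1 1 m)) => //.
  by move=> v; rewrite !ME (@rg_nil _ P 1 1) // (@rg_nil _ Q 1 1) //; lia.
by apply: ctr => // i li; apply: qD; lia.
Qed.

Lemma exists_zeta : exists2 zeta, cyc E (M 2 1 n 1 m) zeta & contr e zeta = tail_l * tail_r.
Proof.
apply: ext_lift.
- by apply: (P_edge cfg); lia.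
- by move=> v; rewrite ME (edP0_mnm cfg) (rgP1 cfg); lia.
- by rewrite (M_edgeP0 cfg); [exact: cyc_tail_lr | lia].
- apply: acyclic_delP0; apply: cycW cyc_tail_lr => // v.
  by rewrite !ME (rgP1 cfg); lia.
Qed.

Variable zeta : C.
Hypotheses (czeta : cyc E (M 2 1 n 1 m) zeta) (zetaE : contr e zeta = tail_l * tail_r).

(** If [zeta] bounds, so does its coefficient of [ed P 0]; cancelling both tails by [tail_inj] makes
    1 a boundary in multidegree 0, where the empty face is the only one. *)
Lemma zeta_not_bnd : ~ bnd E (M 2 1 n 1 m) zeta.
Proof.
case=> y hy zE.
have h1 : bnd (E :\ e) (M 1 2 n 1 m) (tail_l * tail_r).
  rewrite -zetaE zE contr_bd -raddfN; exists (- contr e y) => //.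
  by apply: chainN; have := chain_contr (e := e) hy; rewrite (M_edgeP0 cfg) //; lia.
have mu1 v : (M 1 2 n 1 m - edge_mnm (img (fun i => P (2 + i)%N) (3 * rn)))%MM v =
    M 0 1 1 1 m v.
  rewrite mnmBE rg_img; last exact: tl_inj tll.
  have -> : (2 + 3 * rn)%N = n.+1 by lia.
  by rewrite !ME (@rg_nil _ P 1 1) // (rgPm cfg); lia.
have cr : cyc (E :\ e) (M 0 1 1 1 m) tail_r by apply: ctr => // i li; apply: qD; lia.
have {}h1 : bnd (E :\ e) (M 0 1 1 1 m) tail_r.
  have := tail_inj tll _ h1 => h; apply: bndW (h _) => // [v|]; first by rewrite mu1.
  by apply: chainW cr.1 => // v; rewrite mu1.
have tl : tailable (E :\ e) (M 0 1 1 1 m) (fun i => Q (1 + i)%N) rm.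
  by apply: tlr => // [i li|]; [apply: qD; lia | left].
have mu2 v : (M 0 1 1 1 m - edge_mnm (img (fun i => Q (1 + i)%N) (3 * rm)))%MM v = 0%N.
  rewrite mnmBE rg_img; last exact: tl_inj tl.
  by rewrite -mE !ME (@rg_nil _ P 1 1) //; lia.
have h2 : bnd (E :\ e) (M 0 1 1 1 m) (tail_r * 1) by rewrite mulr1.
have [x hx] := tail_inj tl (chain1 _ _) h2.
move=> /ext_eqP/(_ set0); rewrite ext1 eqxx => /esym x1.
have : bd x set0 != 0 by rewrite x1 oner_eq0.
case/koszul_neq0=> i [_ _ /hx/faceP[]]; rewrite setU0 sub1set in_setD1 => /andP[_ iE] h.
have [v vi _] := edge_noncenter cfg iE.
by have := h v; rewrite mu2 /deg big_set1 edge_mnmE vi.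
Qed.

(** The multidegree of [y] is 0, so [y] is a scalar. The coefficient of [ed P 0] in [z - zeta * y]
    bounds, and [acyclic_delP0] does the rest. *)
Lemma zeta_gen z : cyc E (M 2 1 n 1 m) z ->
  exists2 y, cyc E (M 0 1 1 1 1) y & bnd E (M 2 1 n 1 m) (z - zeta * y).
Proof.
move=> cz; have [y cy by_] := link_one_one (j := 1) isT cz.
have cy' : cyc E (M 0 1 1 1 1) y by apply: cycW cy.
have czy : cyc E (M 2 1 n 1 m) (zeta * y).
  apply: (cycM (mu := M 2 1 n 1 m)) cy' => // v.
  by rewrite !ME (@rg_nil _ P 1 1) // (@rg_nil _ Q 1 1) //; lia.
have [] := @del k s E (M 2 1 n 1 m) e (z - zeta * y); first exact: cycB.
  by rewrite raddfB /= (contrMl _ cy.1) zetaE (M_edgeP0 cfg) //; lia.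
move=> z' cz' bz'; exists y => //; apply: (bnd_eq bz').
by apply: bndW (acyclic_delP0 cz').
Qed.

Lemma imp_one_one_3 z : cyc E (M 3 1 n 1 m) z -> imp E V (M 3 1 n 1 m) z.
Proof.
move=> cz; have [y cy by_] := link_one_one (j := 2) isT cz.
have cy' : cyc E (M 0 1 1 1 1) y by apply: cycW cy.
have czy : cyc E (M 2 1 n 1 m) (zeta * y).
  apply: (cycM (mu := M 2 1 n 1 m)) cy' => // v.
  by rewrite !ME (@rg_nil _ P 1 1) // (@rg_nil _ Q 1 1) //; lia.
have le v : (M 2 1 n 1 m v <= M 3 1 n 1 m v)%N by rewrite !ME; lia.
have [] := @del k s E (M 3 1 n 1 m) e (z - zeta * y).
- by apply: cycB => //; apply: cycW czy.
- by rewrite raddfB /= (contrMl _ cy.1) zetaE (M_edgeP0 cfg) //; lia.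
move=> z' cz' bz'; rewrite -(subrK (zeta * y) z) addrC.
apply: imp_add.
  (* The factor 1, taken in the multidegree of the centre, is the variable of the centre; it comes
     from the graph without [P 1]. *)
  rewrite -[zeta * y]mul1r.
  apply: (imp_mul (nu := M 1 1 1 1 1) (rho := M 2 1 n 1 m) (u := P 0%N) (v := P 1%N)) czy _.
  - by apply: (P_vert cfg); lia.
  - by rewrite (M_P cfg); lia.
  - by rewrite (M_c cfg) //; lia.
  - exact: cyc1.
  - by move=> v; rewrite !ME (@rg_nil _ P 1 1) // (@rg_nil _ Q 1 1) //; lia.
rewrite -(subrK z' (z - _)); apply: imp_add; first exact: imp_bnd.
by apply: imp_del cz'; apply: (P_edge cfg); lia.
Qed.

Lemma imp_one_one_1 z : cyc E (M 1 1 n 1 m) z -> imp E V (M 1 1 n 1 m) z.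
Proof.
move=> cz; apply: (@imp_link _ _ _ _ _ e) (cz) _; first by apply: (P_edge cfg); lia.
rewrite (M_edgeP0 cfg); last by lia.
move=> c; apply: (segment_acyclic (a := 2) (b := n.-1) aP sD); try lia.
- by move=> i li; rewrite (M_P cfg); lia.
- by move=> i li; apply: eD; lia.
- by left; rewrite (M_P cfg); lia.
- by left; rewrite prednK ?(arc_close aP) ?(M_c cfg); lia.
Qed.

End OneOne.
End Config.
End Eight.

(** * Properness of the remaining class, and the other multidegrees *)

Section Eight.
Variables (k : fieldType) (s : nat).
Local Notation C := (ext k {set 'I_s}).
Implicit Types (D F : {set {set 'I_s}}) (mu nu rho : 'X_{1..s}) (x y z c : C)
  (P Q : nat -> 'I_s) (n m : nat)
  (e f g : {set 'I_s}) (u v : 'I_s) (r : nat).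

Lemma M_sym P Q j a b a' b' : P 0%N = Q 0%N -> M P Q j a b a' b' = M Q P j a' b' a b.
Proof. by move=> PQ; apply/mnmP => v; rewrite !ME PQ addnAC. Qed.

Section Config.
Variables (E : {set {set 'I_s}}) (V : {set 'I_s}) (P : nat -> 'I_s) (n : nat)
  (Q : nat -> 'I_s) (m : nat).
Hypothesis cfg : eight E V P n Q m.
Let aP := eight_l cfg.
Let aQ := eight_r cfg.
Let PQ := eight_c cfg.
Let n2 : (2 < n)%N := arc_gt2 aP.
Let m2 : (2 < m)%N := arc_gt2 aQ.
Local Notation M := (M P Q).


(** The deleted edge cuts the first cycle. According to [i] mod 3, one of the pieces is acyclic in
    the link of [ed P 0] or of [ed Q 0]; the cycle is moved off that edge too, and [acyclic_delP0]
    applies. *)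
Lemma del_edgeP_bnd i z : (n %% 3 = 1)%N -> (m %% 3 = 1)%N -> (i < n)%N ->
  cyc (E :\ ed P i) (M 2 1 n 1 m) z -> bnd E (M 2 1 n 1 m) z.
Proof.
move=> n3 m3 li cz; set D := E :\ ed P i in cz *.
have sD : D \subset E by exact: subD1set.
have eD l : (l < n)%N -> l != i -> ed P l \in D.
  by move=> ll il; rewrite in_setD1 (P_edge cfg) ?(edP_neq cfg).
have qD l : (l < m)%N -> ed Q l \in D.
  by move=> ll; rewrite in_setD1 (Q_edge cfg) // eq_sym (edPQ cfg) //; lia.
have niD : ed P i \notin D by rewrite setD11.
have [i3|i3] := eqVneq (i %% 3)%N 0%N.
  have [i0|i0] := posnP i.
    by apply: (bndW sD (fun=> leqnn _)); rewrite /D i0 in cz *; exact: (acyclic_delP0 cfg).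
  have sD' : D :\ ed P 0 \subset D by exact: subD1set.
  have [] := del cz (e := ed P 0).
    have := cyc_contr (ed P 0) cz; rewrite (M_edgeP0 cfg); last by lia.
    apply: (segment_acyclic (a := 2) (b := i) aP (subset_trans sD' sD)); try lia.
    - by move=> l ll; rewrite (M_P cfg); lia.
    - by move=> l ll; rewrite in_setD1 eD ?(edP_neq cfg); lia.
    - by left; rewrite (M_P cfg); lia.
    - by right; rewrite in_setD1 (negPf niD) andbF.
  move=> z' cz' bz'; apply: (bnd_eq (y := z')); first by apply: bndW bz'.
  apply: (bndW (subD1set E (ed P 0)) (fun=> leqnn _)); apply: (acyclic_delP0 cfg) => //.
  by apply: cycW cz' => //; exact: setSD.
have sD' : D :\ ed Q 0 \subset D by exact: subD1set.
have sD'E := subset_trans sD' sD.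
have pD' l : (l < n)%N -> l != i -> ed P l \in D :\ ed Q 0.
  by move=> ll il; rewrite in_setD1 eD // (edPQ cfg) //; lia.
have [] := del cz (e := ed Q 0).
  have := cyc_contr (ed Q 0) cz; rewrite (M_edgeQ0 cfg); last by lia.
  apply: (acyclic_through_center cfg sD'E) => // [l ll|y].
    by rewrite in_setD1 qD ?(edQ_neq cfg); lia.
  (* For residue 1 the piece [P (i+1) .. P (n-1)] has 1 mod 3 edges, for residue 2 the piece
     [P 1 .. P i] does. *)
  have [i1|i2] : (i %% 3 = 1 \/ i %% 3 = 2)%N by lia.
    apply: (segment_acyclic (a := i.+1) (b := n.-1) aP sD'E); try lia.
    - by move=> l ll; rewrite (M_P cfg); lia.
    - by move=> l ll; apply: pD'; lia.
    - by right; rewrite in_setD1 (negPf niD) andbF.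
    - by left; rewrite prednK ?(arc_close aP) ?(M_c cfg) //; lia.
  apply: (segment_acyclic (a := 1) (b := i) aP sD'E); try lia.
  - by move=> l ll; rewrite (M_P cfg); lia.
  - by move=> l ll; apply: pD'; lia.
  - by left; rewrite (M_c cfg) //; lia.
  - by right; rewrite in_setD1 (negPf niD) andbF.
move=> z' cz' bz'; apply: (bnd_eq (y := z')); first by apply: bndW bz'.
apply: (bndW (subD1set E (ed Q 0)) (fun=> leqnn _)).
rewrite (M_sym _ _ _ _ _ PQ) in cz' *; apply: (acyclic_delP0 (eight_sym cfg)) => //.
by apply: cycW cz' => //; exact: setSD.
Qed.

Lemma peel_delP0 nu y : (n %% 3 = 1)%N -> nu (P 0%N) = 1%N ->
  (forall i, (0 < i < n)%N -> nu (P i) = 1%N) -> cyc E nu y ->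
  exists2 y', cyc (E :\ ed P 0) nu y' & bnd E nu (y - y').
Proof.
move=> n3 nc nP cy; apply: (del cy); have cc := cyc_contr (ed P 0) cy.
have nuE i : (0 < i < n)%N -> (nu - edge_mnm (ed P 0))%MM (P i) = (1 < i)%N.
  move=> li; rewrite mnmBE (edP0_mnm cfg) (P_neq_c cfg) // nP //.
  have [->|i1] := eqVneq i 1%N; first by rewrite eqxx.
  by rewrite (negPf (arc_neq aP _ _ _)); lia.
have nu0 : (nu - edge_mnm (ed P 0))%MM (P 0%N) = 0%N.
  by rewrite mnmBE (edP0_mnm cfg) nc eqxx.
apply: (segment_acyclic (a := 2) (b := n.-1) aP (subD1set E (ed P 0))) cc; try lia.
- by move=> i li; rewrite nuE; lia.
- by move=> i li; rewrite in_setD1 (P_edge cfg) ?(edP_neq cfg); lia.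
- by left; rewrite nuE; lia.
- by left; rewrite prednK ?(arc_close aP) ?nu0 //; lia.
Qed.

End Config.

Section Config2.
Variables (E : {set {set 'I_s}}) (V : {set 'I_s}) (P : nat -> 'I_s) (n : nat)
  (Q : nat -> 'I_s) (m : nat).
Hypothesis cfg : eight E V P n Q m.
Let aP := eight_l cfg.
Let aQ := eight_r cfg.
Let PQ := eight_c cfg.
Let n2 : (2 < n)%N := arc_gt2 aP.
Let m2 : (2 < m)%N := arc_gt2 aQ.
Local Notation M := (M P Q).

Lemma del_edge_bnd e z : (n %% 3 = 1)%N -> (m %% 3 = 1)%N -> e \in E ->
  cyc (E :\ e) (M 2 1 n 1 m) z -> bnd E (M 2 1 n 1 m) z.
Proof.
move=> n3 m3 /(eight_edge cfg)[] [i li ->]; first exact: (del_edgeP_bnd cfg).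
by rewrite (M_sym _ _ _ _ _ PQ); exact: (del_edgeP_bnd (eight_sym cfg)).
Qed.

(** If [nu] and [rho] each vanish at an end of some edge, both factors avoid that edge. Otherwise
    the inner vertices of each cycle belong to one factor and the centre is shared. The factor that
    owns the inside of the first cycle can then be moved off [ed P 0], and the other avoids it,
    having exponent 0 at [P 1]. *)
Lemma product_bnd nu rho u v x y : (n %% 3 = 1)%N -> (m %% 3 = 1)%N ->
  (forall w, nu w + rho w = M 2 1 n 1 m w)%N -> (0 < nu u)%N -> (0 < rho v)%N ->
  cyc E nu x -> cyc E rho y -> bnd E (M 2 1 n 1 m) (x * y).
Proof.
move=> n3 m3 sumE nu0 rh0 cx cy.
have le w : (nu w + rho w <= M 2 1 n 1 m w)%N by rewrite sumE.
case: (pselect (exists2 e, e \in E & exists a b, [/\ a \in e, b \in e, nu a = 0%N & rho b = 0%N])).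
  case=> e eE [a [b [ae be na rb]]]; apply: (del_edge_bnd n3 m3 eE).
  by apply: (cycM le); [exact: cyc_dead ae na cx | exact: cyc_dead be rb cy].
move=> h; have alt e a b : e \in E -> a \in e -> b \in e -> (0 < nu a)%N \/ (0 < rho b)%N.
  move=> eE ae be; have [na|na] := posnP (nu a); last by left.
  by right; rewrite lt0n; apply/eqP => rb; apply: h; exists e => //; exists a, b.
have sP i : (0 < i < n)%N -> (nu (P i) + rho (P i) = 1)%N.
  by move=> li; rewrite sumE (M_P cfg); lia.
have sQ i : (0 < i < m)%N -> (nu (Q i) + rho (Q i) = 1)%N.
  by move=> li; rewrite sumE (M_Q cfg); lia.
have sc : (nu (P 0%N) + rho (P 0%N) = 2)%N by rewrite sumE (M_c cfg) //; lia.
have edl (R : nat -> 'I_s) i : R i \in ed R i by rewrite !inE eqxx.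
have edr (R : nat -> 'I_s) i : R i.+1 \in ed R i by rewrite !inE eqxx orbT.
have cP i : (0 < i < n)%N -> nu (P i) = nu (P 1%N).
  elim: i => // i IH li; have [->//|i0] := posnP i; rewrite -IH; last by lia.
  have := alt _ _ _ (P_edge cfg (i := i) _) (edl P i) (edr P i).
  have := alt _ _ _ (P_edge cfg (i := i) _) (edr P i) (edl P i).
  have := sP i; have := sP i.+1 li; lia.
have cQ i : (0 < i < m)%N -> nu (Q i) = nu (Q 1%N).
  elim: i => // i IH li; have [->//|i0] := posnP i; rewrite -IH; last by lia.
  have := alt _ _ _ (Q_edge cfg (i := i) _) (edl Q i) (edr Q i).
  have := alt _ _ _ (Q_edge cfg (i := i) _) (edr Q i) (edl Q i).
  have := sQ i; have := sQ i.+1 li; lia.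
have lP : (0 < n)%N by lia.
have lQ : (0 < m)%N by lia.
have hP1 : (0 < nu (P 1%N))%N \/ (0 < rho (P 0%N))%N.
  exact: alt (P_edge cfg lP) (edr P 0%N) (edl P 0%N).
have hP2 : (0 < nu (P 0%N))%N \/ (0 < rho (P 1%N))%N.
  exact: alt (P_edge cfg lP) (edl P 0%N) (edr P 0%N).
have hQ1 : (0 < nu (Q 1%N))%N \/ (0 < rho (P 0%N))%N.
  by rewrite PQ; exact: alt (Q_edge cfg lQ) (edr Q 0%N) (edl Q 0%N).
have hQ2 : (0 < nu (P 0%N))%N \/ (0 < rho (Q 1%N))%N.
  by rewrite PQ; exact: alt (Q_edge cfg lQ) (edl Q 0%N) (edr Q 0%N).
have supp w : (0 < M 2 1 n 1 m w)%N -> [\/ w = P 0%N,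
    exists2 i, (0 < i < n)%N & w = P i | exists2 i, (0 < i < m)%N & w = Q i].
  have [->|wc] := eqVneq w (P 0%N); first by constructor 1.
  rewrite ME (negPf wc) muln0 add0n addn_gt0 => /orP[] h0.
    constructor 2; apply: contrapT => hn; move: h0; rewrite rg_out // => i li.
    by apply/eqP => wi; apply: hn; exists i.
  constructor 3; apply: contrapT => hn; move: h0; rewrite rg_out // => i li.
  by apply/eqP => wi; apply: hn; exists i.
have s1 : (nu (P 1%N) + rho (P 1%N) = 1)%N by apply: sP; lia.
have t1 : (nu (Q 1%N) + rho (Q 1%N) = 1)%N by apply: sQ; lia.
have suppu : (0 < M 2 1 n 1 m u)%N by rewrite -sumE; lia.
have suppv : (0 < M 2 1 n 1 m v)%N by rewrite -sumE; lia.
have [p1|p0] : nu (P 1%N) = 1%N \/ nu (P 1%N) = 0%N by lia.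
  (* If the first factor owns the inside of both cycles, the second one, of positive degree, can
     only contain the centre. *)
  have rc : (0 < rho (P 0%N))%N.
    have [q1|q0] : nu (Q 1%N) = 1%N \/ nu (Q 1%N) = 0%N by lia.
      case: (supp v suppv) => [<-//|[i li vi]|[i li vi]].
        by have := sP i li; rewrite cP // p1 -vi; lia.
      by have := sQ i li; rewrite cQ // q1 -vi; lia.
    by lia.
  have nc : nu (P 0%N) = 1%N by lia.
  have [|x' cx' bx'] := peel_delP0 cfg n3 nc _ cx.
    by move=> i li; rewrite cP.
  apply: (bnd_eq (y := x' * y)).
    by rewrite -mulrBl; apply: (bndMr le bx' cy).
  apply: (del_edge_bnd n3 m3 (P_edge cfg lP)).
  by apply: (cycM le cx'); apply: cyc_dead cy; [exact: edr P 0%N | lia].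
have r1 i : (0 < i < n)%N -> rho (P i) = 1%N by move=> li; have := sP i li; rewrite cP //; lia.
have nc : (0 < nu (P 0%N))%N.
  have [q1|q0] : nu (Q 1%N) = 1%N \/ nu (Q 1%N) = 0%N by lia.
    by lia.
  case: (supp u suppu) => [<-//|[i li ui]|[i li ui]].
    by move: nu0; rewrite ui cP // p0.
  by move: nu0; rewrite ui cQ // q0.
have rc : rho (P 0%N) = 1%N by lia.
have [y' cy' by'] := peel_delP0 cfg n3 rc r1 cy.
apply: (bnd_eq (y := x * y')).
  by rewrite -mulrBr; apply: (bndMl le cx by').
apply: (del_edge_bnd n3 m3 (P_edge cfg lP)).
by apply: (cycM le _ cy'); apply: cyc_dead cx; [exact: edr P 0%N | lia].
Qed.

(** An exponent of at least 2 at [u] makes [[set v; u]] a cone point. Otherwise the leaf reduction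
    writes the cycle, up to a boundary, as a multiple of a cycle on three vertices, which misses
    [w]. *)
Lemma imp_slack mu v u u' w z : [set v; u] \in E -> [set u; u'] \in E ->
  v != u -> v != u' ->
  (forall f, f \in E -> u \in f -> f = [set v; u] \/ f = [set u; u']) ->
  v \in V -> u \in V -> u' \in V -> w \in V -> w \notin [set v; u; u'] ->
  (forall w, w \in V -> (0 < mu w)%N) -> slack E mu v -> cyc E mu z -> imp E V mu z.
Proof.
move=> eE gE vu vu' hu vV uV u'V wV nw pos sv cz.
have effu f : f \in eff E mu u -> f = [set v; u] \/ f = [set u; u'].
  by case/effP=> fE uf _; apply: hu.
have [m1|m1] := eqVneq (mu u) 1%N; last first.
  apply: imp_bnd; apply: (@cyc_cone _ _ E mu v u) cz => //.
    apply/mnm_lepP => x; rewrite edge_mnmE; case: (boolP (x \in _)) => //.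
    by rewrite !inE => /orP[]/eqP->; apply: pos.
  by apply: slack2 effu; have := pos u uV; lia.
have [y cy by_] := leaf eE vu vu' (pos v vV) m1 sv effu cz.
rewrite -(subrK ((ext_gen k [set v; u] - ext_gen k [set u; u']) * y) z).
apply: imp_add; first exact: imp_bnd.
apply: imp_mul wV _ _ (cyc_gen_sub k eE gE) cy _.
- by rewrite edge_mnmE (negPf nw).
- by instantiate (1 := v); rewrite edge_mnmE !inE eqxx.
- move=> x; rewrite mnmBE subnKC // edge_mnmE; case: (boolP (x \in _)) => //.
  by rewrite !inE -orbA => /or3P[]/eqP->; apply: pos.
Qed.

Lemma P_neq_Q i j : (i <= n)%N -> (0 < j < m)%N -> P i != Q j.
Proof.
move=> li lj; have [->|i0] := posnP i; first by rewrite eq_sym (Q_neq_c cfg).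
have [->|ni] := eqVneq i n; first by rewrite (arc_close aP) eq_sym (Q_neq_c cfg).
by apply: (eight_disj cfg) => //; lia.
Qed.

Lemma P_vert_le i : (i <= n)%N -> P i \in V.
Proof.
move=> li; have [->|ni] := eqVneq i n; last by apply: (P_vert cfg); lia.
by rewrite (arc_close aP); apply: (P_vert cfg); lia.
Qed.

Lemma imp_slack_P mu i z : (i.+1 < n)%N -> (forall w, w \in V -> (0 < mu w)%N) ->
  slack E mu (P i) -> cyc E mu z -> imp E V mu z.
Proof.
move=> li pos sl cz; apply: (imp_slack (v := P i) (u := P i.+1) (u' := P i.+2) (w := Q 1%N)) sl cz => //.
- by apply: (P_edge cfg); lia.
- by apply: (P_edge cfg); lia.
- by apply: (arc_neq aP); lia.
- have [->|i0] := posnP i; first by apply: (arc_neq aP); lia.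
  by rewrite eq_sym; apply: (arc_neq aP); lia.
- by move=> f fE uf; apply: (arc_inc aP (i := i.+1)) => //; lia.
- by apply: P_vert_le; lia.
- by apply: P_vert_le; lia.
- by apply: P_vert_le; lia.
- by apply: (Q_vert cfg); lia.
- by rewrite !inE !negb_or -andbA; apply/and3P; split; rewrite eq_sym; apply: P_neq_Q; lia.
Qed.

Lemma imp_gt1 mu i z : (0 < i < n)%N -> (1 < mu (P i))%N ->
  (forall w, w \in V -> (0 < mu w)%N) -> cyc E mu z -> imp E V mu z.
Proof.
move=> li mi pos cz.
have sl : slack E mu (P i).
  apply: (slack2 (e1 := ed P i.-1) (e2 := ed P i) mi) => f /effP[fE pf _].
  exact: (arc_inc aP li fE pf).
have [iln|iln] := ltnP i.+1 n; first exact: imp_slack_P sl cz.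
(* For [i = n - 1] the next vertex is the centre, so the leaf is taken in the opposite direction. *)
case: i li mi sl iln => [|[|i]] li mi sl iln; try lia.
apply: (imp_slack (v := P i.+2) (u := P i.+1) (u' := P i) (w := Q 1%N)) sl cz => //.
- by rewrite setUC; apply: (P_edge cfg); lia.
- by rewrite setUC; apply: (P_edge cfg); lia.
- by apply: (arc_neq aP); lia.
- by rewrite eq_sym; apply: (arc_neq aP); lia.
- move=> f fE uf; rewrite [[set P i.+2; _]]setUC [[set _; P i]]setUC.
  by apply/or_comm; apply: (arc_inc aP (i := i.+1)) => //; lia.
- by apply: P_vert_le; lia.
- by apply: P_vert_le; lia.
- by apply: P_vert_le; lia.
- by apply: (Q_vert cfg); lia.
- by rewrite !inE !negb_or -andbA; apply/and3P; split; rewrite eq_sym; apply: P_neq_Q; lia.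
Qed.

Lemma imp_center_gt3 mu z : (3 < mu (P 0%N))%N ->
  (forall w, w \in V -> (0 < mu w)%N) -> cyc E mu z -> imp E V mu z.
Proof.
move=> m3 pos; apply: (imp_slack_P (i := 0)) => //; first by lia.
apply: leq_trans m3; pose l := [:: ed P 0; ed P n.-1; ed Q 0; ed Q m.-1].
apply: leq_trans (card_size l); apply: subset_leq_card; apply/subsetP => f.
by case/effP=> fE cf _; rewrite !inE; case: (center_edge cfg fE cf) => [->|[->|[->|->]]];
  rewrite eqxx ?orbT.
Qed.

Lemma imp_standard j z : (n %% 3 <> 1)%N -> (0 < j < 4)%N ->
  cyc E (M j 1 n 1 m) z -> imp E V (M j 1 n 1 m) z.
Proof.
move=> n3 lj cz; have [n2'|n0] : (n %% 3 = 2 \/ n %% 3 = 0)%N by lia.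
  by apply: (imp_mod2 cfg) => //; lia.
have [m2'|m2'] := eqVneq (m %% 3)%N 2.
  rewrite (M_sym _ _ _ _ _ PQ) in cz *.
  by apply: (imp_mod2 (eight_sym cfg)) => //; lia.
have [j1|j1] := eqVneq j 1%N; first by rewrite j1 in cz *; exact: (imp_mod0_1 cfg).
have [mj|mj] := eqVneq (m %% 3)%N 0%N.
  by apply: (imp_mod0 cfg n0) => //; lia.
have [j2|j2] := eqVneq j 2; last by apply: (imp_mod0 cfg n0) => //; lia.
by rewrite j2 in cz *; apply: (imp_mod0_1_2 cfg) => //; lia.
Qed.

End Config2.

Section Config3.
Variables (E : {set {set 'I_s}}) (V : {set 'I_s}) (P : nat -> 'I_s) (n : nat)
  (Q : nat -> 'I_s) (m : nat).
Hypothesis cfg : eight E V P n Q m.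
Let aP := eight_l cfg.
Let aQ := eight_r cfg.
Let PQ := eight_c cfg.
Let n2 : (2 < n)%N := arc_gt2 aP.
Let m2 : (2 < m)%N := arc_gt2 aQ.
Local Notation M := (M P Q).

Lemma imp_all mu u z : (0 < mu u)%N -> (forall w, w \notin V -> mu w = 0%N) ->
  cyc E mu z -> (n %% 3 = 1 -> m %% 3 = 1 -> mu != M 2 1 n 1 m)%N -> imp E V mu z.
Proof.
move=> mu0 supp cz hmu.
case: (pselect (exists2 w, w \in V & mu w = 0%N)) => [[w wV w0]|hpos].
  rewrite -[z]mulr1; apply: (imp_mul (nu := mu) (rho := 0%MM)) wV w0 mu0 cz (cyc1 k E _) _.
  by move=> v; rewrite mnm0E addn0.
have pos w : w \in V -> (0 < mu w)%N.
  by move=> wV; rewrite lt0n; apply/eqP => w0; apply: hpos; exists w.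
case: (pselect (exists2 i, (0 < i < n)%N & (1 < mu (P i))%N)) => [[i li mi]|hP].
  exact: (imp_gt1 cfg li mi).
case: (pselect (exists2 i, (0 < i < m)%N & (1 < mu (Q i))%N)) => [[i li mi]|hQ].
  exact: (imp_gt1 (eight_sym cfg) li mi).
have [mc|mc] := ltnP 3 (mu (P 0%N)); first exact: (imp_center_gt3 cfg).
have Pv : P 0%N \in V by apply: (P_vert cfg); lia.
have muE : mu = M (mu (P 0%N)) 1 n 1 m.
  apply/mnmP => w; case: (boolP (w \in V)) => [/(eight_vert cfg)[] [i li ->]|wV].
  - have [->|i0] := posnP i; first by rewrite (M_c cfg) //; lia.
    rewrite (M_P cfg) //; try lia; have := pos (P i) (P_vert cfg li).
    have [mi|] := ltnP 1 (mu (P i)); last by lia.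
    by case: hP; exists i => //; lia.
  - have [->|i0] := posnP i; first by rewrite -PQ (M_c cfg) //; lia.
    rewrite (M_Q cfg) //; try lia; have := pos (Q i) (Q_vert cfg li).
    have [mi|] := ltnP 1 (mu (Q i)); last by lia.
    by case: hQ; exists i => //; lia.
  rewrite supp // ME rg_out => [|i li]; last first.
    by apply: contraNneq wV => ->; apply: (P_vert cfg); lia.
  rewrite rg_out => [|i li]; last first.
    by apply: contraNneq wV => ->; apply: (Q_vert cfg); lia.
  by case: eqP wV => [->|]; rewrite ?Pv ?muln0.
have lj := pos _ Pv; move: (mu (P 0%N)) mc lj muE => j mc lj muE.
rewrite {}muE in cz hmu *; clear mu mu0 supp hpos pos hP hQ.
have [n3|n3] := eqVneq (n %% 3)%N 1%N; last first.
  by apply: (imp_standard cfg) => //; [exact/eqP | lia].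
have [m3|m3] := eqVneq (m %% 3)%N 1%N; last first.
  rewrite (M_sym _ _ _ _ _ PQ) in cz *.
  by apply: (imp_standard (eight_sym cfg)) => //; [exact/eqP | lia].
have [j1|j1] := eqVneq j 1%N; first by rewrite j1 in cz *; exact: (imp_one_one_1 cfg).
have [j2|j2] := eqVneq j 2; first by case/eqP: (hmu n3 m3); rewrite j2.
have j3 : j = 3 by lia.
rewrite j3 in cz *; have [zeta cze zeE] := exists_zeta k cfg n3 m3.
exact: (imp_one_one_3 cfg n3 m3 cze zeE).
Qed.

End Config3.
End Eight.

(** * Homogeneous elements of the Koszul complex *)

Section Bridge.
Variables (k : fieldType) (s : nat).
Local Notation C := (ext k {set 'I_s}).
Local Notation K := (koszul_ambient k s).
Implicit Types (D F U : {set {set 'I_s}}) (mu nu rho : 'X_{1..s}) (c d : C) (x y z : K).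

(* [hom mu] restores the variables, and [pr mu] selects the part of
   multidegree mu and sets the variables to 1. *)
Definition hom mu c : K := [ffun F => c F *: 'X_[mu - deg F]].

Definition pr mu z : C :=
  [ffun F => if (deg F <= mu)%MM then (z F)@_(mu - deg F) else 0].

Lemma homE mu c F : hom mu c F = c F *: 'X_[mu - deg F].
Proof. by rewrite [LHS]ffunE. Qed.

Lemma prE mu z F : pr mu z F = if (deg F <= mu)%MM then (z F)@_(mu - deg F) else 0.
Proof. by rewrite [LHS]ffunE. Qed.

Lemma hom_is_additive mu : zmod_morphism (hom mu).
Proof.
by move=> c d; apply/ext_eqP => F; rewrite extD extN !homE extD extN scalerBl.
Qed.
HB.instance Definition _ mu := GRing.isZmodMorphism.Build C K (hom mu) (hom_is_additive mu).

Lemma pr_is_additive mu : zmod_morphism (pr mu).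
Proof.
move=> x y; apply/ext_eqP => F; rewrite extD extN !prE extD extN.
by case: ifP; rewrite ?subr0 // mcoeffB.
Qed.
HB.instance Definition _ mu := GRing.isZmodMorphism.Build K C (pr mu) (pr_is_additive mu).

Lemma chain_le D mu c F : chain D mu c -> c F != 0 -> (deg F <= mu)%MM.
Proof. by move=> hc /hc /andP[]. Qed.

Lemma sign_scale n (p : {mpoly k[s]}) : (-1) ^+ n * p = (-1) ^+ n *: p.
Proof. by rewrite -!(signr_odd _ n) mulr_sign scaler_sign. Qed.

Lemma dK_hom D mu c : chain D mu c -> dK (hom mu c) = hom mu (bd c).
Proof.
move=> hc; apply/ext_eqP => U; rewrite homE !ffunE scaler_suml.
apply: eq_bigr => i iU; rewrite homE mul1r sign_scale -scalerA; congr (_ *: _).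
have [->|ci] := eqVneq (c (i |: U)) 0; first by rewrite !scale0r mulr0.
rewrite -scalerAr -mpolyXD; congr (_ *: 'X_[_]); apply/mnmP => v.
have := mnm_lepP (chain_le hc ci) v; rewrite degU1 // !mnmDE !mnmBE mnmDE; lia.
Qed.

Lemma homM D mu nu c d : chain D mu c -> chain D nu d ->
  hom mu c * hom nu d = hom (mu + nu)%MM (c * d).
Proof.
move=> hc hd; apply/ext_eqP => U; rewrite homE !extM scaler_suml.
apply: eq_bigr => S _; rewrite scaler_suml; apply: eq_bigr => T /andP[dST /eqP <-].
rewrite !homE sign_scale -scalerA; congr (_ *: _).
have [->|cS] := eqVneq (c S) 0; first by rewrite !mul0r !scale0r mul0r.
have [->|dT] := eqVneq (d T) 0; first by rewrite !mulr0 !scale0r mulr0.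
rewrite -scalerAl -scalerAr scalerA -mpolyXD; congr (_ *: 'X_[_]).
apply/mnmP => v; have := mnm_lepP (chain_le hc cS) v.
by have := mnm_lepP (chain_le hd dT) v; rewrite degU // !mnmDE !mnmBE !mnmDE; lia.
Qed.

Lemma mcoeff_mulX (p : {mpoly k[s]}) (a m : 'X_{1..s}) :
  ('X_[a] * p)@_m = if (a <= m)%MM then p@_(m - a) else 0.
Proof.
rewrite mulrC; case: ifP => [am|am].
  by rewrite -[in LHS](submK am) addmC mcoeffMX.
apply/eqP; rewrite mcoeff_eq0; apply: contraFN am.
by rewrite (perm_mem (msuppMX _ _)) => /mapP[m' _ ->]; rewrite lem_addr.
Qed.

Lemma pr_dK mu z : pr mu (dK z) = bd (pr mu z).
Proof.
apply/ext_eqP => U; rewrite prE !ffunE; case: ifP => [Um|Um]; last first.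
  rewrite big1 // => i iU; rewrite prE; case: ifP => [h|]; last by rewrite !mulr0.
  move: Um; rewrite (lepm_trans _ h) // degU1 //; exact: lem_addl.
rewrite raddf_sum /=; apply: eq_bigr => i iU.
rewrite prE mul1r sign_scale mcoeffZ mcoeff_mulX degU1 //; congr (_ * _).
have -> : (edge_mnm i <= mu - deg U)%MM = (edge_mnm i + deg U <= mu)%MM.
  apply/mnm_lepP/mnm_lepP => h v; have := h v; have := mnm_lepP Um v;
    rewrite mnmBE mnmDE; lia.
case: ifP => // _; congr (_ @_ _); apply/mnmP => v; rewrite !mnmBE mnmDE; lia.
Qed.

Lemma pr_hom D mu c : chain D mu c -> pr mu (hom mu c) = c.
Proof.
move=> hc; apply/ext_eqP => F; rewrite prE homE mcoeffZ mcoeffX eqxx mulr1.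
by case: ifP => // h; apply/esym/eqP; apply: contraFT h => cF; exact: chain_le hc cF.
Qed.

Lemma pr_hom_neq D mu nu c : chain D mu c -> nu <> mu -> pr nu (hom mu c) = 0.
Proof.
move=> hc neq; apply/ext_eqP => F; rewrite prE homE mcoeffZ mcoeffX ext0.
case: ifP => // h; have [->|cF] := eqVneq (c F) 0; first by rewrite mul0r.
case: eqP => [e|_]; last by rewrite mulr0.
case: neq; apply/mnmP => v; have := congr1 (fun t : 'X_{1..s} => t v) e; rewrite !mnmBE.
have := mnm_lepP (chain_le hc cF) v; have := mnm_lepP h v; lia.
Qed.

Lemma hom_pr mu z : multihomogeneous mu z -> z = hom mu (pr mu z).
Proof.
move=> /forallP hz; apply/ext_eqP => F; rewrite homE; apply/mpolyP => m.
rewrite mcoeffZ mcoeffX prE; have /allP hF := hz F.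
case: (boolP (m \in msupp (z F))) => [mz|mz].
  have /eqP mE := hF _ mz; rewrite -mE lem_addl addmK eqxx mulr1 //.
rewrite (memN_msupp_eq0 mz); case: eqP => [e|_]; last by rewrite mulr0.
by case: ifP; rewrite ?mul0r // e (memN_msupp_eq0 mz) mul0r.
Qed.

Lemma hom_multihomogeneous D mu c : chain D mu c -> multihomogeneous mu (hom mu c).
Proof.
move=> hc; apply/forallP => F; apply/allP => m; rewrite homE.
have [->|cF] := eqVneq (c F) 0; first by rewrite scale0r msupp0.
by move/msuppZ_le; rewrite msuppX inE => /eqP ->; rewrite submK // (chain_le hc cF).
Qed.

Definition monomials z : seq 'X_{1..s} :=
  undup (flatten [seq [seq (m + deg F)%MM | m <- msupp (z F)] | F : {set {set 'I_s}}]).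

Lemma sum_hom_pr z : z = \sum_(mu <- monomials z) hom mu (pr mu z).
Proof.
apply/ext_eqP => F; have -> : (\sum_(mu <- monomials z) hom mu (pr mu z)) F =
    \sum_(mu <- monomials z) hom mu (pr mu z) F.
  by elim/big_rec2: _ => [|mu p q _ <-]; rewrite ?ext0 ?extD.
apply/mpolyP => m; rewrite raddf_sum /=.
have cE mu : (hom mu (pr mu z) F)@_m = if mu == (m + deg F)%MM then (z F)@_m else 0.
  rewrite homE mcoeffZ mcoeffX prE; case: (mu =P _) => [->|ne].
    by rewrite lem_addl addmK eqxx mulr1.
  case: ifP => [h|]; last by rewrite mul0r.
  by case: eqP => [e|]; rewrite ?mulr0 //; case: ne; rewrite -e submK.
under eq_bigr do rewrite cE.
rewrite -big_mkcond -big_filter.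
have [mz|mz] := boolP (m \in msupp (z F)); last first.
  by rewrite (memN_msupp_eq0 mz) big1.
rewrite (perm_big [:: (m + deg F)%MM]) ?big_seq1 //.
apply: uniq_perm; rewrite ?filter_uniq ?undup_uniq // => mu.
rewrite mem_filter inE mem_undup; case: eqP => //= ->.
apply/flattenP; exists [seq (m' + deg F)%MM | m' <- msupp (z F)].
  by apply/mapP; exists F; rewrite ?mem_enum.
by apply/mapP; exists m.
Qed.

Section Graph.
Variable G : graph s.
Local Notation E := (edges G).
Local Notation V := (verts G).

(** Chains see edges only; that [hom mu c] lies in the complex of [G] also needs its variables to be
    vertices of [G]. *)
Definition supported mu := forall v, v \notin V -> mu v = 0%N.

Lemma chain_pr mu z : z \in koszul_of k G -> chain E mu (pr mu z).
Proof.
move=> /koszul_ofP hz F; rewrite prE; case: ifP => [h nz|]; last by rewrite eqxx.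
rewrite /face h andbT; apply: (hz F).2.
by apply: contraNneq nz => ->; rewrite mcoeff0.
Qed.

Lemma supported_pr mu z : z \in koszul_of k G -> pr mu z <> 0 -> supported mu.
Proof.
move=> zK nz v vV; apply/eqP; rewrite -[_ == _]negbK; apply/negP => mv.
apply: nz; apply/ext_eqP => F; rewrite ext0; apply/eqP; apply: contraT => hF.
have /faceP[FE lF] := chain_pr zK hF.
have zK' := zK; move: hF; rewrite prE; case: ifP => [h|]; last by rewrite eqxx.
rewrite -mcoeff_msupp; move/koszul_ofP: zK' => /(_ F)[/in_varsP hv _] /hv/(_ v).
rewrite (negPf vV) mnmBE => hm.
have d0 : deg F v = 0%N.
  rewrite degE; apply/eqP; rewrite cards_eq0; apply/eqP/setP => f; rewrite !inE.
  apply/negP => /andP[fF vf]; case/negP: vV.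
  by apply: (subsetP (edges_sub (subsetP FE _ fF))).
by have := hm; rewrite d0 subn0 mv => /(_ isT).
Qed.

Lemma cyc_pr mu z : z \in cycles k G -> cyc E mu (pr mu z).
Proof.
by case/andP=> zK /eqP dz; split; [exact: chain_pr | rewrite -pr_dK dz raddf0].
Qed.

Lemma hom_koszul mu c : chain E mu c -> supported mu -> hom mu c \in koszul_of k G.
Proof.
move=> hc sm; apply/koszul_ofP => F; rewrite homE; split.
  apply/in_varsP => m /msuppZ_le; rewrite msuppX inE => /eqP -> v.
  by rewrite mnmBE; apply: contraNT => /sm ->.
move=> h; have : c F != 0 by apply: contraNneq h => ->; rewrite scale0r.
by move/hc/andP=> [].
Qed.

Lemma hom_cycles mu c : cyc E mu c -> supported mu -> hom mu c \in cycles k G.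
Proof.
move=> [hc dc] sm; rewrite inE hom_koszul //=.
by rewrite (dK_hom hc) dc raddf0.
Qed.

End Graph.
End Bridge.

(** * Improper classes *)

Section Spans.
Variables (k : fieldType) (V : lmodType k) (R : algType k).

Lemma linear_span0 (X : V -> Prop) : linear_span X 0.
Proof. by exists 0%N, (fun=> 0), (fun=> 0); split=> [[]//|]; rewrite big_ord0. Qed.

Lemma linear_span_gen (X : V -> Prop) a : X a -> linear_span X a.
Proof. by exists 1%N, (fun=> 1), (fun=> a); split=> //; rewrite big_ord1 scale1r. Qed.

Lemma linear_spanD (X : V -> Prop) a b :
  linear_span X a -> linear_span X b -> linear_span X (a + b).
Proof.
move=> [p [c [x [hx ->]]]] [q [d [y [hy ->]]]].
exists (p + q)%N, (fun i => match split i with inl j => c j | inr j => d j end),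
  (fun i => match split i with inl j => x j | inr j => y j end).
split=> [i|]; first by case: split.
rewrite big_split_ord; congr (_ + _); apply: eq_bigr => i _.
  by rewrite (unsplitK (inl i)).
by rewrite (unsplitK (inr i)).
Qed.

Lemma ideal_span0 (X : R -> Prop) : ideal_span X 0.
Proof.
by exists 0%N, (fun=> 0), (fun=> 0), (fun=> 0); split=> [[]//|]; rewrite big_ord0.
Qed.

Lemma ideal_span_gen (X : R -> Prop) l a r : X a -> ideal_span X (l * a * r).
Proof. by exists 1%N, (fun=> l), (fun=> a), (fun=> r); split=> //; rewrite big_ord1. Qed.

Lemma ideal_spanD (X : R -> Prop) a b :
  ideal_span X a -> ideal_span X b -> ideal_span X (a + b).
Proof.
move=> [p [l [x [r [hx ->]]]]] [q [l' [y [r' [hy ->]]]]].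
exists (p + q)%N, (fun i => match split i with inl j => l j | inr j => l' j end),
  (fun i => match split i with inl j => x j | inr j => y j end),
  (fun i => match split i with inl j => r j | inr j => r' j end).
split=> [i|]; first by case: split.
rewrite big_split_ord; congr (_ + _); apply: eq_bigr => i _.
  by rewrite (unsplitK (inl i)).
by rewrite (unsplitK (inr i)).
Qed.

Lemma ideal_spanZ (X : R -> Prop) c a : ideal_span X a -> ideal_span X (c *: a).
Proof.
move=> [p [l [x [r [hx ->]]]]]; exists p, (fun i => c *: l i), x, r; split=> //.
by rewrite scaler_sumr; apply: eq_bigr => i _; rewrite -!scalerAl.
Qed.

Lemma ideal_span_sum (X : R -> Prop) (I : finType) (F : I -> R) :
  (forall i, ideal_span X (F i)) -> ideal_span X (\sum_i F i).
Proof. by move=> h; apply: big_ind => //; [exact: ideal_span0 | exact: ideal_spanD]. Qed.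

End Spans.

(** * Deleting an edge or a vertex *)

Section Graphs.
Variables (s : nat).
Implicit Types (G : graph s) (e : {set 'I_s}) (v : 'I_s).

Lemma del_edge_subproof G e :
  [forall f in edges G :\ e, (#|f| == 2) && (f \subset verts G)].
Proof.
apply/forall_inP => f; rewrite in_setD1 => /andP[_ fE].
by have /forall_inP/(_ _ fE) := edgesP G.
Qed.

Definition del_edge G e := Graph (del_edge_subproof G e).

Lemma del_vert_subproof G v :
  [forall f in [set f in edges G | v \notin f], (#|f| == 2) && (f \subset verts G :\ v)].
Proof.
apply/forall_inP => f; rewrite inE => /andP[fE vf].
by have /forall_inP/(_ _ fE)/andP[-> h] := edgesP G; rewrite subsetD1 h vf.
Qed.

Definition del_vert G v := Graph (del_vert_subproof G v).

Lemma graph_eq G G' : verts G = verts G' -> edges G = edges G' -> G = G'.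
Proof.
case: G G' => [A B p] [A' B' q] /= eA eB; rewrite -eA -eB in q *.
by rewrite (bool_irrelevance p q).
Qed.

End Graphs.

(** * The improper ideal on the level of cycles *)

Section Improper.
Variables (k : fieldType) (s : nat) (G : graph s).
Local Notation C := (ext k {set 'I_s}).
Local Notation K := (koszul_ambient k s).
Implicit Types (mu nu rho : 'X_{1..s}) (c d : C) (x y : K) (z : cycle k G).
Local Notation E := (edges G).
Local Notation V := (verts G).
Local Notation improper := (improper_classes k G).

Lemma hclass_bnd z y : y \in koszul_of k G -> \val z = dK y -> hclass z = 0.
Proof.
move=> yK zE; rewrite -(raddf0 (@hclass k s G)); apply/hclassP; rewrite subr0.
by apply/boundariesP; exists y.
Qed.

Lemma improper_sub (G' : graph s) (sG : subgraph G' G) mu c (w : cycle k G') z :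
  G' <> G -> (0 < mdeg mu)%N -> chain (edges G') mu c -> \val w = hom mu c ->
  \val z = \val w -> improper_generator (hclass z).
Proof.
move=> neq m0 hc wE zE; exists G', sG, (hclass w); split=> //.
  apply: linear_span_gen; exists mu => //; exists w => //.
  by rewrite wE; apply: hom_multihomogeneous hc.
by rewrite homology_mapE; congr hclass; apply: val_inj.
Qed.

Lemma imp_cyc mu c : imp E V mu c -> cyc E mu c.
Proof.
elim=> {c} [c /bnd_cyc //|c d _ [hc dc] _ [hd dd]|e c eE|nu rho u v c d _ _ _ cc cd le].
- by split; [exact: chainD | rewrite raddfD /= dc dd addr0].
- by apply: cycW => //; exact: subD1set.
- exact: cycM cc cd.
Qed.

Lemma imp_improper mu c z : supported G mu -> (0 < mdeg mu)%N -> imp E V mu c ->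
  \val z = hom mu c -> improper (hclass z).
Proof.
move=> sm m0 ic; elim: ic z => {c} [c [y hy ->]|c d ic IHc id IHd|e c eE cc|
  nu rho u v c d vV nv nu0 cc cd le] z zE.
- rewrite (hclass_bnd (y := hom mu y)); first exact: ideal_span0.
    exact: hom_koszul.
  by rewrite zE (dK_hom hy).
- pose z1 := Cycle (hom_cycles (imp_cyc ic) sm); pose z2 := Cycle (hom_cycles (imp_cyc id) sm).
  have -> : z = z1 + z2 by apply: val_inj; rewrite zE raddfD.
  by rewrite raddfD; apply: ideal_spanD; [apply: IHc | apply: IHd].
- have sG : subgraph (del_edge G e) G by rewrite /subgraph /= subxx subD1set.
  have cw : hom mu c \in cycles k (del_edge G e) by apply: hom_cycles.
  rewrite -[hclass z]mul1r -[_ * _]mulr1; apply: ideal_span_gen.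
  apply: (improper_sub sG (w := Cycle cw)) m0 cc.1 _ _ => //.
  by move=> /(congr1 (@edges s)) /= /setP/(_ e); rewrite eE setD11.
have sG : subgraph (del_vert G v) G.
  rewrite /subgraph /= subD1set /=; apply/subsetP => f; by rewrite inE => /andP[].
have snu : supported G nu.
  by move=> w /sm mw; apply/eqP; rewrite -leqn0 -mw; apply: leq_trans (le w); exact: leq_addr.
have srho : supported G rho.
  by move=> w /sm mw; apply/eqP; rewrite -leqn0 -mw; apply: leq_trans (le w); exact: leq_addl.
have cc' : cyc (edges (del_vert G v)) nu c.
  split; last exact: cc.2; move=> F cF; have /faceP[FE h] := cc.1 F cF.
  apply/faceP; split=> //; apply/subsetP => f fF; rewrite inE (subsetP FE) //.
  by apply/negP => vf; have := leq_trans (deg_mem v fF) (h v); rewrite nv edge_mnmE vf.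
have cw : hom nu c \in cycles k (del_vert G v).
  apply: hom_cycles => // w; rewrite in_setD1 negb_and negbK => /orP[/eqP->//|].
  exact: snu.
(* Homogenizing [d] in multidegree [mu - nu] instead of [rho] multiplies it by the missing monomial,
   so that the product has multidegree exactly [mu]. *)
have cd' : cyc E (mu - nu)%MM d.
  by apply: cycW cd => // w; rewrite mnmBE -(leq_add2l (nu w)) subnKC //; apply: leq_trans (le w); exact: leq_addr.
have smn : supported G (mu - nu)%MM by move=> w /sm mw; rewrite mnmBE mw.
pose z1 := Cycle (cycles_sub sG cw); pose z2 := Cycle (hom_cycles cd' smn).
have -> : z = z1 * z2.
  apply: val_inj; rewrite rmorphM zE /= (homM cc.1 cd'.1); congr (hom _ _).
  by apply/mnmP => w; rewrite mnmDE mnmBE subnKC //; apply: leq_trans (le w); exact: leq_addr.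
rewrite rmorphM /= -[hclass z1]mul1r; apply: ideal_span_gen.
apply: (improper_sub sG (w := Cycle cw) (mu := nu)) cc'.1 _ _ => //.
  by move=> /(congr1 (@verts s)) /= /setP/(_ v); rewrite vV setD11.
by rewrite lt0n mdeg_eq0; apply: contraTneq nu0 => ->; rewrite mnm0E.
Qed.

(** A homogeneous piece of an element of the ideal; the last clause records what is kept of the
    proper subgraph from which [x] comes. *)
Definition factor_improper mu c := [/\ supported G mu, (0 < mdeg mu)%N & 
  exists nu1 nu2 nu3 (l x r : C),
  [/\ [/\ cyc E nu1 l, cyc E nu2 x & cyc E nu3 r],
      mu = (nu1 + nu2 + nu3)%MM, c = l * x * r, (0 < mdeg nu2)%N &
      (exists2 e, e \in E & cyc (E :\ e) nu2 x) \/ (exists2 v, v \in V & nu2 v = 0%N)]].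

Inductive improper_sum : K -> Prop :=
| improper_sum_bnd y : y \in koszul_of k G -> improper_sum (dK y)
| improper_sum_hom mu c : factor_improper mu c -> improper_sum (hom mu c)
| improper_sumD x y : improper_sum x -> improper_sum y -> improper_sum (x + y).

Lemma improper_sum0 : improper_sum 0.
Proof. by rewrite -(raddf0 (@dK k s)); apply: improper_sum_bnd; rewrite rpred0. Qed.

Lemma cycles_ind_hom (T : K -> Prop) : T 0 -> (forall x y, T x -> T y -> T (x + y)) ->
  (forall mu c, supported G mu -> cyc E mu c -> T (hom mu c)) ->
  forall x, x \in cycles k G -> T x.
Proof.
move=> T0 TD Th x cx; rewrite (sum_hom_pr x).
elim/big_ind: _ => // mu _; have [->|nz] := pselect (pr mu x = 0).
  by rewrite raddf0.
apply: Th; last exact: cyc_pr.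
by apply: supported_pr nz; case/andP: cx.
Qed.

Lemma mdeg_gt0 mu : (0 < mdeg mu)%N -> exists u, (0 < mu u)%N.
Proof.
move=> m0; apply: contrapT => h; move: m0; rewrite mdegE big1 // => i _.
by apply/eqP; rewrite -leqn0 leqNgt; apply/negP => hi; apply: h; exists i.
Qed.

(** The multipliers [l] and [r] need not be homogeneous, so they are expanded into homogeneous
    cycles. *)
Lemma improper_sum_term (G' : graph s) mu (w l r : K) a : subgraph G' G -> G' <> G ->
  (0 < mdeg mu)%N -> multihomogeneous mu w -> w \in cycles k G' ->
  l \in cycles k G -> r \in cycles k G -> improper_sum (l * (a *: w) * r).
Proof.
move=> sG neq m0 hw cw cl cr.
have [w0|w0] := eqVneq w 0; first by rewrite w0 scaler0 mulr0 mul0r; exact: improper_sum0.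
have haw : a *: w = hom mu (pr mu (a *: w)).
  apply: hom_pr; apply/forallP => F; apply/allP => m; rewrite extZ => /msuppZ_le.
  by move: hw => /forallP/(_ F)/allP; apply.
have caw : a *: w \in cycles k G' by apply: rpredZ.
have [aw0|aw0] := pselect (pr mu (a *: w) = 0).
  by rewrite haw aw0 raddf0 mulr0 mul0r; exact: improper_sum0.
rewrite {}haw; set c := pr mu (a *: w) in aw0 *.
have cc : cyc (edges G') mu c by exact: cyc_pr.
have sm' : supported G' mu by apply: supported_pr aw0; case/andP: caw.
have /andP[sV sE] := sG.
have cE : cyc E mu c by apply: cycW cc.
have sm : supported G mu.
  by move=> v vV; apply: sm'; apply: contraNN vV; exact: (subsetP sV).
(* A proper subgraph misses a vertex, where [mu] then vanishes, or has all vertices and misses an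
   edge. *)
have prop : (exists2 e, e \in E & cyc (E :\ e) mu c) \/ (exists2 v, v \in V & mu v = 0%N).
  have [eV|/eqP nV] := eqVneq (verts G') V; last first.
    right; have : ~~ (V \subset verts G').
      by apply/negP => sV'; case: nV; apply/eqP; rewrite eqEsubset sV.
    by case/subsetPn=> v vV vV'; exists v => //; apply: sm'.
  left; have : ~~ (E \subset edges G').
    by apply/negP => sE'; apply: neq; apply: graph_eq => //; apply/eqP; rewrite eqEsubset sE.
  case/subsetPn=> e eE eE'; exists e => //.
  by apply: cycW cc => //; rewrite subsetD1 sE.
move: cl; apply: (cycles_ind_hom (T := fun l => improper_sum (l * hom mu c * r))).
- by rewrite !mul0r; exact: improper_sum0.
- by move=> x y hx hy; rewrite !mulrDl; exact: improper_sumD.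
move=> nu d snu cd; move: cr.
apply: (cycles_ind_hom (T := fun r => improper_sum (hom nu d * hom mu c * r))).
- by rewrite mulr0; exact: improper_sum0.
- by move=> x y hx hy; rewrite mulrDr; exact: improper_sumD.
move=> rho f srho cf; rewrite (homM cd.1 cE.1) (homM (chainM cd.1 cE.1) cf.1).
apply: improper_sum_hom; split.
- by move=> v vV; rewrite !mnmDE snu ?sm ?srho.
- by rewrite !mdegD; lia.
- by exists nu, mu, rho, d, c, f; split.
Qed.

(** The choice of representatives changes the cycle by a boundary, which [improper_sum] absorbs. *)
Lemma improper_sumP z : improper (hclass z) -> improper_sum (\val z).
Proof.
move=> [p [l [x [r [hx zE]]]]].
have hx' i : exists w : cycle k G, x i = hclass w /\
    forall l r, l \in cycles k G -> r \in cycles k G -> improper_sum (l * \val w * r).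
  have [G' [sG [b [neq [q [a [y [hy ->]]]]] xE]]] := hx i.
  have /choice[f hf] : forall j, exists w : cycle k G', exists2 mu, (0 < mdeg mu)%N &
      multihomogeneous mu (\val w) /\ y j = hclass w.
    by move=> j; have [mu m0 [w hw yE]] := hy j; exists w, mu.
  exists (cycle_incl sG (\sum_j a j *: f j)); split.
    rewrite xE -homology_mapE raddf_sum /=; congr homology_map; apply: eq_bigr => j _.
    by rewrite linearZ /=; have [mu _ [_ ->]] := hf j.
  move=> l' r' cl cr.
  have -> : \val (cycle_incl sG (\sum_j a j *: f j)) = \sum_j a j *: \val (f j).
    rewrite -[LHS]/(\val (\sum_j a j *: f j)) raddf_sum.
    by apply: eq_bigr => j _; apply: linearZ.
  rewrite big_distrr big_distrl /=.
  elim/big_ind: _ => [|u v|j _]; [exact: improper_sum0 | exact: improper_sumD |].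
  have [mu m0 [hw _]] := hf j.
  by apply: (improper_sum_term (a j) sG neq m0 hw _ cl cr); exact: valP.
have [f hf] := choice hx'.
pose z' := \sum_i repr (l i) * f i * repr (r i) : cycle k G.
have : hclass z = hclass z'.
  rewrite zE raddf_sum /=; apply: eq_bigr => i _; rewrite !rmorphM /= !hclass_repr.
  by have [-> _] := hf i.
move/hclassP/boundariesP => [y yK yE].
have -> : \val z = dK y + \val z' by rewrite -yE raddfB subrK.
apply: improper_sumD; first exact: improper_sum_bnd.
rewrite /z' raddf_sum; elim/big_ind: _ => [|u v|i _]; [exact: improper_sum0 | exact: improper_sumD |].
by have [_ h] := hf i; apply: (h (\val (repr (l i))) (\val (repr (r i)))); exact: valP.
Qed.

Lemma factor_cyc mu c : factor_improper mu c -> cyc E mu c.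
Proof.
move=> [_ _ [nu1 [nu2 [nu3 [l [x [r [[cl cx cr] -> -> _ _]]]]]]]].
apply: (cycM (mu := (nu1 + nu2)%MM)) cr; first by move=> v; rewrite !mnmDE.
by apply: cycM cl cx => v; rewrite mnmDE.
Qed.

Lemma improper_sum_positive x : improper_sum x ->
  x \in cycles k G /\ forall z, \val z = x -> positive_part k G (hclass z).
Proof.
elim=> {x} [y yK|mu c fc|x y _ [cx px] _ [cy py]].
- split; first by rewrite inE koszul_of_dK //= /dK koszul_koszul.
  by move=> z zE; rewrite (hclass_bnd yK zE); exact: linear_span0.
- have cc := factor_cyc fc; have [sm m0 _] := fc; split; first exact: hom_cycles.
  move=> z zE; apply: linear_span_gen; exists mu => //; exists z => //.
  by rewrite zE; apply: hom_multihomogeneous cc.1.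
split=> [|z zE]; first exact: rpredD.
have -> : z = Cycle cx + Cycle cy by apply: val_inj; rewrite zE raddfD.
by rewrite raddfD; apply: linear_spanD; [exact: px | exact: py].
Qed.

Lemma improper_positive a : improper a -> positive_part k G a.
Proof.
rewrite -(hclass_repr a) => /improper_sumP/improper_sum_positive[_]; exact.
Qed.

End Improper.

(** * The quotient of an eight *)

Section Labelling.
Variable s : nat.
Implicit Types (f : {set 'I_s}) (v : 'I_s).

(** A rotation of the labels puts the vertex to be glued at index 0. *)
Lemma cycle_label n (p : 'I_n -> 'I_s) (i0 : 'I_n) : injective p ->
  exists P : nat -> 'I_s, [/\ P 0%N = p i0, P n = P 0%N, inj_below P n,
    forall v, v \in [set p i | i : 'I_n] <-> exists2 i, (i < n)%N & v = P i &
    forall f, f \in [set [set p i; p (ordS i)] | i : 'I_n] <->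
      exists2 i, (i < n)%N & f = ed P i].
Proof.
move=> inj; have n0 : (0 < n)%N by apply: leq_ltn_trans (ltn_ord i0).
pose o i := Ordinal (ltn_pmod (i0 + i) n0); pose P i := p (o i).
have oS i : ordS (o i) = o i.+1.
  by apply: val_inj => /=; rewrite -addn1 modnDml addn1 addnS.
have osurj (j : 'I_n) : exists2 i, (i < n)%N & j = o i.
  have [le|lt] := leqP i0 j.
    exists (j - i0)%N; first by apply: leq_ltn_trans (leq_subr _ _) (ltn_ord j).
    by apply: val_inj; rewrite /= subnKC // modn_small.
  exists (j + n - i0)%N; first by have := ltn_ord i0; lia.
  apply: val_inj; rewrite /= subnKC; last by have := ltn_ord i0; lia.
  by rewrite modnDr modn_small.
exists P; split.
- by congr p; apply: val_inj; rewrite /= addn0 modn_small.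
- by congr p; apply: val_inj; rewrite /= modnDr addn0.
- move=> i j li lj /inj /(congr1 val) /= /eqP.
  by rewrite eqn_modDl !modn_small // => /eqP.
- move=> v; split=> [/imsetP[j _ ->]|[i li ->]]; last exact: imset_f.
  by have [i li ->] := osurj j; exists i.
move=> f; split=> [/imsetP[j _ ->]|[i li ->]].
  by have [i li ->] := osurj j; exists i; rewrite // oS.
by apply/imsetP; exists (o i); rewrite // oS.
Qed.

Lemma eight_config n m (G : graph s) : (2 < n)%N -> (2 < m)%N -> is_eight n m G ->
  exists P Q, eight (edges G) (verts G) P n Q m.
Proof.
move=> n2 m2 [C1 [C2 [[p [pinj V1 E1]] [q [qinj V2 E2]] [v Vv] VG EG]]].
have : v \in verts C1 :&: verts C2 by rewrite Vv inE.
rewrite inE V1 V2 => /andP[/imsetP[i0 _ vp] /imsetP[j0 _ vq]].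
have [P [P0 Pn Pinj PV PE]] := cycle_label i0 pinj.
have [Q [Q0 Qm Qinj QV QE]] := cycle_label j0 qinj.
rewrite -V1 in PV; rewrite -V2 in QV; rewrite -E1 in PE; rewrite -E2 in QE.
have common w : w \in verts C1 -> w \in verts C2 -> w = v.
  by move=> w1 w2; apply/set1P; rewrite -Vv inE w1.
have arc_of (C C' : graph s) R l : (2 < l)%N -> R l = R 0%N -> inj_below R l -> R 0%N = v ->
    (forall w, w \in verts C <-> exists2 i, (i < l)%N & w = R i) ->
    (forall f, f \in edges C <-> exists2 i, (i < l)%N & f = ed R i) ->
    (forall w, w \in verts C -> w \in verts C' -> w = v) ->
    arc (edges C :|: edges C') R l.
  move=> l2 Rl Rinj R0 RV RE cm; split=> // [i li|i f li].
    by rewrite inE; apply/orP; left; apply/RE; exists i.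
  (* An inner vertex differs from [v], so no edge of the other cycle contains it. *)
  have iv : R i <> v by rewrite -R0 => /Rinj; lia.
  rewrite inE => /orP[/RE[j lj ->]|fE] Ri.
    move: Ri; rewrite !inE => /orP[] /eqP e.
      by right; congr ed; apply/esym/Rinj => //; lia.
    have [jl|jl] := eqVneq j.+1 l; first by case: iv; rewrite e jl Rl.
    by left; have -> // : i = j.+1 by apply: Rinj => //; lia.
  case: iv; apply: cm; last by apply: (subsetP (edges_sub fE)).
  by apply/RV; exists i => //; lia.
have Pv : P 0%N = v by rewrite P0 -vp.
have Qv : Q 0%N = v by rewrite Q0 -vq.
have aP : arc (edges G) P n by rewrite EG; exact: (arc_of C1 C2 P n n2 Pn).
have aQ : arc (edges G) Q m.
  rewrite EG setUC; apply: (arc_of C2 C1 Q m m2 Qm) => // w w2 w1.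
  exact: common.
exists P, Q; split=> //.
- by rewrite Pv Qv.
- move=> i j li lj; apply/eqP => e.
  have /Pinj : P i = P 0%N; last by lia.
  rewrite Pv; apply: common; first by apply/PV; exists i => //; lia.
  by rewrite e; apply/QV; exists j => //; lia.
- by move=> f; rewrite EG inE => /orP[/PE|/QE]; [left | right].
- move=> w; rewrite VG inE; split=> [/orP[/PV|/QV]|[/PV ->|/QV ->]]; rewrite ?orbT //.
    by left.
  by right.
Qed.

End Labelling.

Section Main.
Variables (k : fieldType) (s : nat) (G : graph s) (P : nat -> 'I_s) (n : nat)
  (Q : nat -> 'I_s) (m : nat).
Local Notation E := (edges G).
Local Notation V := (verts G).
Local Notation improper := (improper_classes k G).
Local Notation C := (ext k {set 'I_s}).
Implicit Types (mu nu : 'X_{1..s}) (c : C) (z : cycle k G) (a : homology k G).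
Hypothesis cfg : eight E V P n Q m.
Let aP := eight_l cfg.
Let aQ := eight_r cfg.
Let PQ := eight_c cfg.
Let n2 : (2 < n)%N := arc_gt2 aP.
Let m2 : (2 < m)%N := arc_gt2 aQ.
Local Notation mu0 := (M P Q 2 1 n 1 m).

Lemma mu0_supported : supported G mu0.
Proof.
move=> w wV; rewrite ME rg_out => [|i li]; last first.
  by apply: contraNneq wV => ->; apply: (P_vert cfg); lia.
rewrite rg_out => [|i li]; last first.
  by apply: contraNneq wV => ->; apply: (Q_vert cfg); lia.
have : P 0%N \in V by apply: (P_vert cfg); lia.
by case: eqP wV => [->|]; rewrite ?muln0 // => /negPf ->.
Qed.

Lemma mu0_pos w : w \in V -> (0 < mu0 w)%N.
Proof.
move=> /(eight_vert cfg)[] [i li ->].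
  have [->|i0] := posnP i; first by rewrite (M_c cfg) //; lia.
  by rewrite (M_P cfg) //; lia.
have [->|i0] := posnP i; first by rewrite -PQ (M_c cfg) //; lia.
by rewrite (M_Q cfg) //; lia.
Qed.

Lemma mu0_mdeg : (0 < mdeg mu0)%N.
Proof.
have := mu0_pos (P_vert cfg (i := 0) _); move=> /(_ ltac:(lia)) h.
by rewrite lt0n mdeg_eq0; apply: contraTneq h => ->; rewrite mnm0E.
Qed.

(** If an outer factor has positive degree, [product_bnd] applies. Otherwise the middle factor
    carries the whole multidegree, which is positive at every vertex, so that factor avoids an
    edge. *)
Lemma factor_bnd c : (n %% 3 = 1)%N -> (m %% 3 = 1)%N ->
  factor_improper G mu0 c -> bnd E mu0 c.
Proof.
move=> n3 m3 [_ _ [nu1 [nu2 [nu3 [l [x [r [[cl cx cr] muE -> m20 prop]]]]]]]].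
have [u2 hu2] := mdeg_gt0 m20.
have [nu10|/eqP nu1_neq0] := eqVneq nu1 0%MM; last first.
  have [u1 hu1] : exists u, (0 < nu1 u)%N.
    by apply: mdeg_gt0; rewrite lt0n mdeg_eq0; apply/eqP.
  rewrite -mulrA; apply: (product_bnd cfg n3 m3 (nu := nu1) (rho := (nu2 + nu3)%MM)) hu1 _ cl _.
  - by move=> w; rewrite muE !mnmDE addnA.
  - by instantiate (1 := u2); rewrite mnmDE; lia.
  - by apply: cycM cx cr => w; rewrite mnmDE.
have [nu30|/eqP nu3_neq0] := eqVneq nu3 0%MM; last first.
  have [u3 hu3] : exists u, (0 < nu3 u)%N.
    by apply: mdeg_gt0; rewrite lt0n mdeg_eq0; apply/eqP.
  apply: (product_bnd cfg n3 m3 (nu := (nu1 + nu2)%MM) (rho := nu3) (u := u2)) hu3 _ cr.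
  - by move=> w; rewrite muE !mnmDE.
  - by rewrite mnmDE; lia.
  - by apply: cycM cl cx => w; rewrite mnmDE.
case: prop => [[e eE cx']|[v vV v0]]; last first.
  by have := mu0_pos vV; rewrite muE !mnmDE v0 nu10 nu30 !mnm0E.
have [v ve _] := edge_noncenter cfg eE.
apply: (del_edge_bnd cfg n3 m3 eE).
have cl' : cyc (E :\ e) nu1 l by apply: cyc_dead ve _ cl; rewrite nu10 mnm0E.
have cr' : cyc (E :\ e) nu3 r by apply: cyc_dead ve _ cr; rewrite nu30 mnm0E.
rewrite muE; apply: (cycM (mu := (nu1 + nu2)%MM)) cr'; first by move=> w; rewrite !mnmDE.
by apply: cycM cl' cx' => w; rewrite mnmDE.
Qed.

Lemma improper_sum_pr x : (n %% 3 = 1)%N -> (m %% 3 = 1)%N ->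
  improper_sum G x -> bnd E mu0 (pr mu0 x : C).
Proof.
move=> n3 m3; elim=> {x} [y yK|mu c fc|x y _ bx _ by_].
- by exists (pr mu0 y); [exact: chain_pr | rewrite pr_dK].
- have cc := factor_cyc fc; have [mE|/eqP mE] := eqVneq mu mu0.
    by rewrite mE in fc cc *; rewrite (pr_hom cc.1); apply: factor_bnd.
  by rewrite (pr_hom_neq cc.1 (nesym mE)); exact: bnd0.
by rewrite raddfD; apply: bndD.
Qed.

Lemma homogeneous_imp mu z : (0 < mdeg mu)%N -> multihomogeneous mu (\val z) ->
  (n %% 3 = 1 -> m %% 3 = 1 -> mu != mu0)%N -> improper (hclass z).
Proof.
move=> md hz hmu; have zE := hom_pr hz; have cz := cyc_pr mu (valP z).
have [c0|c0] := pselect (pr mu (\val z) = 0).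
  rewrite (hclass_bnd (y := 0)); [exact: ideal_span0 | exact: rpred0 |].
  by rewrite zE c0 !raddf0.
have sm : supported G mu.
  by apply: supported_pr c0; have /andP[] := valP z.
have [u hu] := mdeg_gt0 md.
exact: (imp_improper sm md (imp_all cfg hu sm cz hmu) zE).
Qed.

Lemma ext_mul_const (x y : C) : chain E 0%MM y -> forall F, (x * y) F = x F * y set0.
Proof.
move=> hy F; have y0 T : T != set0 -> y T = 0.
  case/set0Pn=> f fT; apply/eqP; apply: contraT => /hy/faceP[/subsetP TE h].
  have [v vf _] := edge_noncenter cfg (TE _ fT).
  by have := leq_trans (deg_mem v fT) (h v); rewrite edge_mnmE vf mnm0E.
rewrite extM (bigD1 F) //= (bigD1 set0) /=; last first.
  by rewrite setU0 eqxx -setI_eq0 setI0 eqxx.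
rewrite inversions0r mul1r !big1 ?addr0 // => [S nS|T /andP[_ nT]].
  apply: big1 => T /andP[_ /eqP TE]; rewrite y0 ?mulr0 //.
  by apply: contraNneq nS => T0; rewrite -TE T0 setU0.
by rewrite y0 ?mulr0.
Qed.

Section OneOne.
Hypotheses (n3 : (n %% 3 = 1)%N) (m3 : (m %% 3 = 1)%N).

Lemma proper_class : exists a, [/\ positive_part k G a, ~ improper a &
  forall b mu, (0 < mdeg mu)%N -> homogeneous_class mu b ->
    exists t : k, improper (b - t *: a)].
Proof.
have [zeta cz zE] := exists_zeta k cfg n3 m3.
pose Z := Cycle (hom_cycles cz mu0_supported).
exists (hclass Z); split.
- apply: linear_span_gen; exists mu0; first exact: mu0_mdeg.
  by exists Z => //; apply: hom_multihomogeneous cz.1.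
- move=> /improper_sumP /(improper_sum_pr n3 m3); rewrite (pr_hom cz.1).
  exact: (zeta_not_bnd cfg n3 m3 zE).
move=> b mu md [z hz ->]; have [mE|mE] := eqVneq mu mu0; last first.
  by exists 0; rewrite scale0r subr0; apply: homogeneous_imp md hz _.
rewrite mE in hz *; have hzE := hom_pr hz; have cc := cyc_pr mu0 (valP z).
have [y cy [w hw wE]] := zeta_gen cfg n3 m3 cz zE cc.
(* A chain of multidegree 0 is the scalar given by its coefficient on the empty set. *)
exists (y set0).
have -> : hclass z - y set0 *: hclass Z = hclass (z - y set0 *: Z).
  rewrite raddfB; congr (_ - _); exact/esym/hclass_is_scalable.
have cy0 : chain E 0%MM y.
  by apply: chainW cy.1 => // v; rewrite ME mnm0E !rg_nil.
rewrite (hclass_bnd (y := hom mu0 w)).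
- exact: ideal_span0.
- by apply: hom_koszul hw _; exact: mu0_supported.
rewrite (dK_hom hw) -wE.
transitivity (\val z - hom mu0 (zeta * y)); last by rewrite [in LHS]hzE -raddfB.
rewrite raddfB; congr (_ - _); rewrite -[LHS]/(y set0 *: hom mu0 zeta).
apply/ext_eqP => F; rewrite extZ !homE ext_mul_const // scalerA mulrC.
by [].
Qed.

End OneOne.
Lemma quotient_dim0 : ~ ((n %% 3 = 1)%N /\ (m %% 3 = 1)%N) ->
  quotient_dim (positive_part k G) improper 0.
Proof.
move=> nm; split; first by move=> a; exact: improper_positive.
exists (fun=> 0); split=> [[]//|v [p [c [x [hx ->]]]]].
exists 0; split=> [|c' _]; last by apply/rowP => -[].
rewrite big_ord0 subr0; apply: ideal_span_sum => i; apply: ideal_spanZ.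
have [mu md [z hz ->]] := hx i; apply: (homogeneous_imp md hz) => h1 h2.
by case: nm.
Qed.

Lemma quotient_dim1 : (n %% 3 = 1)%N -> (m %% 3 = 1)%N ->
  quotient_dim (positive_part k G) improper 1.
Proof.
move=> n3 m3; split; first by move=> a; exact: improper_positive.
have [a [pa na ha]] := proper_class n3 m3.
exists (fun=> a); split=> // v [p [c [x [hx ->]]]].
have /choice[t ht] : forall i, exists t : k, improper (x i - t *: a).
  by move=> i; have [mu md hmu] := hx i; exact: ha hmu.
have impv : improper (\sum_i c i *: x i - (\sum_i c i * t i) *: a).
  rewrite scaler_suml -sumrB; apply: ideal_span_sum => i.
  by rewrite -scalerA -scalerBr; apply/ideal_spanZ/ht.
exists (const_mx (\sum_i c i * t i)); split; first by rewrite big_ord1 mxE.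
move=> c'; rewrite big_ord1 => hc'; apply/rowP => i; rewrite mxE ord1.
(* Two different coefficients would make a nonzero multiple of [a], hence [a] itself, improper. *)
apply/eqP; rewrite -subr_eq0; apply: contraT => nz; case: na.
rewrite -[a]scale1r -(mulVf nz) -scalerA; apply: ideal_spanZ.
have := ideal_spanD hc' (ideal_spanZ (-1) impv).
by rewrite scaleN1r opprB addrC addrA subrK -scalerBl.
Qed.

End Main.

Local Close Scope ring_scope.

Theorem theorem76 (k : fieldType) (n m : nat) (hn : 3 <= n) (hm : 3 <= m)
    (s : nat) (G : graph s) (hG : is_eight n m G) :
  (n <> 1 %[mod 3] \/ m <> 1 %[mod 3] ->
     quotient_dim (positive_part k G) (improper_classes k G) 0)
  /\ (m = 1 %[mod 3] -> n = 1 %[mod 3] ->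
     quotient_dim (positive_part k G) (improper_classes k G) 1).
Proof.
have [P [Q cfg]] := eight_config hn hm hG; split=> [nm|m3 n3].
  by apply: (quotient_dim0 k cfg) => -[n3 m3]; case: nm => [[]|[]].
exact: (quotient_dim1 k cfg n3 m3).
Qed.
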